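(* Let $X\in\{A,B\}$ (Case A: $t,t_N$ algebraically independent; Case B: $t_N=t^m$, $m\in\mathbb N_+$). For all $\alpha\le\beta$ in $\mathcal P_N=\{1,2\}^N$, the generating function of ballot strip configurations under Rule I (sign $\epsilon=+$) equals the parabolic Kazhdan–Lusztig polynomial of the module $\mathcal M^+$: $$Q^{X,I,+}_{\alpha,\beta}=P^{X,+}_{\alpha,\beta}.$$
   Context: Order and length: $\alpha\le\beta$ (Bruhat order) iff every prefix of $\alpha$ contains at least as many $1$'s as the prefix of $\beta$ of the same length. If $p_1<\dots<p_r$ are the positions of the $2$'s in $\alpha$, put $\mathbf t^{|\alpha|}=t^{\sum_k(N-p_k)}t_N^{\,r}$ (with $t_N=t^m$ in Case B) and $\mathbf t^{|\alpha|-|\beta|}=\mathbf t^{|\alpha|}/\mathbf t^{|\beta|}$. Kazhdan–Lusztig polynomials. The Iwahori–Hecke algebra $\mathcal H$ of type $B_N$ over $\mathbb C[t^{\pm1},t_N^{\pm1}]$ has generators $T_1,\dots,T_N$, the type $B_N$ braid relations (bond of order 4 between $N-1$ and $N$), $(T_i-t)(T_i+t^{-1})=0$ for $i<N$ and $(T_N-t_N)(T_N+t_N^{-1})=0$. Bar involution: $T_i\mapsto T_i^{-1}$, $t\mapsto t^{-1}$, $t_N\mapsto t_N^{-1}$. The module $\mathcal M^+$ has basis $\{m_\alpha:\alpha\in\mathcal P_N\}$ with, for $i<N$: $T_im_\alpha=t\,m_\alpha$ if $\alpha_i=\alpha_{i+1}$; $m_{s_i\cdot\alpha}$ if $\alpha_i<\alpha_{i+1}$;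 $m_{s_i\cdot\alpha}+(t-t^{-1})m_\alpha$ if $\alpha_i>\alpha_{i+1}$; and $T_Nm_\alpha=m_{s_N\cdot\alpha}$ if $\alpha_N=1$, $m_{s_N\cdot\alpha}+(t_N-t_N^{-1})m_\alpha$ if $\alpha_N=2$ ($s_i$ exchanges $\alpha_i,\alpha_{i+1}$; $s_N$ replaces $\alpha_N$ by $3-\alpha_N$). The bar involution on $\mathcal M^+$ is semilinear with $\overline{m_{1\ldots1}}=m_{1\ldots1}$, $\overline{hv}=\bar h\bar v$. Let $\Gamma_+^A=\{t^it_N^j: i>0,j\in\mathbb Z\}\cup\{t_N^i:i>0\}$, $\Gamma_+^B=\{t^i:i>0\}$, $\Gamma^X_-=\{g^{-1}:g\in\Gamma^X_+\}$. There is a unique bar-invariant basis $C^{X,+}_\beta=\sum_{\alpha\le\beta}\mathbf t^{|\alpha|-|\beta|}P^{X,+}_{\alpha,\beta}m_\alpha$ with $P^{X,+}_{\beta,\beta}=1$ and $\mathbf t^{|\alpha|-|\beta|}P^{X,+}_{\alpha,\beta}$ in the $\mathbb Z$-span of $\Gamma^X_-$ for $\alpha<\beta$. Generating function $Q^{X,I,+}$. A string $\alpha$ is identified with the lattice path from $(0,0)$ whose $i$-th step is $(1,1)$ if $\alpha_i=1$ and $(1,-1)$ if $\alpha_i=2$; $\alpha\le\beta$ iff path $\alpha$ is weakly above path $\beta$. A box $(i,j)$ is the 45-degree rotated square centred at $(i,j)$ with vertices $(i\pm1,j),(i,j\pm1)$. $\lambda^+(\alpha)$ is the set of boxes $(i,j)$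 with $0<i\le N$, $|j|\le i$, $i+j-1$ even, above the path $\alpha$. The region for $\alpha\le\beta$ is $\lambda^+(\beta)/\lambda^+(\alpha)$, i.e. the boxes between the two paths; its boxes $(N,j)$ are anchor boxes. The box just below $(x,y)$ is $(x,y-2)$. A ballot path of length $(l,l')\in\mathbb N^2$ is a path with steps $(1,\pm1)$ from some $(x,y)$ to $(x+2l+l',y+l')$ staying weakly above height $y$; a ballot strip of length $(l,l')$ is the set of boxes centred at its vertices (a single box has length $(0,0)$). $\mathrm{Conf}^{I}(\alpha,\beta)$ is the set of partitions of the boxes of the region into ballot strips such that: (Rule 0) the rightmost box of a strip with $l'\ge1$ is an anchor box; (Rule Ia) for strips $\mathcal D,\mathcal D'$, if some box of $\mathcal D$ is just below a box of $\mathcal D'$, then all boxes just below a box of $\mathcal D'$ belong to $\mathcal D$; (Rule Ib, Case B only) for each $(l,l')$ with $l'\ge m$, the number of strips of length $(l,l')$ is even if $l'-m$ is even, and zero otherwise. Weight of a strip of length $(l,l')$ under Rule I: in Case A, $t^{2l+l'}$ if $l'$ is even and $-t^{2l+l'-1}t_N^2$ if $l'$ is odd; in Case B, $t^{2l+2l'}$ if $0\le l'\le m-1$, $t^{m+l'+2l}$ if $l'\ge m$ and $l'-m$ even, $t^{m+l'+2l-1}$ if $l'\ge m$ and $l'-m$ odd. $Q^{X,I,+}_{\alpha,\beta}$ is the sum over $\mathrm{Conf}^{I}(\alpha,\beta)$ of the product of the weights of the strips ($Q^{X,I,+}_{\alpha,\alpha}=1$). *)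

(* Defs.v *)
From HB Require Import structures.
From mathcomp Require Import all_boot all_order all_fingroup all_algebra.
From mathcomp Require Import generic_quotient complex finmap monalg ring.
From mathcomp Require Import boolp.
From mathcomp Require classical_sets.

Set Implicit Arguments.
Unset Strict Implicit.
Unset Printing Implicit Defensive.

Import GRing.Theory Num.Theory.
Local Open Scope ring_scope.
Local Open Scope quotient_scope.

(* Laurent polynomials: the group algebra K[G] of an abelian group G of       *)
(* exponents, written additively. {malg K[G]} is given a product by the       *)
(* library only for monoids without nontrivial units, hence this alias.       *)
Definition laurent (K : comNzRingType) (G : zmodType) := {malg K[G]}.

Section Laurent.
Context {K : comNzRingType} {G : zmodType}.
Local Notation L := (laurent K G).
Implicit Types (f : L) (g : G).

HB.instance Definition _ := GRing.Zmodule.on L.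

Definition mono g : L := << (1 : K) *g g >>.

Definition lmul f1 f2 : L :=
  \sum_(a <- msupp f1) \sum_(b <- msupp f2) << f1@_a * f2@_b *g a + b >>.

Fact lmulEw (d1 d2 : {fset G}) f1 f2 :
    (msupp f1 `<=` d1)%fset -> (msupp f2 `<=` d2)%fset ->
  lmul f1 f2 = \sum_(a <- d1) \sum_(b <- d2) << f1@_a * f2@_b *g a + b >>.
Proof.
move=> le1 le2; rewrite /lmul (big_fset_incl _ le1) /=.
  apply/eq_bigr=> a _; apply/big_fset_incl => // b _ /mcoeff_outdom ->.
  by rewrite mulr0 monalgU0.
move=> a _ /mcoeff_outdom f1a.
by rewrite big1 => // b _; rewrite f1a mul0r monalgU0.
Qed.

Fact lmulC : commutative lmul.
Proof.
move=> f1 f2; rewrite /lmul exchange_big /=.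
by apply/eq_bigr=> b _; apply/eq_bigr=> a _; rewrite mulrC addrC.
Qed.

Fact lmulDl : left_distributive lmul +%R.
Proof.
move=> f1 f2 f.
rewrite (lmulEw (msuppD_le f1 f2) (fsubset_refl _)).
rewrite (lmulEw (fsubsetUl (msupp f1) (msupp f2)) (fsubset_refl (msupp f))).
rewrite (lmulEw (fsubsetUr (msupp f1) (msupp f2)) (fsubset_refl (msupp f))).
rewrite -big_split /=; apply/eq_bigr=> a _.
rewrite -big_split /=; apply/eq_bigr=> b _.
by rewrite mcoeffD mulrDl monalgUD.
Qed.

Fact lmulDr : right_distributive lmul +%R.
Proof. by move=> f f1 f2; rewrite !(lmulC f) lmulDl. Qed.

Fact lmul0 f : lmul 0 f = 0.
Proof. by rewrite /lmul msupp0 big_seq_fset0. Qed.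

Fact lmul0r f : lmul f 0 = 0. Proof. by rewrite lmulC lmul0. Qed.

Fact lmulUU (c d : K) a b :
  lmul << c *g a >> << d *g b >> = << c * d *g a + b >>.
Proof. by rewrite (lmulEw msuppU_le msuppU_le) !big_seq_fset1 !mcoeffUU. Qed.

Fact lmul_suml I (r : seq I) (F : I -> L) f :
  lmul (\sum_(i <- r) F i) f = \sum_(i <- r) lmul (F i) f.
Proof. exact: (big_morph (lmul^~ f) (fun x y => lmulDl x y f) (lmul0 f)). Qed.

Fact lmul_sumr I (r : seq I) (F : I -> L) f :
  lmul f (\sum_(i <- r) F i) = \sum_(i <- r) lmul f (F i).
Proof. by rewrite lmulC lmul_suml; apply: eq_bigr => i _; rewrite lmulC. Qed.

Fact lmulA : associative lmul.
Proof.
move: (@lmul_suml) (@lmul_sumr) lmulUU; move: lmul => mul suml sumr mulUU f1 f2 f3.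
rewrite [f1]monalgE !suml; apply: eq_bigr => a _.
rewrite [f2]monalgE suml !sumr suml; apply: eq_bigr => b _.
rewrite [f3]monalgE !sumr; apply: eq_bigr => c _.
by rewrite !mulUU mulrA addrA.
Qed.

Fact lmul1 : left_id (mono 0) lmul.
Proof.
move=> f; rewrite {1}[f]monalgE lmul_sumr [RHS]monalgE.
by apply: eq_bigr => a _; rewrite lmulUU mul1r add0r.
Qed.

Fact lone_neq0 : mono 0 != 0.
Proof. by rewrite monalgU_eq0 oner_neq0. Qed.

HB.instance Definition _ := GRing.Zmodule_isComNzRing.Build L
  lmulA lmulC lmul1 lmulDl lone_neq0.

Lemma monoD a b : mono (a + b) = mono a * mono b.
Proof. by rewrite [RHS]lmulUU mulr1. Qed.

Lemma mono0 : mono 0 = 1. Proof. by []. Qed.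

Lemma monoV a : mono a * mono (- a) = 1.
Proof. by rewrite -monoD subrr. Qed.

Definition lbar f : L := \sum_(a <- msupp f) << f@_a *g - a >>.

Fact lbarEw (d : {fset G}) f : (msupp f `<=` d)%fset ->
  lbar f = \sum_(a <- d) << f@_a *g - a >>.
Proof.
move=> le; rewrite /lbar (big_fset_incl _ le) //= => a _ /mcoeff_outdom ->.
by rewrite monalgU0.
Qed.

Lemma lbarU (c : K) a : lbar << c *g a >> = << c *g - a >>.
Proof. by rewrite (lbarEw msuppU_le) big_seq_fset1 mcoeffUU. Qed.

Fact lbarD : {morph lbar : f1 f2 / f1 + f2}.
Proof.
move=> f1 f2; rewrite (lbarEw (msuppD_le f1 f2)).
rewrite (lbarEw (fsubsetUl _ (msupp f2))) (lbarEw (fsubsetUr (msupp f1) _)).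
by rewrite -big_split; apply: eq_bigr => a _; rewrite mcoeffD monalgUD.
Qed.

Fact lbar0 : lbar 0 = 0.
Proof. by rewrite /lbar msupp0 big_seq_fset0. Qed.

Fact lbar_sum I (r : seq I) (F : I -> L) :
  lbar (\sum_(i <- r) F i) = \sum_(i <- r) lbar (F i).
Proof. exact: (big_morph lbar lbarD lbar0). Qed.

Fact lbarB : zmod_morphism lbar.
Proof.
move=> f1 f2; apply/eqP; rewrite eq_sym subr_eq; apply/eqP.
by rewrite -lbarD subrK.
Qed.

Fact lbar_monoid : monoid_morphism lbar.
Proof.
split=> [|f1 f2]; first by rewrite [1]/(mono 0) lbarU oppr0.
rewrite [f1]monalgE [f2]monalgE mulr_suml !lbar_sum mulr_suml.
apply: eq_bigr => a _; rewrite !mulr_sumr lbar_sum; apply: eq_bigr => b _.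
by rewrite [X in lbar X]lmulUU !lbarU [RHS]lmulUU opprD.
Qed.

HB.instance Definition _ := GRing.isZmodMorphism.Build L L lbar lbarB.
HB.instance Definition _ := GRing.isMonoidMorphism.Build L L lbar lbar_monoid.

Lemma lbar_mono a : lbar (mono a) = mono (- a). Proof. exact: lbarU. Qed.

Definition Zspan (S : G -> Prop) (f : L) : Prop :=
  exists r : seq (int * G),
    (forall p, p \in r -> S p.2) /\ f = \sum_(p <- r) mono p.2 *~ p.1.

End Laurent.

(* The two cases: t and t_N independent (exponents in Z^2), or t_N = t ^ m    *)
(* (exponents in Z).                                                          *)
Variant kl_case := CaseA | CaseB of nat.

Definition kl_case_ok (X : kl_case) : bool :=
  if X is CaseB m then (0 < m)%N else true.

Definition expo (X : kl_case) : zmodType :=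
  match X with CaseA => (int * int)%type | CaseB _ => int end.

Definition e_t (X : kl_case) : expo X :=
  match X with CaseA => (1, 0) | CaseB _ => 1 end.

Definition e_tN (X : kl_case) : expo X :=
  match X with CaseA => (0, 1) | CaseB m => m%:Z end.

Definition Gamma_pos (X : kl_case) : expo X -> Prop :=
  match X with
  | CaseA => fun g =>
      (exists i j : int, 0 < i /\ g = e_t CaseA *~ i + e_tN CaseA *~ j)
      \/ (exists i : int, 0 < i /\ g = e_tN CaseA *~ i)
  | CaseB m => fun g => exists i : int, 0 < i /\ g = e_t (CaseB m) *~ i
  end.

Definition Gamma_neg (X : kl_case) (g : expo X) : Prop := Gamma_pos (- g).

(* Strings in {1,2}^N: [true] stands for the letter 2, [false] for 1, and     *)
(* positions are numbered from 0.                                             *)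
Definition word (N : nat) := {ffun 'I_N -> bool}.

Section Words.
Context {N : nat}.
Implicit Types (i j : 'I_N) (a b : word N).

(* At the last position, [nxt i] is [i] itself.                               *)
Definition nxt i : 'I_N := insubd i i.+1.

Definition is_last i : bool := i.+1 == N.

Definition word1 : word N := [ffun => false].

Definition sact i a : word N :=
  if is_last i then [ffun k => if k == i then ~~ a k else a k]
  else [ffun k => a (tperm i (nxt i) k)].

(* The number of 1's in the prefix of length k.                               *)
Definition ones a (k : nat) : nat := #|[set i : 'I_N | (i < k)%N && ~~ a i]|.

Definition bruhat a b : bool := [forall k : 'I_N.+1, (ones b k <= ones a k)%N].

(* The exponent of t^|a|; the 1-based position of [i] is [i.+1].              *)
Definition wexp (X : kl_case) a : expo X :=
  \sum_(i | a i) (e_t X *+ (N - i.+1) + e_tN X).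

Lemma val_nxt i : ~~ is_last i -> nxt i = i.+1 :> nat.
Proof.
move=> ni; rewrite /nxt val_insubd.
by rewrite ltn_neqAle [i.+1 == N](negbTE ni) ltn_ord.
Qed.

End Words.

Section HeckeModule.
Context (K : comNzRingType) (X : kl_case) (N : nat).
Local Notation L := (laurent K (expo X)).
Local Notation W := (word N).
Local Notation M := {ffun W -> L^o}.
Implicit Types (i j : 'I_N) (a b : W) (v w : M) (c d : L).

(* [tpar i] is t for the generators T_1, ..., T_(N-1) and t_N for T_N.       *)
Definition e_gen i : expo X := if is_last i then e_tN X else e_t X.
Definition tpar i : L := mono (e_gen i).
Definition tparV i : L := mono (- e_gen i).

Fact tparK i : tpar i * tparV i = 1. Proof. exact: monoV. Qed.

Definition mbasis a : M := [ffun b => (a == b)%:R].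

Definition Tbasis i a : M :=
  if is_last i then
    mbasis (sact i a) + (if a i then (tpar i - tparV i) *: mbasis a else 0)
  else if a i == a (nxt i) then tpar i *: mbasis a
  else mbasis (sact i a) + (if a i then (tpar i - tparV i) *: mbasis a else 0).

Definition Top i v : M := \sum_a v a *: Tbasis i a.

Lemma sactK i : involutive (sact i).
Proof.
move=> a; apply/ffunP => k; rewrite /sact.
case li: (is_last i); rewrite !ffunE; last by rewrite tpermK.
by case: eqP => _; rewrite ?negbK.
Qed.

Lemma sact_fix i a : ~~ is_last i -> a i = a (nxt i) -> sact i a = a.
Proof.
move=> /negbTE li e; apply/ffunP => k; rewrite /sact li ffunE.
by case: tpermP => // ->.
Qed.

Lemma sact_at i a : ~~ is_last i -> sact i a i = a (nxt i).
Proof. by move=> /negbTE li; rewrite /sact li ffunE tpermL. Qed.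

Lemma sact_nxt i a : ~~ is_last i -> sact i a (nxt i) = a i.
Proof. by move=> /negbTE li; rewrite /sact li ffunE tpermR. Qed.

Lemma sum_mbasis v : v = \sum_a v a *: mbasis a.
Proof.
apply/ffunP => b; rewrite sum_ffunE (bigD1 b) //= big1 => [|a ab].
  by rewrite !ffunE eqxx addr0 /GRing.scale /= mulr1.
by rewrite !ffunE (negbTE ab) scaler0.
Qed.

Definition flat i a : bool := ~~ is_last i && (a i == a (nxt i)).

Lemma flat_sact i a : flat i (sact i a) = flat i a.
Proof.
rewrite /flat; case li: (is_last i) => //=.
by rewrite sact_at ?sact_nxt ?li // eq_sym.
Qed.

Fact sum_pick v (F : W -> L) b : \sum_a v a * (F a * (a == b)%:R) = v b * F b.
Proof.
rewrite (bigD1 b) //= big1 => [|a ab]; first by rewrite eqxx mulr1 addr0.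
by rewrite (negbTE ab) !mulr0.
Qed.

Lemma TopE i v a : Top i v a =
  if flat i a then tpar i * v a
  else v (sact i a) + (if a i then (tpar i - tparV i) * v a else 0).
Proof.
pose F b : L := if flat i b then tpar i else if b i then tpar i - tparV i else 0.
pose G b : L := if flat i b then 0 else 1.
have E b : Tbasis i b a = F b * (b == a)%:R + G b * (b == sact i a)%:R.
  have -> : (b == sact i a) = (sact i b == a).
    by apply/eqP/eqP => [->|<-]; rewrite sactK.
  rewrite /Tbasis /F /G /flat /mbasis.
  case: (is_last i) => /=; last case: (b i == b (nxt i));
    case: (b i); rewrite !ffunE /GRing.scale /=; ring.
rewrite /Top sum_ffunE.
under eq_bigr => b _ do
  rewrite ffunE /GRing.scale /= E mulrDr.
rewrite big_split /= !sum_pick /F /G flat_sact.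
by case: (flat i a) => /=; case: (a i); ring.
Qed.

Lemma Top_basis i a : Top i (mbasis a) = Tbasis i a.
Proof.
rewrite /Top (bigD1 a) //= big1 => [|b ba].
  by rewrite ffunE eqxx scale1r addr0.
by rewrite ffunE eq_sym (negbTE ba) scale0r.
Qed.

Lemma TopD i v w : Top i (v + w) = Top i v + Top i w.
Proof.
by rewrite -big_split; apply: eq_bigr => a _; rewrite ffunE scalerDl.
Qed.

Lemma TopZ i c v : Top i (c *: v) = c *: Top i v.
Proof.
by rewrite scaler_sumr; apply: eq_bigr => a _; rewrite ffunE scalerA.
Qed.

Lemma Top_sq i v : Top i (Top i v) = (tpar i - tparV i) *: Top i v + v.
Proof.
move: (Top i) (TopE i) => T TE; apply/ffunP => a.
have -> : ((tpar i - tparV i) *: T v + v) a = (tpar i - tparV i) * T v a + v a.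
  by rewrite ffunE ffunE.
rewrite !TE flat_sact sactK.
have := tparK i; set x := tpar i; set y := tparV i => xy.
case fa: (flat i a); first by ring: xy.
have -> : sact i a i = ~~ a i.
  move: fa; rewrite /flat; case li: (is_last i) => /=.
    by rewrite /sact li ffunE eqxx.
  by rewrite sact_at ?li //; case: (a i) (a (nxt i)) => [] [].
by case: (a i) => /=; ring: xy.
Qed.

Section FarPair.
Context (i j : 'I_N) (far : (i.+1 < j)%N).

Let li : ~~ is_last i.
Proof.
apply/eqP => e; have := ltn_trans far (ltn_ord j).
by rewrite e ltnn.
Qed.

Let ij : i != j.
Proof. by apply/eqP => e; move: far; rewrite e ltnNge leqnSn. Qed.

Let nij : nxt i != j.
Proof.
by apply/eqP => /(congr1 val) /= e; move: far; rewrite -e val_nxt // ltnn.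
Qed.

Let inj k : k = i \/ k = nxt i -> ~~ is_last j -> k != nxt j.
Proof.
move=> ki lj; apply/eqP => /(congr1 val) /=; rewrite val_nxt // => e.
have : (k <= i.+1)%N by case: ki => ->; rewrite ?val_nxt.
by rewrite e leqNgt ltnS (leq_trans (ltnW far)).
Qed.

Let sactj_fix a k : k = i \/ k = nxt i -> sact j a k = a k.
Proof.
move=> ki; have kj : k != j by case: ki => ->.
rewrite /sact; case lj: (is_last j); rewrite ffunE ?(negbTE kj) //.
by rewrite tpermD // eq_sym ?inj ?lj.
Qed.

Let sacti_fix a k : k = j \/ k = nxt j -> sact i a k = a k.
Proof.
move=> kj; rewrite /sact (negbTE li) ffunE.
case lj: (is_last j); last first.
  rewrite tpermD //; case: kj => ->; rewrite ?inj ?lj //; by [left|right|].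
have -> : k = j.
  case: kj => // ->; apply: val_inj; rewrite /= /nxt val_insubd.
  by move/eqP: lj => ->; rewrite ltnn.
by rewrite tpermD.
Qed.

Let sactC a : sact i (sact j a) = sact j (sact i a).
Proof.
apply/ffunP => k; rewrite {1}/sact (negbTE li) ffunE.
case: tpermP => [->|->|/eqP ki /eqP kni].
- by rewrite !sactj_fix ?sact_at //; [left|right].
- by rewrite !sactj_fix ?sact_nxt //; [right|left].
have fixi b : k \notin [:: i; nxt i] -> sact i b k = b k.
  by rewrite !inE negb_or => /andP[? ?]; rewrite /sact (negbTE li) ffunE tpermD // eq_sym.
have kP : k \notin [:: i; nxt i] by rewrite !inE negb_or ki kni.
rewrite {1 2}/sact; case lj: (is_last j); rewrite !ffunE ?fixi //.
by case: tpermP => [_|_|_ _]; rewrite ?fixi ?sacti_fix //; [right|left].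
Qed.

Let flatij a : flat i (sact j a) = flat i a.
Proof. by rewrite /flat !sactj_fix //; [right|left]. Qed.

Let flatji a : flat j (sact i a) = flat j a.
Proof. by rewrite /flat !sacti_fix //; [right|left]. Qed.

Lemma Top_far v : Top i (Top j v) = Top j (Top i v).
Proof.
move: (Top i) (Top j) (TopE i) (TopE j) => Ti Tj TiE TjE.
apply/ffunP => a; rewrite !(TiE, TjE) !flatij !flatji sactC.
rewrite (sactj_fix a (or_introl erefl)) (sacti_fix a (or_introl erefl)).
by case: (flat i a); case: (flat j a); case: (a i); case: (a j); ring.
Qed.

End FarPair.

Section NearPair.
Context (i j : 'I_N) (near : j = i.+1 :> nat).

Let li : ~~ is_last i.
Proof. by apply/eqP => e; have := ltn_ord j; rewrite near e ltnn. Qed.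

Let ni : nxt i = j. Proof. by apply: val_inj; rewrite /= val_nxt. Qed.

Let ij : i != j. Proof. by rewrite -val_eqE /= near neq_ltn ltnSn. Qed.

Let ji : (j == i) = false. Proof. by rewrite eq_sym (negbTE ij). Qed.

Let up2 a x y : W :=
  [ffun l => if l == i then x else if l == j then y else a l].

Let up2E a : a = up2 a (a i) (a j).
Proof. by apply/ffunP => l; rewrite ffunE; do 2?case: eqP => [->|_]. Qed.

Let sact_i2 a x y : sact i (up2 a x y) = up2 a y x.
Proof.
apply/ffunP => l; rewrite /sact (negbTE li) ni !ffunE.
by case: tpermP => [->|->|/eqP/negbTE-> /eqP/negbTE->]; rewrite ?eqxx ?ji.
Qed.

Let Ti2 v a x y : Top i v (up2 a x y) =
  if x == y then tpar i * v (up2 a x y)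
  else v (up2 a y x) + (if x then (tpar i - tparV i) * v (up2 a x y) else 0).
Proof.
by rewrite TopE sact_i2 /flat li ni !ffunE !eqxx ji.
Qed.

Section LastPair.
Hypothesis lj : is_last j.

Let sact_j2 a x y : sact j (up2 a x y) = up2 a x (~~ y).
Proof.
apply/ffunP => l; rewrite /sact lj !ffunE.
by case: (eqVneq l j) => // ->; rewrite ji.
Qed.

Let Tj2 v a x y : Top j v (up2 a x y) =
  v (up2 a x (~~ y)) + (if y then (tpar j - tparV j) * v (up2 a x y) else 0).
Proof.
by rewrite TopE sact_j2 /flat lj /= !ffunE eqxx ji.
Qed.

Lemma Top_braid4 v :
  Top i (Top j (Top i (Top j v))) = Top j (Top i (Top j (Top i v))).
Proof.
move: (Top i) (Top j) Ti2 Tj2 => Ti Tj TiE TjE.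
apply/ffunP => a; rewrite [a]up2E; move: (a i) (a j) => x y.
have := tparK i; set s := tpar i; set s' := tparV i => ss.
by case: x; case: y; rewrite !(TiE, TjE) /= -/s -/s'; ring: ss.
Qed.

End LastPair.

Section MiddlePair.
Hypothesis lj : ~~ is_last j.

Let k := nxt j.

Let jk : j != k. Proof. by rewrite -val_eqE /= val_nxt // neq_ltn ltnSn. Qed.

Let ik : i != k.
Proof. by rewrite -val_eqE /= val_nxt // near neq_ltn ltnS leqnSn. Qed.

Let ki : (k == i) = false. Proof. by rewrite eq_sym (negbTE ik). Qed.
Let kj : (k == j) = false. Proof. by rewrite eq_sym (negbTE jk). Qed.

Let up3 a x y z : W := up2 [ffun l => if l == k then z else a l] x y.

Let up3E a : a = up3 a (a i) (a j) (a k).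
Proof. by apply/ffunP => l; rewrite !ffunE; do 3?case: eqP => [->|_]. Qed.

Let sact_j3 a x y z : sact j (up3 a x y z) = up3 a x z y.
Proof.
apply/ffunP => l; rewrite /sact (negbTE lj) -/k !ffunE.
by case: tpermP => [->|->|/eqP/negbTE-> /eqP/negbTE->];
  rewrite ?eqxx ?ji ?ki ?kj.
Qed.

Let Ti3 v a x y z : Top i v (up3 a x y z) =
  if x == y then tpar i * v (up3 a x y z)
  else v (up3 a y x z) + (if x then (tpar i - tparV i) * v (up3 a x y z) else 0).
Proof. exact: Ti2. Qed.

Let Tj3 v a x y z : Top j v (up3 a x y z) =
  if y == z then tpar i * v (up3 a x y z)
  else v (up3 a x z y) + (if y then (tpar i - tparV i) * v (up3 a x y z) else 0).
Proof.
have [-> ->] : tpar i = tpar j /\ tparV i = tparV j.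
  by rewrite /tpar /tparV /e_gen (negbTE li) (negbTE lj).
rewrite TopE sact_j3 /flat lj -/k !ffunE !eqxx.
by rewrite ji ki kj.
Qed.

Lemma Top_braid3 v : Top i (Top j (Top i v)) = Top j (Top i (Top j v)).
Proof.
move: (Top i) (Top j) Ti3 Tj3 => Ti Tj TiE TjE.
apply/ffunP => a; rewrite [a]up3E; move: (a i) (a j) (a k) => x y z.
have := tparK i; set s := tpar i; set s' := tparV i => ss.
by case: x; case: y; case: z; rewrite !(TiE, TjE) /= -/s -/s'; ring: ss.
Qed.

End MiddlePair.
End NearPair.

End HeckeModule.

(* The Iwahori-Hecke algebra of type B_N, presented as the quotient of the    *)
(* expressions in the generators by the smallest congruence that contains the *)
(* axioms of an L-algebra and the defining relations.                         *)
Inductive hexpr (K : comNzRingType) (X : kl_case) (N : nat) :=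
  | HScal of laurent K (expo X)
  | HGen of 'I_N
  | HAdd of hexpr K X N & hexpr K X N
  | HMul of hexpr K X N & hexpr K X N.
Arguments HScal {K X N}.
Arguments HGen {K X N}.

HB.instance Definition _ K X N := gen_eqMixin (hexpr K X N).
HB.instance Definition _ K X N := gen_choiceMixin (hexpr K X N).

Section HeckeAlgebra.
Context {K : comNzRingType} {X : kl_case} {N : nat}.
Local Notation L := (laurent K (expo X)).
Local Notation W := (word N).
Local Notation M := {ffun W -> L^o}.
Local Notation E := (hexpr K X N).
Local Notation tpar := (tpar K X).
Local Notation tparV := (tparV K X).
Local Notation T i := (HGen i : E).
Local Infix "+!" := (@HAdd K X N) (at level 50, left associativity).
Local Infix "*!" := (@HMul K X N) (at level 40, left associativity).

Inductive heq : E -> E -> Prop :=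
  | heq_refl x : heq x x
  | heq_sym x y : heq x y -> heq y x
  | heq_trans x y z : heq x y -> heq y z -> heq x z
  | heq_add x x' y y' : heq x x' -> heq y y' -> heq (x +! y) (x' +! y')
  | heq_mul x x' y y' : heq x x' -> heq y y' -> heq (x *! y) (x' *! y')
  | heq_addA x y z : heq (x +! (y +! z)) (x +! y +! z)
  | heq_addC x y : heq (x +! y) (y +! x)
  | heq_add0 x : heq (HScal 0 +! x) x
  | heq_addN x : heq (HScal (-1) *! x +! x) (HScal 0)
  | heq_mulA x y z : heq (x *! (y *! z)) (x *! y *! z)
  | heq_mul1 x : heq (HScal 1 *! x) x
  | heq_mulDl x y z : heq ((x +! y) *! z) (x *! z +! y *! z)
  | heq_mulDr x y z : heq (x *! (y +! z)) (x *! y +! x *! z)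
  | heq_scalD c d : heq (HScal (c + d)) (HScal c +! HScal d)
  | heq_scalM c d : heq (HScal (c * d)) (HScal c *! HScal d)
  | heq_scalC c x : heq (HScal c *! x) (x *! HScal c)
  | heq_quad i : heq ((T i +! HScal (- tpar i)) *! (T i +! HScal (tparV i))) (HScal 0)
  | heq_far (i j : 'I_N) : (i.+1 < j)%N -> heq (T i *! T j) (T j *! T i)
  | heq_braid3 (i j : 'I_N) : j = i.+1 :> nat -> ~~ is_last j ->
      heq (T i *! T j *! T i) (T j *! T i *! T j)
  | heq_braid4 (i j : 'I_N) : j = i.+1 :> nat -> is_last j ->
      heq (T i *! T j *! T i *! T j) (T j *! T i *! T j *! T i).

Definition heqb (x y : E) : bool := `[< heq x y >].

Fact heqb_equiv : equiv_class_of heqb.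
Proof.
split=> [x|x y|y x z].
- exact/asboolP/heq_refl.
- by apply/asboolP/asboolP => /heq_sym.
- by move=> /asboolP xy /asboolP yz; apply/asboolP/(heq_trans xy yz).
Qed.

Canonical heqb_equiv_rel := EquivRelPack heqb_equiv.

Definition hecke := {eq_quot heqb_equiv_rel}.

HB.instance Definition _ := Choice.on hecke.
HB.instance Definition _ := EqQuotient.on hecke.

Definition hpi (x : E) : hecke := \pi_hecke x.

Lemma hpiP x y : hpi x = hpi y <-> heq x y.
Proof. by split=> [/eqmodP/asboolP|xy] //; apply/eqmodP/asboolP. Qed.

Lemma heq_repr x : heq (repr (hpi x)) x.
Proof. by apply/hpiP; rewrite /hpi reprK. Qed.

Lemma hpi_ind (P : hecke -> Prop) : (forall x, P (hpi x)) -> forall h, P h.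
Proof. by move=> Px h; rewrite -[h]reprK; apply: Px. Qed.

Definition hadd (g h : hecke) : hecke := hpi (repr g +! repr h).
Definition hmul (g h : hecke) : hecke := hpi (repr g *! repr h).
Definition hopp (h : hecke) : hecke := hpi (HScal (-1) *! repr h).

Fact hpi_add x y : hadd (hpi x) (hpi y) = hpi (x +! y).
Proof. exact/hpiP/heq_add/heq_repr/heq_repr. Qed.

Fact hpi_mul x y : hmul (hpi x) (hpi y) = hpi (x *! y).
Proof. exact/hpiP/heq_mul/heq_repr/heq_repr. Qed.

Fact hpi_opp x : hopp (hpi x) = hpi (HScal (-1) *! x).
Proof. exact/hpiP/heq_mul/heq_repr/heq_refl. Qed.

Let hpiE := (hpi_add, hpi_mul, hpi_opp).

Fact haddA : associative hadd.
Proof. do 3!elim/hpi_ind=> ?; rewrite !hpiE; exact/hpiP/heq_addA. Qed.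
Fact haddC : commutative hadd.
Proof. do 2!elim/hpi_ind=> ?; rewrite !hpiE; exact/hpiP/heq_addC. Qed.
Fact hadd0 : left_id (hpi (HScal 0)) hadd.
Proof. elim/hpi_ind=> ?; rewrite !hpiE; exact/hpiP/heq_add0. Qed.
Fact haddN : left_inverse (hpi (HScal 0)) hopp hadd.
Proof. elim/hpi_ind=> ?; rewrite !hpiE; exact/hpiP/heq_addN. Qed.

HB.instance Definition _ := GRing.isZmodule.Build hecke haddA haddC hadd0 haddN.

Fact hmulA : associative hmul.
Proof. do 3!elim/hpi_ind=> ?; rewrite !hpiE; exact/hpiP/heq_mulA. Qed.
Fact hmul1 : left_id (hpi (HScal 1)) hmul.
Proof. elim/hpi_ind=> ?; rewrite !hpiE; exact/hpiP/heq_mul1. Qed.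
Fact hmulr1 : right_id (hpi (HScal 1)) hmul.
Proof.
elim/hpi_ind=> x; rewrite !hpiE; apply/hpiP.
exact: heq_trans (heq_sym (heq_scalC _ _)) (heq_mul1 _).
Qed.
Fact hmulDl : left_distributive hmul hadd.
Proof. do 3!elim/hpi_ind=> ?; rewrite !hpiE; exact/hpiP/heq_mulDl. Qed.
Fact hmulDr : right_distributive hmul hadd.
Proof. do 3!elim/hpi_ind=> ?; rewrite !hpiE; exact/hpiP/heq_mulDr. Qed.

(* The action on M^+, which is realized as the functions from P_N to L.       *)
Fixpoint eact (x : E) (v : M) : M :=
  match x with
  | HScal c => c *: v
  | HGen i => Top i v
  | HAdd x y => eact x v + eact y v
  | HMul x y => eact x (eact y v)
  end.

Fact eactD x v w : eact x (v + w) = eact x v + eact x w.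
Proof.
elim: x v w => [c|i|x IHx y IHy|x IHx y IHy] v w /=.
- exact: scalerDr.
- exact: TopD.
- by rewrite IHx IHy addrACA.
- by rewrite IHy IHx.
Qed.

Fact eactZ x c v : eact x (c *: v) = c *: eact x v.
Proof.
elim: x v => [d|i|x IHx y IHy|x IHx y IHy] v /=.
- by rewrite !scalerA mulrC.
- exact: TopZ.
- by rewrite IHx IHy scalerDr.
- by rewrite IHy IHx.
Qed.

Fact eact_heq x y : heq x y -> eact x =1 eact y.
Proof.
elim=> {x y} /=.
- by [].
- by move=> x y _ xy v; rewrite xy.
- by move=> x y z _ xy _ yz v; rewrite xy yz.
- by move=> x x' y y' _ xx' _ yy' v; rewrite xx' yy'.
- by move=> x x' y y' _ xx' _ yy' v; rewrite xx' yy'.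
- by move=> x y z v; rewrite addrA.
- by move=> x y v; rewrite addrC.
- by move=> x v; rewrite scale0r add0r.
- by move=> x v; rewrite scaleN1r addNr scale0r.
- by [].
- by move=> x v; rewrite scale1r.
- by [].
- by move=> x y z v; rewrite eactD.
- by move=> c d v; rewrite scalerDl.
- by move=> c d v; rewrite scalerA.
- by move=> c x v; rewrite eactZ.
- move=> i v; rewrite TopD TopZ Top_sq scale0r scalerDr !scalerA.
  rewrite mulNr tparK !scaleNr scale1r scalerBl.
  by rewrite [_ - _ + v]addrAC subrK -opprD subrr.
- by move=> i j ij v; apply: Top_far.
- by move=> i j ij lj v; apply: Top_braid3.
- by move=> i j ij lj v; apply: Top_braid4.
Qed.

Definition hact (h : hecke) (v : M) : M := eact (repr h) v.

Lemma hact_pi x v : hact (hpi x) v = eact x v.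
Proof. exact: eact_heq (heq_repr x) v. Qed.

Fact hone_neq0 : hpi (HScal 1) != 0.
Proof.
apply/eqP => /(congr1 (fun h => hact h (mbasis K X word1) word1)).
rewrite /GRing.zero /= !hact_pi /= scale1r scale0r !ffunE eqxx. move=> /eqP.
by rewrite oner_eq0.
Qed.

HB.instance Definition _ := GRing.Zmodule_isNzRing.Build hecke
  hmulA hmul1 hmulr1 hmulDl hmulDr hone_neq0.

Definition hscal (c : L) : hecke := hpi (HScal c).
Definition hgen i : hecke := hpi (HGen i).

Lemma hpiD x y : hpi (x +! y) = hpi x + hpi y.
Proof. by rewrite [RHS]hpi_add. Qed.

Lemma hpiM x y : hpi (x *! y) = hpi x * hpi y.
Proof. by rewrite [RHS]hpi_mul. Qed.

Definition hscale (c : L) (h : hecke) : hecke := hscal c * h.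

Fact hscalD c d : hscal (c + d) = hscal c + hscal d.
Proof. by rewrite -hpiD; apply/hpiP/heq_scalD. Qed.

Fact hscalM c d : hscal (c * d) = hscal c * hscal d.
Proof. by rewrite -hpiM; apply/hpiP/heq_scalM. Qed.

Fact hscaleA c d h : hscale c (hscale d h) = hscale (c * d) h.
Proof. by rewrite /hscale hscalM mulrA. Qed.
Fact hscale1 : left_id 1 hscale. Proof. exact: mul1r. Qed.
Fact hscaleDr : right_distributive hscale +%R.
Proof. by move=> c g h; apply: mulrDr. Qed.
Fact hscaleDl h : {morph hscale^~ h : c d / c + d}.
Proof. by move=> c d; rewrite /hscale hscalD mulrDl. Qed.

HB.instance Definition _ := GRing.Zmodule_isLmodule.Build L hecke
  hscaleA hscale1 hscaleDr hscaleDl.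

Fact hscaleAl (c : L) (g h : hecke) : c *: (g * h) = (c *: g) * h.
Proof. exact: mulrA. Qed.

HB.instance Definition _ := GRing.Lmodule_isLalgebra.Build L hecke hscaleAl.

Fact hscaleAr (c : L) (g h : hecke) : c *: (g * h) = g * (c *: h).
Proof.
rewrite [LHS]mulrA [RHS]mulrA; congr (_ * h).
by elim/hpi_ind: g => x; rewrite -!hpiM; apply/hpiP/heq_scalC.
Qed.

HB.instance Definition _ := GRing.Lalgebra_isAlgebra.Build L hecke hscaleAr.

Lemma hscalE c : hscal c = c%:A. Proof. exact/esym/mulr1. Qed.

Lemma hgen_quad i : (hgen i - (tpar i)%:A) * (hgen i + (tparV i)%:A) = 0.
Proof.
rewrite -scaleNr -!hscalE -!hpiD -hpiM; exact/hpiP/heq_quad.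
Qed.

Lemma hgen_far (i j : 'I_N) : (i.+1 < j)%N -> hgen i * hgen j = hgen j * hgen i.
Proof. by move=> ij; rewrite /hgen -!hpiM; apply/hpiP; exact: heq_far. Qed.

Lemma hgen_braid3 (i j : 'I_N) : j = i.+1 :> nat -> ~~ is_last j ->
  hgen i * hgen j * hgen i = hgen j * hgen i * hgen j.
Proof. by move=> ? ?; rewrite /hgen -!hpiM; apply/hpiP; exact: heq_braid3. Qed.

Lemma hgen_braid4 (i j : 'I_N) : j = i.+1 :> nat -> is_last j ->
  hgen i * hgen j * hgen i * hgen j = hgen j * hgen i * hgen j * hgen i.
Proof. by move=> ? ?; rewrite /hgen -!hpiM; apply/hpiP; exact: heq_braid4. Qed.

Lemma hact1 v : hact 1 v = v. Proof. by rewrite hact_pi /= scale1r. Qed.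

Lemma hactM g h v : hact (g * h) v = hact g (hact h v).
Proof.
by elim/hpi_ind: g => x; elim/hpi_ind: h => y; rewrite -hpiM !hact_pi.
Qed.

Lemma hactDl g h v : hact (g + h) v = hact g v + hact h v.
Proof.
by elim/hpi_ind: g => x; elim/hpi_ind: h => y; rewrite -hpiD !hact_pi.
Qed.

Lemma hactDr h v w : hact h (v + w) = hact h v + hact h w.
Proof. exact: eactD. Qed.

Lemma hact_scale c h v : hact (c *: h) v = c *: hact h v.
Proof. by rewrite hactM hact_pi. Qed.

Lemma hact_gen i a : hact (hgen i) (mbasis K X a) = Tbasis K X i a.
Proof. by rewrite hact_pi /= Top_basis. Qed.

Definition hgenV i : hecke := hgen i - (tpar i - tparV i)%:A.

Lemma hgen_sq i : hgen i * hgen i = (tpar i - tparV i) *: hgen i + 1.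
Proof.
have := hgen_quad i; rewrite mulrDr !mulrBl !mulr_algl !mulr_algr scalerA.
rewrite tparK scale1r scalerBl => /eqP.
by rewrite addrA subr_eq0 => /eqP <-; rewrite [RHS]addrC -addrA [X in _ = _ + X]addrC !subrK.
Qed.

Lemma hgenK i : hgen i * hgenV i = 1.
Proof. by rewrite mulrBr hgen_sq mulr_algr addrC addKr. Qed.

Lemma hgenVK i : hgenV i * hgen i = 1.
Proof. by rewrite mulrBl hgen_sq mulr_algl addrC addKr. Qed.

(* The bar involution of the Hecke algebra, T_i being sent to its inverse.    *)
Fixpoint ebar (x : E) : hecke :=
  match x with
  | HScal c => (lbar c)%:A
  | HGen i => hgenV i
  | HAdd x y => ebar x + ebar y
  | HMul x y => ebar x * ebar y
  end.

Fact inv_uniq (x y x' y' : hecke) : x = y -> x * x' = 1 -> y' * y = 1 -> x' = y'.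
Proof. by move=> <- xx' y'x; rewrite -[x']mul1r -y'x -mulrA xx' mulr1. Qed.

Fact ebar_heq x y : heq x y -> ebar x = ebar y.
Proof.
elim=> {x y} /=.
- by [].
- by [].
- by move=> x y z _ -> _ ->.
- by move=> x x' y y' _ -> _ ->.
- by move=> x x' y y' _ -> _ ->.
- by move=> x y z; rewrite addrA.
- by move=> x y; rewrite addrC.
- by move=> x; rewrite rmorph0 scale0r add0r.
- by move=> x; rewrite rmorphN1 rmorph0 scaleN1r scale0r mulN1r addNr.
- by move=> x y z; rewrite mulrA.
- by move=> x; rewrite rmorph1 scale1r mul1r.
- by move=> x y z; rewrite mulrDl.
- by move=> x y z; rewrite mulrDr.
- by move=> c d; rewrite rmorphD scalerDl.
- by move=> c d; rewrite rmorphM mulr_algl scalerA.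
- by move=> c x; rewrite mulr_algl mulr_algr.
- move=> i; rewrite rmorph0 scale0r -[RHS](hgen_quad i).
  rewrite rmorphN /= /tpar /tparV !lbar_mono opprK -/(tpar i) -/(tparV i).
  rewrite /hgenV scaleNr scalerBl opprB; congr (_ * _); rewrite addrA.
    by rewrite addrAC addrK.
  by rewrite subrK.
- move=> i j /hgen_far/esym e; apply: inv_uniq e _ _.
    by rewrite mulrA -[_ * hgenV i]mulrA hgenK mulr1 hgenK.
  by rewrite mulrA -[_ * hgen i]mulrA hgenVK mulr1 hgenVK.
- move=> i j ij lj; have e := hgen_braid3 ij lj.
  apply: inv_uniq e _ _; rewrite !mulrA.
    by do 2!rewrite -[_ * hgen _ * hgenV _]mulrA hgenK mulr1; rewrite hgenK.
  by do 2!rewrite -[_ * hgenV _ * hgen _]mulrA hgenVK mulr1; rewrite hgenVK.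
- move=> i j ij lj; have e := esym (hgen_braid4 ij lj).
  apply: inv_uniq e _ _; rewrite !mulrA.
    by do 3!rewrite -[_ * hgen _ * hgenV _]mulrA hgenK mulr1; rewrite hgenK.
  by do 3!rewrite -[_ * hgenV _ * hgen _]mulrA hgenVK mulr1; rewrite hgenVK.
Qed.

Definition hbar (h : hecke) : hecke := ebar (repr h).

Lemma hbar_pi x : hbar (hpi x) = ebar x.
Proof. exact: ebar_heq (heq_repr x). Qed.

Lemma hbarD g h : hbar (g + h) = hbar g + hbar h.
Proof.
by elim/hpi_ind: g => x; elim/hpi_ind: h => y; rewrite -hpiD !hbar_pi.
Qed.

Lemma hbarM g h : hbar (g * h) = hbar g * hbar h.
Proof.
by elim/hpi_ind: g => x; elim/hpi_ind: h => y; rewrite -hpiM !hbar_pi.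
Qed.

Lemma hbar_scale c h : hbar (c *: h) = lbar c *: hbar h.
Proof. by rewrite hbarM hbar_pi mulr_algl. Qed.

Lemma hbar_gen i : hbar (hgen i) * hgen i = 1 /\ hgen i * hbar (hgen i) = 1.
Proof. by rewrite hbar_pi; split; [apply: hgenVK|apply: hgenK]. Qed.

End HeckeAlgebra.

Section KazhdanLusztig.
Context (K : comNzRingType) (X : kl_case) (N : nat).
Local Notation L := (laurent K (expo X)).
Local Notation W := (word N).
Local Notation M := {ffun W -> L^o}.
Local Notation m_ := (mbasis K X).

Definition is_bar_module (b : M -> M) : Prop :=
  [/\ forall v w, b (v + w) = b v + b w,
      forall (c : L) v, b (c *: v) = lbar c *: b v,
      b (m_ (word1 : W)) = m_ word1
    & forall (h : hecke) v, b (hact h v) = hact (hbar h) (b v)].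

(* [xget] is the description operator: the value is the unique such map, [id] *)
(* being a junk value for the case (which does not occur) where there is none *)
Definition bar_module : M -> M := classical_sets.xget (id : M -> M) is_bar_module.

Definition wratio (a b : W) : L := mono (wexp X a - wexp X b).

Definition KL_element (P : W -> W -> L) (b : W) : M :=
  \sum_(a | bruhat a b) (wratio a b * P a b) *: m_ a.

(* The elements C_b are unitriangular in the m_a, hence automatically form a  *)
(* basis of M^+. The entries outside the Bruhat order, which do not occur in  *)
(* C_b, are normalized to 0.                                                  *)
Definition is_KL_family (P : W -> W -> L) : Prop :=
  forall b : W,
    [/\ bar_module (KL_element P b) = KL_element P b,
        P b b = 1,
        forall a, bruhat a b -> a != b ->
          Zspan (@Gamma_neg X) (wratio a b * P a b)
      & forall a, ~~ bruhat a b -> P a b = 0].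

Definition KLpoly : W -> W -> L := classical_sets.xget (fun _ _ => 0 : L) is_KL_family.

End KazhdanLusztig.

Section BallotStrips.
Context {N : nat}.
Implicit Types (a b : word N) (k : nat).

Definition height a k : int := \sum_(i < N | (i < k)%N) (if a i then -1 else 1).

(* Boxes are stored with their second coordinate shifted by N.                *)
Definition box : finType := ('I_N.+1 * 'I_N.*2.+1)%type.

Definition box_x (c : box) : nat := c.1.
Definition box_y (c : box) : int := c.2%:Z - N%:Z.

Definition is_box (c : box) : bool :=
  [&& (0 < box_x c)%N, `|box_y c| <= (box_x c)%:Z & (2 %| (box_x c)%:Z + box_y c - 1)%Z].

(* A box whose lowest vertex is on or above the path is entirely above it,    *)
(* and by parity this amounts to its centre being above the path.             *)
Definition lambda a : {set box} :=
  [set c | is_box c && (height a (box_x c) < box_y c)].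

Definition region a b : {set box} := lambda b :\: lambda a.

Definition anchor (c : box) : bool := box_x c == N.

Definition just_below (c d : box) : bool :=
  (box_x c == box_x d) && (box_y c == box_y d - 2).

Definition ballot_step (c d : box) : bool :=
  (box_x d == (box_x c).+1) && ((box_y d == box_y c + 1) || (box_y d == box_y c - 1)).

Definition is_strip (l l' : nat) (D : {set box}) : bool :=
  [exists c : box, exists s : (l.*2 + l').-tuple box,
    [&& path ballot_step c s, all (fun d => box_y c <= box_y d) s,
        box_y (last c s) == box_y c + l'%:Z & D == [set d in c :: s]]].

(* Strips have at most N boxes, so that l and l' range below N.               *)
Definition ballot_strip (D : {set box}) : bool :=
  [exists p : 'I_N.+1 * 'I_N.+1, is_strip p.1 p.2 D].

Definition strip_length (D : {set box}) : nat * nat :=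
  if [pick p : 'I_N.+1 * 'I_N.+1 | is_strip p.1 p.2 D] is Some p
  then (val p.1, val p.2) else (0, 0)%N.

Definition rule0 (P : {set {set box}}) : bool :=
  [forall D in P, (0 < (strip_length D).2)%N ==>
    [forall c in D, [forall d in D, (box_x d <= box_x c)%N] ==> anchor c]].

(* A position just below a box of D' that is not in the region belongs to no  *)
(* strip, so that D' then has no strip just below it.                         *)
Definition ruleIa (P : {set {set box}}) : bool :=
  [forall D in P, forall D' in P,
    [exists c in D, exists c' in D', just_below c c'] ==>
    [forall c' in D', exists c in D, just_below c c']].

Definition ruleIb (m : nat) (P : {set {set box}}) : bool :=
  [forall l : 'I_N.+1, forall l' : 'I_N.+1, (m <= l')%N ==>
    let n := #|[set D in P | strip_length D == (val l, val l')]| in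
    if odd (l' - m) then n == 0%N else ~~ odd n].

Definition conf (X : kl_case) a b : {set {set {set box}}} :=
  [set P | [&& partition P (region a b), [forall D in P, ballot_strip D],
               rule0 P, ruleIa P & if X is CaseB m then ruleIb m P else true]].

Definition strip_weight (K : comNzRingType) (X : kl_case) (p : nat * nat) :
    laurent K (expo X) :=
  let: (l, l') := p in
  match X with
  | CaseA =>
      if odd l' then
        - mono (e_t CaseA *+ (2 * l + l' - 1) + e_tN CaseA *+ 2)
      else mono (e_t CaseA *+ (2 * l + l'))
  | CaseB m =>
      if (l' < m)%N then mono (e_t (CaseB m) *+ (2 * l + 2 * l'))
      else if odd (l' - m) then mono (e_t (CaseB m) *+ (m + l' + 2 * l - 1))
      else mono (e_t (CaseB m) *+ (m + l' + 2 * l))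
  end.

Definition Qpoly (K : comNzRingType) (X : kl_case) a b : laurent K (expo X) :=
  \sum_(P in conf X a b) \prod_(D in P) strip_weight K X (strip_length D).

End BallotStrips.

(* Main.v *)
(** The Kazhdan-Lusztig basis vectors are written down explicitly. Reading a
    configuration column by column, from the last column to the first, only the
    numbers of strips that cross each step of the lower path matter; the
    resulting transfer recursion [scan] computes the generating function.

    The operators [T_i - t_i] factor through maps between words of different
    lengths, the caps and cups of a one-boundary Temperley-Lieb algebra. The
    vectors given by [scan] are carried by cups, and by the boundary operator
    [hcup], either to such vectors for a shorter word or to 0. Iterating, one
    reaches the coefficient at 1...1: this gives functionals dual to these
    vectors, and a space stable under [T_i - t_i] on which the functionals take
    bar-invariant values. Hence the semilinear map that fixes these vectors is
    the bar involution. A bound on the exponents in [scan] then shows that they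
    are the Kazhdan-Lusztig basis.

    In Case B the boundary parameter degenerates at level [m], where Rule Ib
    pairs up the strips that reach the last column. *)

From mathcomp Require Import all_boot all_order all_fingroup all_algebra.
From mathcomp Require Import monalg ring zify.
From mathcomp Require Import boolp complex reals.
Require Import Defs.

Set Implicit Arguments.
Unset Strict Implicit.
Unset Printing Implicit Defensive.

Import Order.TTheory GRing.Theory Num.Theory.
Local Open Scope ring_scope.

(** * Cups and caps *)

Lemma eq_seqfun (L : Type) (v w : seq bool -> L) : v =1 w -> v = w.
Proof. by move=> e; apply/funext. Qed.

Section CupCap.
Context {L : comNzRingType} (t tV : L).
Hypothesis tK : t * tV = 1.
Implicit Types (v u : seq bool -> L) (s : seq bool) (k : nat).

Fixpoint cup k v s : L :=
  match k, s with
  | 0, s => v (true :: false :: s) - tV * v (false :: true :: s)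
  | k'.+1, a :: s' => cup k' (fun x => v (a :: x)) s'
  | _.+1, [::] => 0
  end.

Fixpoint cap k u s : L :=
  match k, s with
  | 0, a :: b :: s' =>
      if a then (if b then 0 else - t * u s') else if b then u s' else 0
  | k'.+1, a :: s' => cap k' (fun x => u (a :: x)) s'
  | _, _ => 0
  end.

Definition hcup (c : L) v s : L := v (false :: s) - c * v (true :: s).

Definition hcap (c : L) u s : L :=
  if s is a :: s' then (if a then u s' else c * u s') else 0.

Definition restr (e : bool) v s : L :=
  if odd (count id s) == e then v s else 0.

Definition drop_parity (e : bool) v s : L := v ((e (+) odd (count id s)) :: s).

Lemma cup_lin k c d v u s :
  cup k (fun x => c * v x + d * u x) s = c * cup k v s + d * cup k u s.
Proof.
elim: k v u s => [|k IH] v u [|a s] /=; try ring.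
exact: (IH (fun x => v (a :: x)) (fun x => u (a :: x))).
Qed.

Lemma cap_lin k c d v u s :
  cap k (fun x => c * v x + d * u x) s = c * cap k v s + d * cap k u s.
Proof.
elim: k v u s => [|k IH] v u [|a s] /=; try ring.
  by case: s => [|b s]; first ring; case: a; case: b; ring.
exact: (IH (fun x => v (a :: x)) (fun x => u (a :: x))).
Qed.

Lemma cup_ext k v w s :
  (forall x, size x = (size s).+2 -> v x = w x) -> cup k v s = cup k w s.
Proof.
elim: k v w s => [|k IH] v w [|a s] vw //=; rewrite ?vw //.
by apply: IH => x xs; apply: vw; rewrite /= xs.
Qed.

Lemma cupZ k c v s : cup k (fun x => c * v x) s = c * cup k v s.
Proof.
have := cup_lin k c 0 v v s; rewrite mul0r addr0 => <-.
by congr (cup k _ s); apply/eq_seqfun => x; ring.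
Qed.

Lemma cup0v k s : cup k (fun=> 0) s = 0.
Proof. by elim: k s => [|k IH] [|a s] /=; rewrite ?mulr0 ?subr0. Qed.

Lemma cup_cap k u s :
  cup k (cap k u) s = if (k <= size s)%N then - (t + tV) * u s else 0.
Proof.
elim: k u s => [|k IH] u [|a s] //=; try ring.
exact: (IH (fun y => u (a :: y))).
Qed.

Lemma cupS_cap k u s :
  cup k.+1 (cap k u) s = if (k < size s)%N then u s else 0.
Proof.
elim: k u s => [|k IH] u [|a s] //=; last exact: (IH (fun y => u (a :: y))).
by case: a; rewrite ?mulr0 ?sub0r ?subr0 ?mulNr ?mulrN ?opprK ?mulrA ?[tV * _]mulrC ?tK ?mul1r.
Qed.

Lemma cup_capS k u s :
  cup k (cap k.+1 u) s = if (k < size s)%N then u s else 0.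
Proof.
elim: k u s => [|k IH] u [|a s] //=; first by rewrite mulr0 subr0.
  by case: a; rewrite ?mulr0 ?sub0r ?subr0 ?mulNr ?mulrN ?opprK ?mulrA ?[tV * _]mulrC ?tK ?mul1r.
exact: (IH (fun y => u (a :: y))).
Qed.

Lemma cup_cap_far k j u s :
  cup (k + j).+2 (cap k u) s = cap k (cup (k + j) u) s.
Proof.
elim: k u s => [|k IH] u s.
  rewrite add0n; case: s => [|a [|b s]] //=.
  case: a; case: b => //=; rewrite ?cup0v // -cupZ; congr (cup j _ s).
by rewrite addSn; case: s => [|a s] //=; apply: (IH (fun y => u (a :: y))).
Qed.

Lemma cap_cup_far k j u s :
  cup k (cap (k + j).+2 u) s = cap (k + j) (cup k u) s.
Proof.
elim: k u s => [|k IH] u s.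
  rewrite add0n /=.
  transitivity (cap j (fun x => 1 * u (true :: false :: x)
                                + - tV * u (false :: true :: x)) s).
    by rewrite cap_lin; ring.
  by congr (cap j _ s); apply/eq_seqfun => x; ring.
by rewrite addSn; case: s => [|a s] //=; apply: (IH (fun y => u (a :: y))).
Qed.

Lemma hcup_capS c k u s : hcup c (cap k.+1 u) s = cap k (hcup c u) s.
Proof.
rewrite /hcup /=; transitivity (cap k (fun x => 1 * u (false :: x) + - c * u (true :: x)) s).
  by rewrite cap_lin; ring.
by congr (cap k _ s); apply/eq_seqfun => x; ring.
Qed.

Lemma hcup_cap0 c u s : hcup c (cap 0 u) s = hcap (c * t) u s.
Proof. by rewrite /hcup; case: s => [|a s] /=; first ring; case: a; ring. Qed.

Lemma hcup_hcap c d u s : hcup c (hcap d u) s = (d - c) * u s.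
Proof. by rewrite /hcup /=; ring. Qed.

Lemma cup_hcapS k c u s : cup k.+1 (hcap c u) s = hcap c (cup k u) s.
Proof. by case: s => [|a s] //=; case: a; rewrite // -cupZ; congr (cup k _ s). Qed.

Lemma cup0_hcap c u s : cup 0 (hcap c u) s = hcup (tV * c) u s.
Proof. by rewrite /hcup /=; ring. Qed.

Lemma cup_hcup k c v s : cup k (hcup c v) s = hcup c (cup k.+1 v) s.
Proof.
rewrite /hcup /=; transitivity (cup k (fun x => 1 * v (false :: x) + - c * v (true :: x)) s).
  by congr (cup k _ s); apply/eq_seqfun => x; ring.
by rewrite cup_lin; ring.
Qed.

Lemma cup_restr k e v s : cup k (restr e v) s = restr (~~ e) (cup k v) s.
Proof.
elim: k e v s => [|k IH] e v s.
  by rewrite /restr /= ?oddD /=; case: (odd _); case: e => /=; ring.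
case: s => [|a s] /=; first by rewrite /restr if_same.
have -> : (fun x => restr e v (a :: x)) = restr (e (+) a) (fun x => v (a :: x)).
  apply/eq_seqfun => x; rewrite /restr /= oddD oddb.
  by case: a; case: (odd _); case: e.
rewrite IH /restr /= oddD oddb.
by case: a; case: (odd _); case: e.
Qed.

Lemma cap_parity k (f : bool -> seq bool -> L) s :
  cap k (f (odd (count id s))) s = cap k (fun x => f (~~ odd (count id x)) x) s.
Proof.
elim: k s f => [|k IH] s f.
  by case: s => [|c [|d s]] //=; case: c; case: d; rewrite ?oddD //=.
case: s => [|c s] //=; rewrite oddD oddb addbC.
rewrite (IH s (fun y x => f (y (+) c) (c :: x))).
congr (cap k _ s); apply/eq_seqfun => x; congr (f _ (c :: x)).
by rewrite oddD oddb; case: c; case: (odd _).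
Qed.

Lemma drop_parity_capS e k u s :
  drop_parity e (cap k.+1 u) s = cap k (drop_parity (~~ e) u) s.
Proof.
rewrite /drop_parity /= (cap_parity k (fun y x => u ((e (+) y) :: x))).
by congr (cap k _ s); apply/eq_seqfun => x; case: e; case: (odd _).
Qed.

Lemma drop_parity_cap0 e u s :
  drop_parity e (cap 0 u) s = hcap (- t) (restr (~~ e) u) s.
Proof.
rewrite /drop_parity; case: s => [|a s] //=; rewrite /restr.
by case: a; rewrite ?oddD /=; case: e; case: (odd _) => //=; rewrite ?mulr0.
Qed.

Lemma drop_parity_hcap1 e u s : drop_parity e (hcap 1 u) s = u s.
Proof. by rewrite /drop_parity /=; case: (e (+) _); rewrite ?mul1r. Qed.

Lemma drop_parity_restr e f v s :
  drop_parity e (restr f v) s = if e == f then drop_parity e v s else 0.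
Proof.
rewrite /drop_parity /restr /= oddD oddb.
by case: e; case: f; case: (odd _).
Qed.

Lemma hcupN1_parity v s :
  hcup (-1) v s = drop_parity false v s + drop_parity true v s.
Proof. by rewrite /hcup /drop_parity; case: (odd _) => /=; ring. Qed.

End CupCap.

Section Spaces.
Context {L : comNzRingType} (t tV : L) (bar : {rmorphism L -> L}).
Hypotheses (tK : t * tV = 1) (bar_t : bar t = tV) (bar_tV : bar tV = t).
(* [crit p] marks the level at which the boundary generator acts by [+-1] and *)
(* a vector is only tested on its two parity components.                      *)
Context (thetaV : nat -> L) (crit : pred nat).
Implicit Types (v u : seq bool -> L) (s : seq bool) (k p n : nat).

Fixpoint space p n v : Prop :=
  bar (v (nseq n true)) = v (nseq n true) /\
  match n with
  | 0 => True
  | n'.+1 =>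
      (if crit p then forall e, space p.-1 n' (drop_parity e v)
       else space p.+1 n' (hcup (thetaV p) v)) /\
      match n' with 0 => True | n''.+1 => forall k, space p n'' (cup tV k v) end
  end.

Lemma space_ext p n v w :
  (forall s, size s = n -> v s = w s) -> space p n v -> space p n w.
Proof.
elim/ltn_ind: n p v w => n IH p v w vw.
have vwn := vw _ (size_nseq n true).
case: n IH vw vwn => [|n] IH vw vwn /=; rewrite vwn; first by [].
case=> bv [bd cv]; split=> //; split.
  move: bd; case: (crit p) => [h e|]; [move: (h e)|]; apply: IH => // s sn;
  by rewrite /drop_parity /hcup ?vw //= sn.
case: n IH vw vwn cv {bd bv} => // n IH vw _ cv k.
apply: IH (cv k) => // s sn.
by apply: cup_ext => x xs; apply: vw; rewrite xs sn.
Qed.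

Lemma space_lin p n c d v u : bar c = c -> bar d = d ->
  space p n v -> space p n u -> space p n (fun s => c * v s + d * u s).
Proof.
move=> bc bd; elim/ltn_ind: n p v u => -[|n] IH p v u /=.
  by move=> [bv _] [bu _]; rewrite rmorphD !rmorphM /= bv bu bc bd.
move=> [bv [hv cv]] [bu [hu cu]]; split.
  by rewrite rmorphD !rmorphM /= bv bu bc bd.
split.
  case: (crit p) hv hu => [hv hu e|hv hu]; first exact: (IH n _ _ _ _ (hv e) (hu e)).
  apply: space_ext (IH n _ _ _ _ hv hu) => // s _.
  by rewrite /hcup; ring.
case: n IH hv hu cv cu {bv bu} => // n IH _ _ cv cu k.
by apply: space_ext (IH n _ _ _ _ (cv k) (cu k)) => // s _; rewrite cup_lin.
Qed.

Lemma spaceZ p n c v : bar c = c -> space p n v -> space p n (fun s => c * v s).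
Proof.
move=> bc sv; apply: space_ext (space_lin bc (rmorph0 bar) sv sv) => s _.
by rewrite mul0r addr0.
Qed.

Lemma space0 p n : space p n (fun=> 0).
Proof.
elim/ltn_ind: n p => -[|n] IH p /=; rewrite rmorph0 //; split=> //; split.
  case: (crit p) => [e|]; first exact: (IH n).
  by apply: space_ext (IH n _ _) => // s _; rewrite /hcup mulr0 subr0.
case: n IH => // n IH k; apply: space_ext (IH n _ _) => // s _.
by rewrite cup0v.
Qed.

Lemma space_bar p n v : space p n v -> bar (v (nseq n true)) = v (nseq n true).
Proof. by case: n => [|n] []. Qed.

Lemma space_cup p n v k : space p n.+2 v -> space p n (cup tV k v).
Proof. by case=> _ [_ cv]; apply: cv. Qed.

Lemma space_hcup p n v : ~~ crit p -> space p n.+1 v -> space p.+1 n (hcup (thetaV p) v).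
Proof. by move=> /negbTE cp [_ [hv _]]; rewrite cp in hv. Qed.

Lemma space_drop p n v e : crit p -> space p n.+1 v -> space p.-1 n (drop_parity e v).
Proof. by move=> cp [_ [hv _]]; rewrite cp in hv; apply: hv. Qed.

Lemma space_restr p n v e : crit p -> space p n v -> space p n (restr e v).
Proof.
move=> cp; elim/ltn_ind: n e v => n IH e v sv.
have bv : bar (restr e v (nseq n true)) = restr e v (nseq n true).
  by rewrite /restr; case: eqP => _; rewrite ?rmorph0 //; apply: space_bar sv.
case: n IH sv bv => [|n] IH sv bv; split=> //; split.
  rewrite cp => f; have hv := space_drop f cp sv.
  apply: space_ext (_ : space p.-1 n (if f == e then drop_parity f v else fun=> 0)).
    by move=> s _; rewrite drop_parity_restr; case: eqP.
  by case: eqP => // _; apply: space0.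
case: n IH sv {bv} => // n IH sv k.
apply: space_ext (IH n _ (~~ e) _ (space_cup k sv)) => // s _.
by rewrite cup_restr.
Qed.

Lemma bar_loop : bar (- (t + tV)) = - (t + tV).
Proof. by rewrite rmorphN rmorphD /= bar_t bar_tV addrC. Qed.

Lemma cap_true u k n : cap t k u (nseq n true) = 0.
Proof.
elim: k n u => [|k IH] [|n] u //=; first by case: n.
Qed.

(* Reduces closure under [cap] to the boundary conditions of [cap 0 u].       *)
Lemma space_cap_step p n u k :
    (forall n', (n' < n)%N -> forall q v j, q = p \/ q = (if crit p then p.-1 else p.+1) ->
       space q n' v -> space q n'.+2 (cap t j v)) ->
    space p n u ->
    (if crit p then forall e, space p.-1 n.+1 (drop_parity e (cap t 0 u))
     else space p.+1 n.+1 (hcup (thetaV p) (cap t 0 u))) ->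
  space p n.+2 (cap t k u).
Proof.
move=> IH su h0; split; first by rewrite cap_true rmorph0.
split.
  case: k => [|k] //; case: n IH su h0 => [|n] IH su h0.
    have z s : size s = 1 -> cap t k.+1 u (false :: s) = 0 /\ cap t k.+1 u (true :: s) = 0.
      by case: s => [|a []] // _; case: k => [|[|k]].
    case: (crit p) => [e|]; apply: space_ext (space0 _ _) => s /z[zf zt].
      by rewrite /drop_parity; case: (e (+) _); rewrite ?zf ?zt.
    by rewrite /hcup zf zt mulr0 subr0.
  case: ifP h0 => cp _; [move=> e|].
    have hu := space_drop (~~ e) cp su.
    by apply: space_ext (IH n (ltnSn n) _ _ k _ hu) => [s _|]; last (by rewrite cp; right); rewrite drop_parity_capS.
  have hu := space_hcup (negbT cp) su.
  by apply: space_ext (IH n (ltnSn n) _ _ k _ hu) => [s _|]; last (by rewrite cp; right); rewrite hcup_capS.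
move=> j; have [jk|kj] := ltnP j.+1 k.
  rewrite -(subnKC jk) addSn.
  case: n IH su {h0} => [|[|n]] IH su.
  - by apply: space_ext (space0 _ _) => s sn; rewrite cap_cup_far; case: s sn => //; case: (j + _)%N.
  - apply: space_ext (space0 _ _) => s sn; rewrite cap_cup_far.
    by case: s sn => [|a []] //; case: (j + _)%N => [|[]].
  apply: space_ext (IH n (leqnSn _) _ _ (j + (k - j.+2))%N (or_introl erefl) (space_cup j su)) => // s _.
  by rewrite cap_cup_far.
have [kj'|jk'] := ltnP k.+1 j.
  rewrite -(subnKC kj') addSn.
  case: n IH su {h0} => [|[|n]] IH su.
  - apply: space_ext (space0 _ _) => s sn; rewrite cup_cap_far.
    by case: s sn => //; case: (k) => //.
  - apply: space_ext (space0 _ _) => s sn; rewrite cup_cap_far.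
    by case: s sn => [|a []] //; case: (k) => [|[]].
  apply: space_ext (IH n (leqnSn _) _ _ k (or_introl erefl) (space_cup (k + (j - k.+2))%N su)) => // s _.
  by rewrite cup_cap_far.
have [e|[e|e]] : k = j.+1 \/ k = j \/ j = k.+1 by lia.
- rewrite e; apply: space_ext (_ : space p n (if (j < n)%N then u else fun=> 0)).
    by move=> s <-; rewrite cup_capS //; case: ifP.
  by case: ifP => // _; apply: space0.
- rewrite e; apply: space_ext (_ : space p n (if (j <= n)%N then (fun s => - (t + tV) * u s) else fun=> 0)).
    by move=> s <-; rewrite cup_cap; case: ifP.
  case: ifP => _; last exact: space0.
  exact/spaceZ/su/bar_loop.
- rewrite e; apply: space_ext (_ : space p n (if (k < n)%N then u else fun=> 0)).
    by move=> s <-; rewrite cupS_cap //; case: ifP.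
  by case: ifP => // _; apply: space0.
Qed.

End Spaces.

Section SpacesA.
Context {L : comNzRingType} (t tV tN tNV : L) (bar : {rmorphism L -> L}).
Hypotheses (tK : t * tV = 1) (bar_t : bar t = tV) (bar_tV : bar tV = t).
Hypotheses (bar_tN : bar tN = tNV) (bar_tNV : bar tNV = tN).

Definition thetaA p := if odd p then - (t * tNV) else tN.
Definition thetaVA p := if odd p then - (tV * tN) else tNV.

Local Notation space := (space tV bar thetaVA pred0).

Lemma spaceA_period p n v : space p.+2 n v <-> space p n v.
Proof.
elim/ltn_ind: n p v => -[|n] IH p v //=.
have E : thetaVA p.+2 = thetaVA p by rewrite /thetaVA /= negbK.
rewrite E; split=> -[bv [hv cv]]; split=> //; split; try exact/IH.
  by case: n IH cv {hv bv} => // n IH cv k; apply/IH.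
by case: n IH cv {hv bv} => // n IH cv k; apply/IH.
Qed.

Lemma thetaAVS p : thetaVA p * t = - thetaA p.+1.
Proof.
by rewrite /thetaVA /thetaA /=; case: odd => /=; ring: tK.
Qed.

Lemma bar_loopA p : bar (- thetaA p - thetaVA p) = - thetaA p - thetaVA p.
Proof.
rewrite /thetaVA /thetaA rmorphB rmorphN; case: odd => /=.
  rewrite !rmorphN !rmorphM /= bar_t bar_tV bar_tN bar_tNV; ring.
by rewrite bar_tN bar_tNV; ring.
Qed.

Lemma spaceA_hcap p n u : space p.+1 n u -> space p n.+1 (hcap (- thetaA p) u).
Proof.
elim/ltn_ind: n p u => n IH p u su; split; first exact: space_bar su.
split.
  apply: space_ext (spaceZ (bar_loopA p) su) => s _.
  by rewrite hcup_hcap.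
case: n IH su => // n IH su [|k].
  have /spaceA_period h := space_hcup (crit := pred0) isT su.
  apply: space_ext h => s _; rewrite cup0_hcap; congr (hcup _ u s).
  have := thetaAVS p.+1; have -> : thetaA p.+2 = thetaA p by rewrite /thetaA /= negbK.
  by move=> e; rewrite -e; ring: tK.
case: n IH su => [|n] IH su.
  apply: space_ext (space0 _ _ _ _ _ _) => s s0; rewrite cup_hcapS.
  by case: s s0.
apply: space_ext (IH n _ _ _ (space_cup k su)) => // s _.
by rewrite cup_hcapS.
Qed.

Lemma spaceA_cap p n u k : space p n u -> space p n.+2 (cap t k u).
Proof.
elim/ltn_ind: n p u k => n IH p u k su.
have su0 := su; apply: space_cap_step su0 _ => //=; first by move=> n' nn q v j _; apply: IH.
apply: space_ext (spaceA_hcap (p := p.+1) _); last exact/spaceA_period/su.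
by move=> s _; rewrite hcup_cap0 thetaAVS.
Qed.

End SpacesA.

Section SpacesB.
Context {L : comNzRingType} (t tV : L) (bar : {rmorphism L -> L}) (m : nat).
Hypotheses (tK : t * tV = 1) (bar_t : bar t = tV) (bar_tV : bar tV = t).
Hypothesis m_gt0 : (0 < m)%N.

Definition thetaVB p := tV ^+ (m - p).

Local Notation space := (space tV bar thetaVB (pred1 m)).

Lemma expVK q : t ^+ q * tV ^+ q = 1.
Proof. by rewrite -exprMn tK expr1n. Qed.

Lemma bar_add_exp q : bar (t ^+ q + tV ^+ q) = t ^+ q + tV ^+ q.
Proof. by rewrite rmorphD !rmorphXn /= bar_t bar_tV addrC. Qed.

Lemma bar_loopB q : bar (- t ^+ q - tV ^+ q) = - t ^+ q - tV ^+ q.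
Proof. by rewrite -opprD rmorphN bar_add_exp. Qed.

Lemma spaceB_hcup p n v : (p < m)%N ->
  space p.+1 n.+1 v -> space p n (hcup (- t ^+ (m - p.+1)) v).
Proof.
elim/ltn_ind: n p v => n IH p v pm sv.
have [pm'|pm'] := eqVneq p.+1 m.
  rewrite pm' subnn.
  have H e := space_drop (crit := pred1 m) e (introT eqP pm') sv.
  apply: space_ext (space_lin (rmorph1 bar) (rmorph1 bar) (H false) (H true)).
  by move=> s _; rewrite hcupN1_parity; ring.
have /andP[pm2 q0] : (p.+1 < m)%N && (0 < m - p.+1)%N by lia.
have hv := space_hcup (crit := pred1 m) (p := p.+1) pm' sv.
have bw : bar (hcup (- t ^+ (m - p.+1)) v (nseq n true)) = hcup (- t ^+ (m - p.+1)) v (nseq n true).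
  have -> : hcup (- t ^+ (m - p.+1)) v (nseq n true) =
      hcup (thetaVB p.+1) v (nseq n true)
      + (t ^+ (m - p.+1) + tV ^+ (m - p.+1)) * v (nseq n.+1 true).
    by rewrite /hcup /thetaVB /=; ring.
  by rewrite rmorphD rmorphM /= (space_bar hv) bar_add_exp (space_bar sv).
case: n IH sv hv bw => [|n] IH sv hv bw; split=> //; split.
  rewrite /= ltn_eqF //.
  have kv := IH n (ltnSn n) _ _ pm2 hv; have cv := space_cup 0 sv.
  apply: space_ext (space_lin (rmorph1 bar) (bar_add_exp (m - p.+1)) kv cv) => s _.
  rewrite /hcup /thetaVB /=.
  have [q Eq] : exists q, (m - p.+1 = q.+1)%N by exists (m - p.+2)%N; lia.
  have -> : (m - p.+2 = q)%N by lia.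
  have -> : (m - p = q.+2)%N by lia.
  rewrite Eq !exprS; have := expVK q; set a := t ^+ q; set b := tV ^+ q => ab.
  by ring: tK ab.
case: n IH sv {hv bw} => // n IH sv k.
apply: space_ext (IH n _ _ _ pm (space_cup k.+1 sv)) => // s _.
by rewrite cup_hcup.
Qed.

Lemma spaceB_hcap p n u : (p < m)%N ->
  space p.+1 n u -> space p n.+1 (hcap (- t ^+ (m - p)) u).
Proof.
move=> pm; elim/ltn_ind: n u => n IH u su; split; first exact: space_bar su.
split.
  rewrite /= ltn_eqF //.
  apply: space_ext (spaceZ (bar_loopB (m - p)) su) => s _.
  by rewrite hcup_hcap.
case: n IH su => // n IH su [|k].
  apply: space_ext (spaceB_hcup pm su) => s _.
  rewrite cup0_hcap -(subnSK pm) exprS; congr (hcup _ u s).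
  by ring: tK.
case: n IH su => [|n] IH su.
  apply: space_ext (space0 _ _ _ _ _ _) => s s0; rewrite cup_hcapS.
  by case: s s0.
apply: space_ext (IH n _ _ (space_cup k su)) => // s _.
by rewrite cup_hcapS.
Qed.

Lemma spaceB_hcapV p n u : (p < m)%N ->
  space p n u -> space p.+1 n.+1 (hcap (tV ^+ (m - p.+1)) u).
Proof.
move=> pm; elim/ltn_ind: n u => n IH u su; split; first exact: space_bar su.
split.
  case: (eqVneq p.+1 m) => [pm'|pm'] /=.
    rewrite pm' eqxx => e; apply: space_ext su => s _.
    by rewrite subnn drop_parity_hcap1.
  rewrite (negbTE pm'); apply: space_ext (space0 _ _ _ _ _ _) => s _.
  by rewrite hcup_hcap /thetaVB subrr mul0r.
case: n IH su => // n IH su [|k].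
  have h := space_hcup (crit := pred1 m) (negbT (ltn_eqF pm)) su.
  apply: space_ext h => s _; rewrite cup0_hcap /thetaVB -(subnSK pm) exprS.
  by [].
case: n IH su => [|n] IH su.
  apply: space_ext (space0 _ _ _ _ _ _) => s s0; rewrite cup_hcapS.
  by case: s s0.
apply: space_ext (IH n _ _ (space_cup k su)) => // s _.
by rewrite cup_hcapS.
Qed.

Lemma spaceB_cap p n u k : (p <= m)%N -> space p n u -> space p n.+2 (cap t k u).
Proof.
elim/ltn_ind: n p u k => n IH p u k pm su.
have su0 := su; apply: space_cap_step su0 _ => //=.
  by move=> n' nn q v j qp; apply: IH => //; case: qp => ->; [lia|case: eqP; lia].
have [pm'|pm'] /= := eqVneq p m.
  move=> e; have cp : pred1 m p by rewrite /= pm'.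
  have Ep : p.-1.+1 = p by rewrite prednK // pm'.
  have su' : space p.-1.+1 n (restr (~~ e) u) by rewrite Ep; apply: space_restr.
  have pm2 : (p.-1 < m)%N by rewrite pm' prednK.
  apply: space_ext (spaceB_hcap pm2 su') => s _.
  rewrite drop_parity_cap0 pm'; congr (hcap _ _ s).
  by rewrite -[X in (X - _)%N]prednK // subSnn expr1.
have pm2 : (p < m)%N by rewrite ltn_neqAle pm' pm.
apply: space_ext (spaceB_hcapV pm2 su) => s _.
rewrite hcup_cap0 /thetaVB -(subnSK pm2) exprS; congr (hcap _ u s).
by ring: tK.
Qed.

End SpacesB.

(** * The transfer recursion *)

Notation count2 := (count id).

Section Scan.
Context {L : comNzRingType} (t : L) (sw : nat -> nat -> L).
Hypothesis sw0 : forall p, sw p 0 = 1.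
Implicit Types (al be s : seq bool) (stk : seq nat) (p c g M : nat).

Definition fits al be g := (count2 al + g <= count2 be)%N.

(* Transfer along the columns, from the last one to the first, of the strips  *)
(* crossing each step: [c] counts those that reach the last column, at height *)
(* [p] above the current running minimum of the lower path, and [stk] lists,  *)
(* for each unit of height above this minimum, how many strips have to cross  *)
(* back down.                                                                 *)
Fixpoint scan p c stk al be : L :=
  if all (fits al be) (c :: stk) then
    match al, be with
    | _ :: al', b :: be' =>
      if b then
        if stk is [::] then
          \sum_(g < (count2 be' - count2 al').+1)
            t ^+ g * (sw p (c - g) * scan p (minn c g) [:: val g] al' be')
        else \sum_(g < (count2 be' - count2 al').+1 | (head 0%N stk <= g)%N)
            t ^+ g * scan p c (val g :: stk) al' be'
      else
        if stk is h :: stk' then t ^+ h * scan p c stk' al' be'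
        else \sum_(g < c.+1) t ^+ g * (sw p (c - g) * scan p.+1 g [::] al' be')
    | _, _ => 1
    end
  else 0.

Lemma scan_out p c stk al be : ~~ all (fits al be) (c :: stk) -> scan p c stk al be = 0.
Proof. by case: al be => [|a al] [|b be] /negbTE /= ->. Qed.

Lemma scan_out1 p c stk al be g :
  g \in c :: stk -> ~~ fits al be g -> scan p c stk al be = 0.
Proof. by move=> gs ng; apply: scan_out; apply/allPn; exists g. Qed.

Lemma scan_outc p c stk al be : ~~ fits al be c -> scan p c stk al be = 0.
Proof. by apply: scan_out1; rewrite mem_head. Qed.

Lemma sum_fits M (P : pred nat) (F : nat -> L) al be :
    (forall g, ~~ fits al be g -> F g = 0) -> (count2 be < M)%N ->
  \sum_(g < (count2 be - count2 al).+1 | P g) F g = \sum_(g < M | P g) F g.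
Proof.
move=> F0 beM.
rewrite [LHS](big_ord_widen_cond M) //; last by lia.
rewrite [LHS]big_mkcondr; apply: eq_bigr => g _; case: ifP => // /negbT gF.
by rewrite F0 // /fits; lia.
Qed.

Lemma scan_true_nil p c M a al be :
    fits (a :: al) (true :: be) c -> (count2 be < M)%N ->
  scan p c [::] (a :: al) (true :: be) =
    \sum_(g < M) t ^+ g * (sw p (c - g) * scan p (minn c g) [:: val g] al be).
Proof.
rewrite /= => -> beM /=.
apply: (@sum_fits _ xpredT (fun g => t ^+ g * (sw p (c - g) * scan p (minn c g) [:: g] al be)) _ _ _ beM) => g ng.
by rewrite (scan_out1 _ (g := g)) ?inE ?eqxx ?orbT ?mulr0.
Qed.

Lemma scan_true_cons p c h stk M a al be :
    (count2 be < M)%N ->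
  scan p c (h :: stk) (a :: al) (true :: be) =
    \sum_(g < M | (h <= g)%N) t ^+ g * scan p c (val g :: h :: stk) al be.
Proof.
move=> beM; case ok: (all (fits (a :: al) (true :: be)) (c :: h :: stk)).
  rewrite /= in ok *; rewrite ok.
  apply: (@sum_fits _ (leq h) (fun g => t ^+ g * scan p c (g :: h :: stk) al be) _ _ _ beM) => g ng.
  by rewrite (scan_out1 _ (g := g)) ?inE ?eqxx ?orbT ?mulr0.
rewrite scan_out ?ok // big1 // => g _.
rewrite scan_out ?mulr0 //; apply/negP => ok'; move/negP: ok; apply.
have H x : fits al be x -> fits (a :: al) (true :: be) x.
  by rewrite /fits /=; case: a; lia.
by move: ok' => /= /and4P[/H-> _ /H-> /=]; apply: sub_all.
Qed.

Lemma scan_false_cons p c h stk a al be :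
    all (fits (a :: al) (false :: be)) (c :: h :: stk) ->
  scan p c (h :: stk) (a :: al) (false :: be) = t ^+ h * scan p c stk al be.
Proof. by rewrite /= => ->. Qed.

Lemma scan_false_nil p c a al be :
    fits (a :: al) (false :: be) c ->
  scan p c [::] (a :: al) (false :: be) =
    \sum_(g < c.+1) t ^+ g * (sw p (c - g) * scan p.+1 g [::] al be).
Proof. by rewrite /= => ->. Qed.

Lemma scan_suffix0 p c stk s1 s2 b1 b2 : size s1 = size b1 ->
  (count2 b2 < count2 s2)%N -> scan p c stk (s1 ++ s2) (b1 ++ b2) = 0.
Proof.
elim: s1 b1 p c stk => [|a s1 IH] [|b b1] p c stk // sz lt.
  by rewrite scan_outc // /fits /=; lia.
case: sz => sz; rewrite /=; case: ifP => // _.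
case: b; case: stk => [|h stk]; rewrite ?IH ?mulr0 ?big1 // => g _;
by rewrite IH ?mulr0.
Qed.

Lemma scan_flip p c stk s1 s2 b1 x y b2 : size s1 = size b1 -> ~~ (x && ~~ y) ->
  scan p c stk (s1 ++ true :: false :: s2) (b1 ++ x :: y :: b2) =
  scan p c stk (s1 ++ false :: true :: s2) (b1 ++ x :: y :: b2).
Proof.
move=> sz xy; elim: s1 b1 sz p c stk => [|a s1 IH] [|b b1] // sz p c stk; last first.
  case: sz => sz; rewrite !cat_cons.
  have Ec : count2 (s1 ++ true :: false :: s2) = count2 (s1 ++ false :: true :: s2).
    by rewrite !count_cat.
  have Ef : fits (a :: s1 ++ true :: false :: s2) (b :: b1 ++ x :: y :: b2) =
            fits (a :: s1 ++ false :: true :: s2) (b :: b1 ++ x :: y :: b2).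
    by apply/funext => g; rewrite /fits /= Ec.
  rewrite /= Ef Ec; case: ifP => // _.
  by case: b Ef => _; case: stk => [|h stk]; rewrite ?IH //; apply: eq_bigr => g _; rewrite IH.
rewrite !cat0s.
have Ef : fits (true :: false :: s2) (x :: y :: b2) =
          fits (false :: true :: s2) (x :: y :: b2) by [].
case ok: (all (fits (false :: true :: s2) (x :: y :: b2)) (c :: stk)); last first.
  by rewrite !scan_out ?Ef ?ok.
pose M := (count2 b2).+2.
have M1 : (count2 b2 < M)%N by rewrite /M; lia.
have M2 : (count2 (true :: b2) < M)%N by rewrite /M /=; lia.
have fall : {in c :: stk, forall g, fits (false :: true :: s2) (x :: y :: b2) g} by apply/allP.
case: x y xy Ef ok fall => [] [] // _ _ ok fall.
- case: stk ok fall => [|h stk] ok fall.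
    have fc := fall c (mem_head _ _).
    rewrite !(scan_true_nil _ (M := M)) //; apply: eq_bigr => g _.
    by rewrite !(scan_true_cons _ _ _ _ _ _ M1).
  rewrite !(scan_true_cons _ _ _ _ _ _ M2); apply: eq_bigr => g _.
  by rewrite !(scan_true_cons _ _ _ _ _ _ M1).
- case: stk ok fall => [|h [|h' stk]] ok fall.
  + have fc := fall c (mem_head _ _).
    rewrite !scan_false_nil //; apply: eq_bigr => -[g gc] _; rewrite [nat_of_ord _]/=.
    by rewrite !(scan_true_nil _ (M := M)) //; move: fc; rewrite /fits /=; lia.
  + have fc := fall c (mem_head _ _).
    rewrite !scan_false_cons //.
    by rewrite !(scan_true_nil _ (M := M)) //; move: fc; rewrite /fits /=; lia.
  + rewrite !scan_false_cons //.
    by rewrite !(scan_true_cons _ _ _ _ _ _ M1).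
- have fits2 g b : g \in c :: stk -> fits (b :: s2) (false :: b2) g.
    by move=> /fall; rewrite /fits /=; case: b; lia.
  case: stk ok fall fits2 => [|h [|h' stk]] ok fall fits2.
  + have fc b := fits2 c b (mem_head _ _).
    rewrite !scan_false_nil //; last exact: fall (mem_head _ _).
      apply: eq_bigr => -[g gc] _; rewrite [nat_of_ord _]/=.
      have fg b : fits (b :: s2) (false :: b2) g.
        by move: (fc b); rewrite /fits; move: gc => /=; lia.
      by rewrite !scan_false_nil.
    exact: fall (mem_head _ _).
  + rewrite !scan_false_cons // !scan_false_nil //; exact: fits2 (mem_head _ _).
  + rewrite !scan_false_cons //; apply/allP => g gs; apply: fits2;
    by move: gs; rewrite !inE => /or3P[] -> //; rewrite ?orbT.
Qed.

Lemma scan_peak p c stk s1 s2 b1 b2 : size s1 = size b1 -> sorted geq (rcons stk c) ->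
  scan p c stk (s1 ++ true :: false :: s2) (b1 ++ true :: false :: b2) =
  scan p c stk (s1 ++ false :: true :: s2) (b1 ++ true :: false :: b2)
  + t ^+ (count2 b2 - count2 s2).*2 * scan p c stk (s1 ++ s2) (b1 ++ b2).
Proof.
move=> sz; elim: s1 b1 sz p c stk => [|a s1 IH] [|b b1] // sz p c stk srt; last first.
  case: sz => sz; rewrite !cat_cons.
  have Ec u v : (u != v) -> count2 (s1 ++ u :: v :: s2) = (count2 (s1 ++ s2)).+1.
    by rewrite !count_cat /=; case: u; case: v => //= _; lia.
  have Eb : count2 (b1 ++ true :: false :: b2) = (count2 (b1 ++ b2)).+1.
    by rewrite !count_cat /=; lia.
  have Ef u v : (u != v) -> fits (a :: s1 ++ u :: v :: s2) (b :: b1 ++ true :: false :: b2) =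
            fits (a :: s1 ++ s2) (b :: b1 ++ b2).
    by move=> uv; apply/funext => g; rewrite /fits /= Ec // Eb; lia.
  rewrite /= !Ef // !Ec // Eb subSS; case: ifP => _; last by rewrite mulr0 addr0.
  case: b {Ef} => /=; case: stk srt => [|h stk] srt.
  - rewrite mulr_sumr -big_split; apply: eq_bigr => g _ /=.
    by rewrite IH //= ?andbT ?geq_minr //; ring.
  - rewrite mulr_sumr -big_split; apply: eq_bigr => g hg /=.
    by rewrite IH //=; [ring | apply/andP].
  - rewrite mulr_sumr -big_split; apply: eq_bigr => g _ /=.
    by rewrite IH //; ring.
  - by rewrite IH //; [ring | apply: path_sorted srt].
rewrite !cat0s.
have Ef u v : u != v -> fits (u :: v :: s2) (true :: false :: b2) = fits s2 b2.
  by move=> uv; apply/funext => g; rewrite /fits /=; case: u uv; case: v => //= _; lia.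
case ok: (all (fits s2 b2) (c :: stk)); last first.
  by rewrite !scan_out ?Ef ?ok // mulr0 addr0.
have fc : fits s2 b2 c by case/andP: ok.
pose F := (count2 b2 - count2 s2)%N.
have cF : (count2 s2 + F = count2 b2)%N by move: fc; rewrite /fits /F; lia.
pose M := (count2 b2).+1.
have FM : (F < M)%N by rewrite /F /M; lia.
have M2 : (count2 (false :: b2) < M)%N by rewrite /M /=; lia.
have mid q d g (s : seq nat) (a : bool) : (forall x, x \in d :: s -> (x <= g)%N) ->
  scan q d (g :: s) (a :: s2) (false :: b2) =
    if (g + a <= F)%N then t ^+ g * scan q d s s2 b2 else 0.
  move=> ds; case: ifP => ga; last first.
    by rewrite (scan_out1 _ (g := g)) ?inE ?eqxx ?orbT // /fits /=; lia.
  rewrite scan_false_cons //; apply/allP => x xs.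
  have xg : (x <= g)%N.
    by move: xs; rewrite !inE => /or3P[xd|/eqP->//|xs]; apply: ds; rewrite inE ?xd ?xs ?orbT.
  by rewrite /fits /=; lia.
pose oF : 'I_M := Ordinal FM.
have E (P : pred nat) (A : nat -> L) : P F ->
  \sum_(g < M | P g) t ^+ g * (if (g + false <= F)%N then t ^+ g * A g else 0) =
  \sum_(g < M | P g) t ^+ g * (if (g + true <= F)%N then t ^+ g * A g else 0)
  + t ^+ F.*2 * A F.
  move=> PF; rewrite (bigD1 oF) //= [in RHS](bigD1 oF) //= addn0 leqnn addn1 ltnn mulr0 add0r.
  rewrite addrC mulrA -exprD addnn; congr (_ + _); apply: eq_bigr => g /andP[_].
  rewrite -val_eqE /= => gF; rewrite addn0 addn1.
  by have -> : (g <= F)%N = (g < F)%N by lia.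
case: stk srt ok => [|h stk] srt ok.
  rewrite !(scan_true_nil _ (M := M)) ?Ef //; [|move: fc; rewrite /fits /=; lia..].
  pose A g := sw p (c - g) * scan p (minn c g) [::] s2 b2.
  have EA a : \sum_(g < M) t ^+ g * (sw p (c - g) * scan p (minn c g) [:: val g] (a :: s2) (false :: b2))
    = \sum_(g < M | xpredT (nat_of_ord g)) t ^+ g * (if (g + a <= F)%N then t ^+ g * A g else 0).
    apply: eq_bigr => g _; rewrite mid => [|x]; last by rewrite inE => /eqP->; apply: geq_minr.
    by case: ifP => _; rewrite /A; ring.
  rewrite !EA (E xpredT A) // /A.
  have -> : (c - F = 0)%N by move: fc; rewrite /fits; lia.
  have -> : minn c F = c by move: fc; rewrite /fits; lia.
  by rewrite sw0 mul1r.
rewrite !(scan_true_cons _ _ _ _ _ _ M2).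
have le_h x : x \in c :: h :: stk -> (x <= h)%N.
  have := order_path_min (fun a b c (ab : geq b a) bc => leq_trans bc ab) srt.
  move/allP => H; rewrite !inE => /or3P[/eqP->|/eqP->|xs] //; apply: H;
  by rewrite mem_rcons inE ?eqxx ?xs ?orbT.
have EA a : \sum_(g < M | (h <= g)%N) t ^+ g * scan p c [:: val g, h & stk] (a :: s2) (false :: b2)
    = \sum_(g < M | (leq h) (nat_of_ord g)) t ^+ g * (if (g + a <= F)%N then t ^+ g * scan p c (h :: stk) s2 b2 else 0).
  apply: eq_bigr => g hg; rewrite mid // => x xs.
  exact: leq_trans (le_h x xs) hg.
rewrite !EA (E (leq h) (fun=> scan p c (h :: stk) s2 b2)) //.
by case/and3P: ok => _; rewrite /fits /=; lia.
Qed.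

End Scan.

Fixpoint area (al be : seq bool) : nat :=
  match al, be with
  | _ :: al', _ :: be' => count2 be' - count2 al' + area al' be'
  | _, _ => 0
  end.

Lemma area_swap s1 s2 b1 x y b2 : size s1 = size b1 ->
  (area (s1 ++ true :: false :: s2) (b1 ++ x :: y :: b2) + (y + count2 b2 - (count2 s2).+1) =
   area (s1 ++ false :: true :: s2) (b1 ++ x :: y :: b2) + (y + count2 b2 - count2 s2))%N.
Proof.
elim: s1 b1 => [|a s1 IH] [|b b1] //= sz; first by rewrite !add0n !add1n; lia.
case: sz => sz; have := IH _ sz; rewrite !count_cat /=; lia.
Qed.

Lemma area_peak s1 s2 b1 b2 : size s1 = size b1 ->
  (area (s1 ++ true :: false :: s2) (b1 ++ true :: false :: b2) =
   area (s1 ++ s2) (b1 ++ b2) + (count2 b2 - count2 s2).*2)%N.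
Proof.
elim: s1 b1 => [|a s1 IH] [|b b1] //= sz; first by rewrite !add0n; lia.
case: sz => sz; have := IH _ sz; rewrite !count_cat /=; lia.
Qed.

Section KLVectors.
Context {L : comNzRingType} (t tV tNV : L) (sw : nat -> nat -> L).
Hypotheses (tK : t * tV = 1) (sw0 : forall p, sw p 0 = 1).
Implicit Types (al be s : seq bool) (p c g : nat).

Definition klvec p be al : L :=
  tV ^+ area al be * (tNV ^+ (count2 be - count2 al)
    * scan t sw p (count2 be - count2 al) [::] al be).

Lemma klvec0 p be al : (count2 be < count2 al)%N -> klvec p be al = 0.
Proof. by move=> lt; rewrite /klvec scan_outc ?mulr0 // /fits; lia. Qed.

Lemma klvec_suffix0 p s1 s2 b1 b2 : size s1 = size b1 ->
  (count2 b2 < count2 s2)%N -> klvec p (b1 ++ b2) (s1 ++ s2) = 0.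
Proof. by move=> sz lt; rewrite /klvec scan_suffix0 ?mulr0. Qed.

Lemma area_diag be : area be be = 0%N.
Proof. by elim: be => //= b be ->; rewrite subnn. Qed.

Lemma scan_diag p k be : scan t sw p 0 (nseq k 0%N) be be = 1.
Proof.
elim: be p k => [|b be IH] p k.
  by rewrite /= all_nseq ?orbT.
have ok : all (fits (b :: be) (b :: be)) (0%N :: nseq k 0%N).
  by rewrite /= all_nseq /fits addn0 leqnn orbT.
move: ok; rewrite /= => -> /=; rewrite !subnn.
case: b; case: k => [|k]; rewrite ?(big_ord1, big_ord1_cond) /= mul1r ?minnn ?sw0 ?mul1r.
- exact: (IH _ 1%N).
- exact: (IH _ k.+2).
- exact: (IH _ 0%N).
- exact: IH.
Qed.

Lemma klvec_diag p be : klvec p be be = 1.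
Proof. by rewrite /klvec subnn area_diag !mul1r (scan_diag p 0). Qed.

Lemma klvec_nseq p n be : size be = n -> klvec p be (nseq n true) = (be == nseq n true)%:R.
Proof.
move=> <-; have [e|ne] := eqVneq be _.
  by rewrite -e klvec_diag.
rewrite klvec0 // count_nseq mul1n ltn_neqAle count_size andbT.
apply: contra ne => e; apply/eqP; move: e; rewrite -all_count.
by elim: be => //= -[] be IH //= /IH {1}->.
Qed.

Lemma cup_cat v s1 s2 : cup tV (size s1) v (s1 ++ s2) =
  v (s1 ++ true :: false :: s2) - tV * v (s1 ++ false :: true :: s2).
Proof. by elim: s1 v => //= a s1 IH v; rewrite IH. Qed.

Lemma cup_size k v s : (size s < k)%N -> cup tV k v s = 0.
Proof. by elim: k v s => [|k IH] v [|a s] //= sk; rewrite IH. Qed.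

Lemma cup_klvec_peak p b1 b2 s : size s = (size b1 + size b2)%N ->
  cup tV (size b1) (klvec p (b1 ++ true :: false :: b2)) s = klvec p (b1 ++ b2) s.
Proof.
move=> sz; rewrite -(cat_take_drop (size b1) s).
have : size (take (size b1) s) = size b1 by rewrite size_take sz; case: ifP => //; lia.
move: (take _ s) (drop _ s) => s1 s2 sz1; rewrite -sz1 cup_cat.
have [lt|le] := ltnP (count2 b2) (count2 s2).
  have z u w : klvec p (b1 ++ true :: w :: b2) (s1 ++ u :: ~~ u :: s2) = 0.
    have := @klvec_suffix0 p (rcons (rcons s1 u) (~~ u)) s2 (rcons (rcons b1 true) w) b2.
    by rewrite !cat_rcons; apply; rewrite ?size_rcons ?sz1.
  rewrite [RHS]klvec_suffix0 //; have := z false false; have := z true false.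
  by rewrite /= => -> ->; rewrite mulr0 subr0.
rewrite /klvec.
have Ed u v : (u != v) -> (count2 (b1 ++ true :: false :: b2) - count2 (s1 ++ u :: v :: s2) =
                          count2 (b1 ++ b2) - count2 (s1 ++ s2))%N.
  by rewrite !count_cat /=; case: u; case: v => //= _; lia.
rewrite !Ed // (area_peak _ _ sz1) scan_peak //.
have := area_swap s2 true false b2 sz1; rewrite (area_peak _ _ sz1).
set F := (count2 b2 - count2 s2)%N; set D := (count2 (b1 ++ b2) - _)%N.
set A := area _ _; set A' := area _ _; set Y := scan _ _ _ _ _ (s1 ++ s2) _.
set Z := scan _ _ _ _ _ _ _ => eA.
have tF : tV ^+ F.*2 * t ^+ F.*2 = 1 by rewrite -exprMn mulrC tK expr1n.
have [F0|F0] := posnP F.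
  have -> : Z = 0.
    have := @scan_suffix0 _ t sw p D [::] (rcons s1 false) (true :: s2) (rcons b1 true) (false :: b2).
    by rewrite !cat_rcons; apply; rewrite ?size_rcons ?sz1 //= ?add0n ?add1n; move: F0; rewrite /F; lia.
  by rewrite F0 addn0 mul1r; ring.
have eA' : (A + F.*2 = A'.+1)%N by move: eA F0; rewrite /F; lia.
rewrite eA' exprS.
have -> : tV ^+ A = tV * tV ^+ A' * t ^+ F.*2.
  by rewrite -exprS -eA' exprD -mulrA tF mulr1.
by ring.
Qed.

Lemma cup_klvec0 p b1 x y b2 s : size s = (size b1 + size b2)%N -> ~~ (x && ~~ y) ->
  cup tV (size b1) (klvec p (b1 ++ x :: y :: b2)) s = 0.
Proof.
move=> sz xy; rewrite -(cat_take_drop (size b1) s).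
have : size (take (size b1) s) = size b1 by rewrite size_take sz; case: ifP => //; lia.
move: (take _ s) (drop _ s) => s1 s2 sz1; rewrite -sz1 cup_cat.
rewrite /klvec scan_flip //.
have -> : count2 (s1 ++ true :: false :: s2) = count2 (s1 ++ false :: true :: s2).
  by rewrite !count_cat.
have [lt|le] := ltnP (y + count2 b2) (count2 s2).+1.
  have -> : scan t sw p (count2 (b1 ++ x :: y :: b2) - count2 (s1 ++ false :: true :: s2)) [::]
     (s1 ++ false :: true :: s2) (b1 ++ x :: y :: b2) = 0; last by rewrite !mulr0 subr0.
  have := @scan_suffix0 _ t sw p (count2 (b1 ++ x :: y :: b2) - count2 (s1 ++ false :: true :: s2)) [::] (rcons s1 false) (true :: s2) (rcons b1 x) (y :: b2).
  by rewrite !cat_rcons; apply; rewrite ?size_rcons ?sz1 //= ?add0n ?add1n; lia.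
have -> : area (s1 ++ true :: false :: s2) (b1 ++ x :: y :: b2) =
          (area (s1 ++ false :: true :: s2) (b1 ++ x :: y :: b2)).+1.
  by have := area_swap s2 x y b2 sz1; lia.
by rewrite exprS; ring.
Qed.

Lemma hcup_klvec_false p e be s : (forall n, sw p n = e ^+ n) -> size s = size be ->
  hcup (tNV * e) (klvec p (false :: be)) s = klvec p.+1 be s.
Proof.
move=> swe sz; rewrite /hcup.
have [lt|le] := ltnP (count2 be) (count2 s).
  by rewrite !klvec0 ?mulr0 ?subr0 //=; lia.
rewrite /klvec /area -/area [count2 (false :: _)]/= [count2 (true :: _)]/= [count2 (false :: s)]/= !add0n add1n.
set f := (count2 be - count2 s)%N.
have ff : (count2 s + f = count2 be)%N by rewrite /f; lia.
rewrite scan_false_nil; last by rewrite /fits /= !add0n ff.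
case Ef: f => [|f'].
  rewrite [scan t sw p _ _ (true :: s) _]scan_outc; last by rewrite /fits /=; lia.
  by rewrite big_ord1 swe /= !add0n; ring.
have -> : (count2 be - (count2 s).+1 = f')%N by rewrite /f in Ef; lia.
rewrite scan_false_nil; last by rewrite /fits /=; lia.
rewrite big_ord_recr /= subnn swe mul1r.
have -> : \sum_(g < f'.+1) t ^+ g * (sw p (f'.+1 - g) * scan t sw p.+1 g [::] s be) =
          e * \sum_(g < f'.+1) t ^+ g * (sw p (f' - g) * scan t sw p.+1 g [::] s be).
  rewrite mulr_sumr; apply: eq_bigr => -[g gf] _ /=.
  by rewrite !swe subSn // exprS; ring.
have tf : tV ^+ f'.+1 * t ^+ f'.+1 = 1 by rewrite -exprMn mulrC tK expr1n.
rewrite exprD; set S := \sum_(_ < _) _.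
transitivity (tV ^+ f'.+1 * t ^+ f'.+1 * (tV ^+ area s be * (tNV ^+ f'.+1 * scan t sw p.+1 f'.+1 [::] s be))).
  by rewrite [tNV ^+ _]exprS; ring.
by rewrite tf mul1r.
Qed.

Lemma hcup_klvec_true p e be s : (forall n, sw p n = e ^+ n) -> size s = size be ->
  hcup (tNV * e) (klvec p (true :: be)) s = 0.
Proof.
move=> swe sz; rewrite /hcup.
have [lt|le] := ltnP (count2 be) (count2 s).
  rewrite (klvec_suffix0 _ (s1 := [:: false]) (b1 := [:: true])) //.
  by rewrite (klvec_suffix0 _ (s1 := [:: true]) (b1 := [:: true])) // mulr0 subr0.
rewrite /klvec /area -/area [count2 (false :: _)]/= ![count2 (true :: _)]/= !add0n !add1n subSS.
have -> : ((count2 be).+1 - count2 s = (count2 be - count2 s).+1)%N by lia.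
set f := (count2 be - count2 s)%N.
have ff : (count2 s + f = count2 be)%N by rewrite /f; lia.
rewrite !(@scan_true_nil _ _ _ _ _ (count2 be).+1) //; try by rewrite /fits /=; lia.
have -> : \sum_(g < (count2 be).+1) t ^+ g * (sw p (f.+1 - g) * scan t sw p (minn f.+1 g) [:: val g] s be) =
          e * \sum_(g < (count2 be).+1) t ^+ g * (sw p (f - g) * scan t sw p (minn f g) [:: val g] s be).
  rewrite mulr_sumr; apply: eq_bigr => -[g gf] _ /=.
  have [fg|gf'] := ltnP f g.
    by rewrite !(@scan_out1 _ _ _ _ _ _ _ _ g) ?inE ?eqxx ?orbT ?mulr0 // /fits; lia.
  rewrite ?(minn_idPr gf') (minn_idPr (leqW gf')) !swe subSn // exprS; ring.
by rewrite exprS; ring.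
Qed.

End KLVectors.

Section CriticalLevel.
Context {L : comNzRingType} (t tV : L) (m : nat).
Hypotheses (tK : t * tV = 1) (m_gt0 : (0 < m)%N).
Implicit Types (al be s : seq bool) (stk : seq nat) (p c g : nat).

Definition swB p n : L :=
  if (p < m)%N then t ^+ (p * n)
  else if odd (p - m) then (n == 0%N)%:R else (~~ odd n)%:R * t ^+ (m * n).

Local Notation scan := (scan t swB).

Lemma swB0 p : swB p 0 = 1.
Proof. by rewrite /swB !muln0 /= !mulr1 !if_same. Qed.

Lemma swB_lt p n : (p < m)%N -> swB p n = (t ^+ p) ^+ n.
Proof. by rewrite /swB => ->; rewrite exprM. Qed.

Lemma swB_m n : swB m n = (~~ odd n)%:R * t ^+ (m * n).
Proof. by rewrite /swB ltnn subnn. Qed.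

Lemma swB_mS n : swB m.+1 n = (n == 0%N)%:R.
Proof. by rewrite /swB ltnNge leqnSn /= subSn // subnn. Qed.

Lemma swB_period p n : (m <= p)%N -> swB p.+2 n = swB p n.
Proof.
move=> mp; rewrite /swB !ltnNge mp (leq_trans mp) /= ?(leqW (leqnSn p)) //.
by rewrite subSn ?leqW // subSn //= negbK.
Qed.

Lemma scanB_period p c stk al be : (m <= p)%N ->
  scan p.+2 c stk al be = scan p c stk al be.
Proof.
elim: al be p c stk => [|a al IH] [|b be] p c stk mp //=.
case: ifP => // _; case: b; case: stk => [|h stk]; rewrite ?IH //;
by apply: eq_bigr => g _; rewrite IH ?leqW // ?swB_period.
Qed.

Lemma scanB_odd p c stk al be : (m <= p)%N -> size al = size be -> odd c ->
  scan p c stk al be = 0.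
Proof.
move=> mp sz; elim: al be p c stk sz mp => [|a al IH] [|b be] // p c stk sz mp oc.
  by rewrite scan_outc // /fits /= add0n leqn0; case: c oc.
case: sz => sz; rewrite /=; case: ifP => // _.
have sw_odd g : (g <= c)%N -> ~~ odd g -> swB p (c - g) = 0.
  move=> gc og; rewrite /swB ltnNge mp /= (oddB gc) oc (negbTE og) /= mul0r.
  have cg : (c - g)%N != 0%N by rewrite subn_eq0 -ltnNge ltn_neqAle gc andbT; apply: contra og => /eqP->.
  by rewrite (negbTE cg) if_same.
case: b; case: stk => [|h stk].
- rewrite big1 // => -[g gM] _ /=; have [cg|gc] := ltnP c g.
    by rewrite ?(minn_idPl (ltnW cg)) IH ?mulr0.
  rewrite ?(minn_idPr gc); case og: (odd g); first by rewrite IH ?mulr0.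
  by rewrite sw_odd ?og // mul0r mulr0.
- by rewrite big1 // => g _; rewrite IH ?mulr0.
- rewrite big1 // => -[g gM] _ /=.
  case og: (odd g); first by rewrite IH ?mulr0 // leqW.
  by rewrite sw_odd ?og // mul0r mulr0.
- by rewrite IH ?mulr0.
Qed.

Lemma scanB_rcons c stk al be :
  scan m.+1 c stk al be = scan m c (rcons stk c) al be.
Proof.
elim: al be c stk => [|a al IH] [|b be] c stk; try by rewrite /= !all_rcons; case: (fits _ _ c).
rewrite /= !all_rcons; case: (fits _ _ c) => //=; case: (all _ _) => //.
case: b; case: stk => [|h stk] /=.
- rewrite [RHS]big_mkcond; apply: eq_bigr => -[g gM] _ /=.
  rewrite swB_mS subn_eq0; case: leqP => cg; last by rewrite mul0r mulr0.
  by rewrite ?(minn_idPl cg) IH mul1r.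
- by apply: eq_bigr => g _; rewrite IH.
- rewrite (bigD1 ord_max) //= big1 => [|[g gc]]; last first.
    rewrite -val_eqE /= => gc'; rewrite swB_mS subn_eq0.
    have -> : (c <= g)%N = false by lia.
    by rewrite mul0r mulr0.
  by rewrite addr0 swB_mS subnn mul1r scanB_period.
- by rewrite IH.
Qed.

Lemma geq_trans : transitive geq.
Proof. by move=> a b c ba cb; apply: leq_trans cb ba. Qed.

(* Among the strips reaching the last column, those that start at height at   *)
(* least [m] come in pairs; resumming over the pairs turns the level [m + 1]  *)
(* into the level [m - 1].                                                    *)
Lemma scanB_pairs c stk al be : size al = size be -> fits al be c ->
    sorted geq (rcons stk c) ->
  \sum_(g < c.+1 | ~~ odd g) t ^+ (g + m * (c - g)) * scan m.+1 g stk al be =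
  t ^+ c * scan m.-1 c stk al be.
Proof.
elim: al be c stk => [|a al IH] [|b be] // c stk sz fc srt.
  have -> : c = 0%N by move: fc; rewrite /fits /=; lia.
  by rewrite big_mkcond big_ord1 /= muln0.
case: sz => sz; case ok: (all (fits (a :: al) (b :: be)) stk); last first.
  have z p g : scan p g stk (a :: al) (b :: be) = 0.
    by rewrite scan_out // [all _ _]/= ok andbF.
  by rewrite z mulr0 big1 // => g _; rewrite z mulr0.
have le_stk x : x \in stk -> (c <= x)%N.
  elim: stk srt {ok} => [|h stk IHs] //= srt; rewrite inE => /orP[/eqP->|]; last first.
    by apply: IHs; apply: path_sorted srt.
  have /allP := order_path_min geq_trans srt.
  by apply; rewrite mem_rcons mem_head.
have fg g : (g <= c)%N -> fits (a :: al) (b :: be) g.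
  by move=> gc; move: fc; rewrite /fits; lia.
have exch M (P : pred nat) (F : nat -> nat -> L) :
    \sum_(g < c.+1 | ~~ odd g) t ^+ (g + m * (c - g)) * (\sum_(g' < M | P g') F g g')
  = \sum_(g' < M | P g') \sum_(g < c.+1 | ~~ odd g) t ^+ (g + m * (c - g)) * F g g'.
  by rewrite exchange_big /=; apply: eq_bigr => g _; rewrite mulr_sumr.
pose M := (count2 be).+1.
case: b fc fg ok => fc fg ok; case: stk srt le_stk ok => [|h stk] srt le_stk ok.
- under eq_bigr => g _ do rewrite (@scan_true_nil _ _ _ _ _ M) ?fg ?ltnSn // -1?ltnS //.
  rewrite (exch M xpredT (fun g g' => t ^+ g' * (swB m.+1 (g - g') * scan m.+1 (minn g g') [:: g'] al be))).
  rewrite (@scan_true_nil _ _ _ _ _ M) // mulr_sumr; apply: eq_bigr => -[g' g'M] _ /=.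
  case fg': (fits al be g'); last first.
    rewrite (@scan_out1 _ _ _ _ _ _ _ _ g') ?inE ?eqxx ?orbT ?mulr0 ?fg' // big1 // => g _.
    by rewrite (@scan_out1 _ _ _ _ _ _ _ _ g') ?inE ?eqxx ?orbT ?mulr0 ?fg'.
  pose d := minn c g'.
  have srt' : sorted geq (rcons [:: g'] d) by rewrite /= andbT geq_minr.
  have fd : fits al be d by move: fg'; rewrite /fits /d; lia.
  have := IH be d [:: g'] sz fd srt'.
  transitivity (t ^+ g' * t ^+ (m * (c - d)) *
    \sum_(g < d.+1 | ~~ odd g) t ^+ (g + m * (d - g)) * scan m.+1 g [:: g'] al be).
    rewrite [in RHS](big_ord_widen_cond c.+1 (fun g => ~~ odd g) (fun g => t ^+ (g + m * (d - g)) * scan m.+1 g [:: g'] al be)); last by rewrite ltnS geq_minl.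
    rewrite mulr_sumr [RHS]big_mkcondr; apply: eq_bigr => -[g gc] og /=.
    rewrite swB_mS subn_eq0; have -> : (g <= g')%N = (g < d.+1)%N by rewrite /d; lia.
    case: ifP => gd; last by rewrite mul0r !mulr0.
    have -> : minn g g' = g by move: gd; rewrite /d; lia.
    rewrite mul1r; have -> : (c - g = (c - d) + (d - g))%N by move: gd; rewrite /d; lia.
    by rewrite mulnDr !exprD; ring.
  rewrite IH // swB_lt ?prednK //.
  have -> : (t ^+ m.-1) ^+ (c - g') = (t ^+ m.-1) ^+ (c - d).
    by congr (_ ^+ _); rewrite /d; lia.
  have -> : t ^+ c = t ^+ d * t ^+ (c - d) by rewrite -exprD; congr (_ ^+ _); rewrite /d; lia.
  have -> : t ^+ (m * (c - d)) = t ^+ (c - d) * (t ^+ m.-1) ^+ (c - d).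
    by rewrite -exprM -exprD -mulSn prednK.
  by rewrite -/d; move: (t ^+ d) (t ^+ (c - d)) => u v; ring.
- under eq_bigr => g _ do rewrite (@scan_true_cons _ _ _ _ _ _ _ M) //.
  rewrite (exch M (leq h) (fun g g' => t ^+ g' * scan m.+1 g [:: g', h & stk] al be)).
  rewrite (@scan_true_cons _ _ _ _ _ _ _ M) // mulr_sumr; apply: eq_bigr => -[g' g'M] /= hg'.
  case fg': (fits al be g'); last first.
    rewrite (@scan_out1 _ _ _ _ _ _ _ _ g') ?inE ?eqxx ?orbT ?mulr0 ?fg' // big1 // => g _.
    by rewrite (@scan_out1 _ _ _ _ _ _ _ _ g') ?inE ?eqxx ?orbT ?mulr0 ?fg'.
  have ch := le_stk h (mem_head _ _).
  have fc' : fits al be c by move: fg'; rewrite /fits; lia.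
  have srt' : sorted geq (rcons [:: g', h & stk] c) by rewrite /= hg'.
  rewrite mulrCA -IH // mulr_sumr; apply: eq_bigr => g _.
  by rewrite mulrCA.
- have fc' : fits al be c by move: fc; rewrite /fits /=; case: a {fg ok}; lia.
  have fle x : (x <= c)%N -> fits al be x by move: fc'; rewrite /fits; lia.
  rewrite scan_false_nil // prednK // mulr_sumr big_mkcond; apply: eq_bigr => -[g gc] _; rewrite [nat_of_ord _]/=.
  case: ifP => [_|/negbFE og]; last by rewrite (scanB_odd (p := m)) // !mulr0.
  have -> : scan m.+1 g [::] (a :: al) (false :: be) = t ^+ g * scan m g [::] al be.
    rewrite scan_false_nil ?fg // (bigD1 ord_max) //= big1 => [|[g' gg]]; last first.
      rewrite -val_eqE /= => gc'; rewrite swB_mS subn_eq0.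
      have -> : (g <= g')%N = false by lia.
    by rewrite mul0r mulr0.
    by rewrite addr0 swB_mS subnn mul1r scanB_period.
  rewrite swB_lt ?prednK // -exprM !mulrA -!exprD; congr (t ^+ _ * _).
  have [m' Em] : exists m', m = m'.+1 by exists m.-1; rewrite prednK.
  rewrite Em /= mulSn; move: gc; rewrite ltnS => gc.
  by rewrite -{2}(subnKC gc); lia.
- have fs : all (fits (a :: al) (false :: be)) (c :: h :: stk) by rewrite /= fc.
  rewrite scan_false_cons // mulrCA -IH //.
  + rewrite mulr_sumr; apply: eq_bigr => -[g gc] _; rewrite [nat_of_ord _]/=.
    rewrite scan_false_cons; first by rewrite mulrCA.
    by rewrite [all _ _]/= fg //=.
  + by move: fc; rewrite /fits /=; case: (a); lia.
  + exact: path_sorted srt.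
Qed.

Lemma scanB_oddS c al be : size al = size be -> fits al be c -> odd c ->
  t ^+ c * scan m.-1 c [::] al be = t ^+ m * (t ^+ c.-1 * scan m.-1 c.-1 [::] al be).
Proof.
move=> sz fc oc; rewrite -!scanB_pairs //; last by move: fc; rewrite /fits; lia.
case: c oc fc => //= c oc fc; rewrite [LHS]big_mkcond big_ord_recr /= oc addr0 -big_mkcond mulr_sumr.
apply: eq_bigr => -[g gc] _ /=; rewrite mulrA -exprD; congr (t ^+ _ * _).
by move: gc; rewrite ltnS => gc; rewrite subSn // mulnS; lia.
Qed.

Lemma scanB_sum k f s be : size s = size be -> fits s be f ->
  \sum_(g < f.+1) t ^+ g * (swB m (k + f - g) * scan m.+1 g [::] s be) =
  if odd (k + f) then 0 else t ^+ (m * k) * (t ^+ f * scan m.-1 f [::] s be).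
Proof.
move=> sz ff; rewrite -scanB_pairs //.
have E (g : 'I_f.+1) : t ^+ g * (swB m (k + f - g) * scan m.+1 g [::] s be) =
    if ~~ odd (k + f) && ~~ odd g then
      t ^+ (m * k) * (t ^+ (g + m * (f - g)) * scan m.+1 g [::] s be) else 0.
  case: g => g gf /=; rewrite ltnS in gf; rewrite swB_m oddB; last by rewrite (leq_trans gf) ?leq_addl.
  case og: (odd g); first by rewrite (scanB_odd (p := m.+1)) // !mulr0 andbF.
  rewrite addbF andbT; case: (odd (k + f)) => /=; first by rewrite !mul0r mulr0.
  rewrite mul1r mulrA -exprD mulrA -exprD; congr (t ^+ _ * _).
  by rewrite -addnBA // mulnDr; lia.
under eq_bigr => g _ do rewrite E; case: (odd (k + f)) => /=; first by rewrite big1.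
by rewrite -big_mkcond mulr_sumr.
Qed.

Lemma klvec_critical a b be s : size s = size be ->
  klvec t tV (tV ^+ m) swB m (b :: be) (a :: s) =
  if odd (count2 (b :: be) + count2 (a :: s)) then 0
  else klvec t tV (tV ^+ m) swB m.-1 be s.
Proof.
move=> sz; have [lt|le] := ltnP (count2 be) (count2 s).
  by rewrite (klvec_suffix0 _ _ _ _ _ (s1 := [:: a]) (b1 := [:: b])) // klvec0 // if_same.
rewrite /klvec /area -/area [count2 (b :: be)]/= [count2 (a :: s)]/=.
set f := (count2 be - count2 s)%N.
have ff : (count2 s + f = count2 be)%N by rewrite /f; lia.
have fits_f : fits s be f by rewrite /fits ff.
have tf n : tV ^+ n * t ^+ n = 1 by rewrite -exprMn mulrC tK expr1n.
set A := area s be; set x := scan m.-1 f [::] s be.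
have Es k : \sum_(g < (count2 be).+1) t ^+ g * (swB m (k + f - g) * scan m (minn (k + f) g) [:: val g] s be) =
  if odd (k + f) then 0 else t ^+ (m * k) * (t ^+ f * x).
  rewrite -scanB_sum //.
  rewrite [RHS](big_ord_widen (count2 be).+1 (fun g => t ^+ g * (swB m (k + f - g) * scan m.+1 g [::] s be))); last by rewrite /f; lia.
  rewrite [RHS]big_mkcond; apply: eq_bigr => -[g gM] _ /=; rewrite ltnS.
  case: leqP => gf; last by rewrite (@scan_out1 _ _ _ _ _ _ _ _ g) ?inE ?eqxx ?orbT ?mulr0 // /fits; lia.
  by rewrite scanB_rcons; have -> : minn (k + f) g = g by lia.
case: a; case: b; rewrite ?[nat_of_bool true]/= ?[nat_of_bool false]/= ?add0n ?add1n.
- rewrite subSS -/f (@scan_true_nil _ _ _ _ _ (count2 be).+1) //; try by rewrite /fits /=; lia.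
  rewrite (Es 0%N) muln0 mul1r.
  have -> : odd ((count2 be).+1 + (count2 s).+1) = odd f by rewrite -ff; lia.
  case: odd; first by rewrite !mulr0.
  by rewrite [tV ^+ (_ + _)]exprD -[RHS]mul1r -(tf f); ring.
- have -> : odd (count2 be + (count2 s).+1) = ~~ odd f by rewrite -ff; lia.
  case Ef: f => [|f'].
    rewrite scan_outc ?mulr0 // /fits /=; lia.
  have Ed : (count2 be - (count2 s).+1 = f')%N by move: Ef; rewrite /f; lia.
  have ff' : fits s be f' by rewrite /fits; lia.
  rewrite Ed scan_false_nil; try by rewrite /fits /=; lia.
  rewrite (scanB_sum 0) // muln0 mul1r add0n [odd f'.+1]/= negbK.
  case of': (odd f'); first by rewrite !mulr0.
  have := @scanB_oddS f s be sz fits_f; rewrite Ef /= of' => /(_ isT) E.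
  rewrite /x Ef.
  have -> : scan m.-1 f'.+1 [::] s be = tV ^+ f'.+1 * (t ^+ m * (t ^+ f' * scan m.-1 f' [::] s be)).
    by rewrite -E mulrA tf mul1r.
  rewrite [(tV ^+ m) ^+ f'.+1]exprS -[LHS]mul1r -(tf m) [tV ^+ (_ + _)]exprD; ring.
- have -> : ((count2 be).+1 - count2 s = f.+1)%N by rewrite /f; lia.
  rewrite (@scan_true_nil _ _ _ _ _ (count2 be).+1) //; try by rewrite /fits /=; lia.
  rewrite (Es 1%N) muln1 add1n.
  have -> : odd ((count2 be).+1 + count2 s) = odd f.+1 by rewrite -ff; lia.
  case: odd; first by rewrite !mulr0.
  rewrite [tV ^+ (_ + _)]exprD [_ ^+ f.+1]exprS; move: (tf f) (tf m).
  move: (tV ^+ f) (t ^+ f) (t ^+ m) (tV ^+ A) ((tV ^+ m) ^+ f) (tV ^+ m) => u v w y z r uv rw.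
  by ring: uv rw.
- rewrite -/f scan_false_nil; try by rewrite /fits /=; lia.
  rewrite (scanB_sum 0) // muln0 mul1r add0n.
  have -> : odd (count2 be + count2 s) = odd f by rewrite -ff; lia.
  case: odd; first by rewrite !mulr0.
  by rewrite -/x [tV ^+ (_ + _)]exprD -[RHS]mul1r -(tf f); ring.
Qed.

End CriticalLevel.

Lemma peakP (s : seq bool) :
  [\/ exists b1 b2, s = b1 ++ true :: false :: b2,
      s = nseq (size s) true | exists s', s = false :: s'].
Proof.
elim: s => [|[] s IH]; [by constructor 2| |by constructor 3; exists s].
case: IH => [[b1 [b2 ->]]|e|[s' ->]]; last by constructor 1; exists [::], s'.
  by constructor 1; exists (true :: b1), b2.
by constructor 2; rewrite /= -e.
Qed.

Lemma split_at2 k n (s : seq bool) : size s = (k + n).+2 ->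
  exists s1 x y s2, [/\ s = s1 ++ x :: y :: s2, size s1 = k & size s2 = n].
Proof.
elim: k s => [|k IH] [|a s] //=.
  by case: s => [|y s] //= [e]; exists [::], a, y, s.
by case=> /IH[s1 [x [y [s2 [-> e1 e2]]]]]; exists (a :: s1), x, y, s2; rewrite /= e1.
Qed.

Section DualBasis.
Context {L : comNzRingType} (tV : L) (bar : {rmorphism L -> L}).
Context (thetaV : nat -> L) (crit lev : pred nat).
Context (V : nat -> seq bool -> seq bool -> L).
Hypotheses (levS : forall p, lev p -> ~~ crit p -> lev p.+1)
           (lev_pred : forall p, lev p -> crit p -> lev p.-1).
Hypothesis V_true : forall p be, lev p ->
  V p be (nseq (size be) true) = (be == nseq (size be) true)%:R.
Hypothesis cup_peak : forall p b1 b2 s, lev p -> size s = (size b1 + size b2)%N ->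
  cup tV (size b1) (V p (b1 ++ true :: false :: b2)) s = V p (b1 ++ b2) s.
Hypothesis cup_nopeak : forall p b1 x y b2 s, lev p ->
  size s = (size b1 + size b2)%N -> ~~ (x && ~~ y) ->
  cup tV (size b1) (V p (b1 ++ x :: y :: b2)) s = 0.
Hypothesis hcup_false : forall p be s, lev p -> ~~ crit p -> size s = size be ->
  hcup (thetaV p) (V p (false :: be)) s = V p.+1 be s.
Hypothesis hcup_true : forall p be s, lev p -> ~~ crit p -> size s = size be ->
  hcup (thetaV p) (V p (true :: be)) s = 0.
Hypothesis V_crit : forall p a b be s, lev p -> crit p -> size s = size be ->
  V p (b :: be) (a :: s) =
  if odd (count2 (b :: be) + count2 (a :: s)) then 0 else V p.-1 be s.

Local Notation space := (space tV bar thetaV crit).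

Lemma drop_parity_V p e b be s : lev p -> crit p -> size s = size be ->
  drop_parity e (V p (b :: be)) s = if odd (count2 (b :: be)) == e then V p.-1 be s else 0.
Proof.
move=> lp cp sz; rewrite /drop_parity V_crit //= !oddD !oddb.
by case: b; case: e; case: (odd (count2 be)); case: (odd (count2 s)).
Qed.

Lemma V_space p be : lev p -> space p (size be) (V p be).
Proof.
move En: (size be) => n; elim/ltn_ind: n p be En => n IH p be En lp.
have bv : bar (V p be (nseq n true)) = V p be (nseq n true).
  by rewrite -En V_true // rmorph_nat.
case: n IH En bv => [|n] IH En bv; split=> //; split.
  case: be En {bv} => // b be [En]; case: ifP => cp.
    move=> e; apply: space_ext
      (_ : space p.-1 n (if odd (count2 (b :: be)) == e then V p.-1 be else fun=> 0)).
      by move=> s sn; rewrite drop_parity_V ?En //; case: ifP.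
    by case: ifP => _; [apply: IH => //; apply: lev_pred|apply: space0].
  case: b.
    by apply: space_ext (space0 _ _ _ _ _ _) => s sn; rewrite hcup_true ?cp ?En.
  have h : space p.+1 n (V p.+1 be) by apply: IH => //; rewrite levS ?cp.
  by apply: space_ext h => s sn; rewrite hcup_false ?cp ?En.
case: n IH En {bv} => // n IH En k.
have [nk|kn] := ltnP n k.
  by apply: space_ext (space0 _ _ _ _ _ _) => s sn; rewrite cup_size ?sn.
have /split_at2[b1 [x [y [b2 [-> e1 e2]]]]] : size be = (k + (n - k)).+2.
  by rewrite subnKC.
have szs s : size s = n -> size s = (size b1 + size b2)%N by move=> ->; rewrite e1 e2 subnKC.
rewrite -e1; case xy: (x && ~~ y); last first.
  by apply: space_ext (space0 _ _ _ _ _ _) => s /szs sn; rewrite cup_nopeak ?xy.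
case: x y xy => -[] // _; have h : space p n (V p (b1 ++ b2)).
  by apply: IH => //; rewrite size_cat e1 e2 subnKC.
by apply: space_ext h => s /szs sn; rewrite cup_peak.
Qed.

Lemma dual_functional p ga : lev p -> exists D : (seq bool -> L) -> L,
  [/\ forall v w, (forall s, size s = size ga -> v s = w s) -> D v = D w,
      forall c d v w, D (fun s => c * v s + d * w s) = c * D v + d * D w,
      forall be, size be = size ga -> D (V p be) = (be == ga)%:R
    & forall v, space p (size ga) v -> bar (D v) = D v].
Proof.
move En: (size ga) => n; elim/ltn_ind: n p ga En => -[|n] IH p ga En lp.
  exists (fun v => v [::]); split=> // [v w ->//|be sb|v]; last by case.
  by move/size0nil: sb => ->; move/size0nil: En => ->; rewrite (V_true [::]).
case cp: (crit p).
  case: ga En => // g ga [En].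
  have [D [Dext Dlin Ddual Dbar]] := IH n (ltnSn n) _ _ En (lev_pred lp cp).
  exists (fun v => D (drop_parity (odd (count2 (g :: ga))) v)); split.
  - by move=> v w vw; apply: Dext => s sn; rewrite /drop_parity vw //= sn.
  - by move=> c d v w; rewrite -Dlin.
  - case=> // b be [sb].
    rewrite (Dext _ (fun s => (odd (count2 (b :: be)) == odd (count2 (g :: ga)))%:R * V p.-1 be s + 0 * V p.-1 be s)).
      rewrite Dlin Ddual // mul0r addr0 -natrM mulnb; congr (_%:R : L); congr nat_of_bool.
      have [->|ne] := eqVneq be ga; last by rewrite andbF eqseq_cons (negbTE ne) andbF.
      by rewrite andbT eqseq_cons eqxx andbT /= !oddD !oddb; case: b; case: g; case: odd.
    by move=> s sn; rewrite drop_parity_V ?sb //; case: eqP => _; rewrite !mul0r addr0 ?mul1r ?mul0r.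
  - by move=> v sv; apply: Dbar; apply: space_drop.
case: (peakP ga) => [[b1 [b2 ega]]|ega|[ga' ega]].
- have En' : size (b1 ++ b2) = n.-1 by move: En; rewrite ega !size_cat /=; lia.
  have n0 : (n.-1.+1 = n)%N by move: En; rewrite ega size_cat /=; lia.
  have [|D [Dext Dlin Ddual Dbar]] := IH n.-1 _ _ _ En' lp; first by lia.
  have szs s : size s = n.-1 -> size s = (size b1 + size b2)%N.
    by move=> ->; rewrite -En' size_cat.
  exists (fun v => D (cup tV (size b1) v)); split.
  - by move=> v w vw; apply: Dext => s sn; apply: cup_ext => x xs; rewrite vw // xs sn n0.
  - by move=> c d v w; rewrite -Dlin; apply: Dext => s _; rewrite cup_lin.
  - move=> be sb.
    have /split_at2[b1' [x [y [b2' [ebe e1 e2]]]]] : size be = (size b1 + size b2).+2.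
      by rewrite sb -n0 -En' size_cat.
    have szs' s : size s = n.-1 -> size s = (size b1' + size b2')%N.
      by move=> /szs ->; rewrite e1 e2.
    rewrite ebe -e1; case xy: (x && ~~ y).
      case: x y xy ebe => -[] // _ ebe; rewrite (Dext _ (V p (b1' ++ b2'))).
        rewrite Ddual; last by rewrite size_cat e1 e2 -size_cat.
        by rewrite ega !eqseq_cat // eqseq_cons eqseq_cons.
      by move=> s /szs' sn; rewrite cup_peak.
    rewrite (Dext _ (fun s => 0 * V p be s + 0 * V p be s)); last first.
      by move=> s /szs' sn; rewrite cup_nopeak ?xy // !mul0r addr0.
    rewrite Dlin !mul0r addr0; case: eqP => // e.
    by move: e xy; rewrite ega => /eqP; rewrite eqseq_cat // !eqseq_cons => /and4P[_ /eqP-> /eqP->].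
  - by move=> v sv; apply: Dbar; apply: space_cup; rewrite n0.
- exists (fun v => v (nseq n.+1 true)); split=> //.
  + by move=> v w; apply; rewrite size_nseq.
  + by move=> be sb; rewrite -sb V_true // [in RHS]ega En sb.
  + by move=> v; apply: space_bar.
- have [En'] : size (false :: ga') = n.+1 by rewrite -ega.
  have lpS : lev p.+1 by rewrite levS ?cp.
  have [D [Dext Dlin Ddual Dbar]] := IH n (ltnSn n) _ _ En' lpS.
  exists (fun v => D (hcup (thetaV p) v)); split.
  - by move=> v w vw; apply: Dext => s sn; rewrite /hcup !vw //= sn.
  - by move=> c d v w; rewrite -Dlin; apply: Dext => s _; rewrite /hcup; ring.
  - case=> // b be [sb]; rewrite ega; case: b.
      rewrite (Dext _ (fun s => 0 * V p be s + 0 * V p be s)) ?Dlin ?mul0r ?addr0 //.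
      by move=> s sn; rewrite hcup_true ?cp ?sb // mul0r addr0.
    rewrite (Dext _ (V p.+1 be)) ?Ddual //.
    by move=> s sn; rewrite hcup_false ?cp ?sb.
  - by move=> v sv; apply: Dbar; apply: space_hcup; rewrite ?cp.
Qed.

End DualBasis.

(** * Words and the module *)

Section WordSeq.
Context {N : nat}.
Implicit Types (a b : word N) (i : 'I_N) (s : seq bool).

(* Words are read backwards, from the letter N to the letter 1.               *)
Definition rseq a : seq bool := [seq a (rev_ord i) | i <- enum 'I_N].

Definition wordof s : word N := [ffun i => nth false s (rev_ord i)].

Lemma size_rseq a : size (rseq a) = N.
Proof. by rewrite size_map size_enum_ord. Qed.

Lemma nth_rseq a i : nth false (rseq a) (rev_ord i) = a i.
Proof. by rewrite (nth_map i) ?size_enum_ord ?nth_ord_enum ?rev_ordK. Qed.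

Lemma rseqK : cancel rseq wordof.
Proof. by move=> a; apply/ffunP => i; rewrite ffunE nth_rseq. Qed.

Lemma wordofK s : size s = N -> rseq (wordof s) = s.
Proof.
move=> sN; apply: (@eq_from_nth _ false) => [|k]; rewrite size_rseq ?sN // => kN.
by have := nth_rseq (wordof s) (rev_ord (Ordinal kN)); rewrite rev_ordK ffunE rev_ordK.
Qed.

Lemma rseq_inj : injective rseq.
Proof. exact: can_inj rseqK. Qed.

Lemma nth_rseqE a k (kN : (k < N)%N) : nth false (rseq a) k = a (rev_ord (Ordinal kN)).
Proof. by have := nth_rseq a (rev_ord (Ordinal kN)); rewrite rev_ordK. Qed.

Lemma rseq_nxt i a : ~~ is_last i -> exists s1 s2,
  [/\ (size s1 + i.+2 = N)%N,
      rseq a = s1 ++ a (nxt i) :: a i :: s2 &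
      rseq (sact i a) = s1 ++ a i :: a (nxt i) :: s2].
Proof.
move=> li; have iN := ltn_ord i; have := val_nxt li => en.
have nN := ltn_ord (nxt i); rewrite en in nN.
pose k := (N - i.+2)%N.
have dec c : rseq c = take k (rseq c) ++ c (nxt i) :: c i :: drop k.+2 (rseq c).
  rewrite -{1}(cat_take_drop k (rseq c)); congr (_ ++ _).
  have sz : (k.+1 < size (rseq c))%N by rewrite size_rseq /k; lia.
  rewrite (drop_nth false) 1?ltnW // (drop_nth false) //; congr [:: _, _ & _].
    by rewrite -(nth_rseq c); congr (nth _ _ _); rewrite /= en.
  by rewrite -(nth_rseq c); congr (nth _ _ _); rewrite /= /k; lia.
have fixk m : (m < N)%N -> m != k -> m != k.+1 ->
    nth false (rseq (sact i a)) m = nth false (rseq a) m.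
  move=> mN mk mk1; rewrite !(nth_rseqE _ mN) /sact (negbTE li) ffunE tpermD //.
    by rewrite -val_eqE /= eq_sym; apply: contra mk1 => /eqP; rewrite /k; lia.
  by rewrite -val_eqE /= en eq_sym; apply: contra mk => /eqP; rewrite /k; lia.
exists (take k (rseq a)), (drop k.+2 (rseq a)); split.
- by rewrite size_take size_rseq /k; case: ifP; lia.
- exact: dec.
rewrite [LHS]dec sact_at // sact_nxt //; congr (_ ++ _ :: _ :: _).
  apply: (@eq_from_nth _ false) => [|m]; rewrite !size_take !size_rseq //.
  move=> mk; have mk' : (m < k)%N by move: mk; rewrite /k; case: ifP; lia.
  by rewrite !nth_take // fixk //; move: mk'; rewrite /k; lia.
apply: (@eq_from_nth _ false) => [|m]; rewrite !size_drop !size_rseq //.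
by move=> mk; rewrite !nth_drop fixk //; lia.
Qed.

Lemma rseq_last i a : is_last i -> exists s,
  [/\ size s = N.-1, rseq a = a i :: s & rseq (sact i a) = ~~ a i :: s].
Proof.
move=> li; have /eqP iN := li.
have dec c : rseq c = c i :: behead (rseq c).
  case E: (rseq c) => [|x s]; first by have := size_rseq c; rewrite E /= => N0; have := ltn_ord i; lia.
  have := nth_rseq c i; rewrite E /=; have -> : (N - i.+1 = 0)%N by lia.
  by move=> /= ->.
exists (behead (rseq a)); split; first by rewrite size_behead size_rseq.
  exact: dec.
rewrite [LHS]dec /sact li ffunE eqxx; congr (_ :: _).
apply: (@eq_from_nth _ false) => [|m]; rewrite !size_behead !size_rseq // => mN.
rewrite !nth_behead; have mN' : (m.+1 < N)%N by lia.
rewrite !(nth_rseqE _ mN') ffunE; case: eqP => // /(congr1 val) /=; lia.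
Qed.

End WordSeq.

(* The Bruhat order in terms of the letters 2 in the prefixes of words.       *)
Definition below (al be : seq bool) :=
  forall k, (count2 (drop k al) <= count2 (drop k be))%N.

Definition suffix_sum (s : seq bool) : nat := \sum_(k < size s) count2 (drop k s).

Lemma suffix_sum_cons a s : suffix_sum (a :: s) = (count2 (a :: s) + suffix_sum s)%N.
Proof. by rewrite /suffix_sum big_ord_recl drop0. Qed.

Lemma below_cons a al b be : below (a :: al) (b :: be) <->
  (count2 (a :: al) <= count2 (b :: be))%N /\ below al be.
Proof.
split=> [h|[h0 h] [|k]]; last exact: h; last by [].
by split=> [|k]; [exact: (h 0%N)|exact: (h k.+1)].
Qed.

Lemma below_refl s : below s s. Proof. by move=> k. Qed.

Lemma below_cat s al be : (count2 al <= count2 be)%N -> below al be -> below (s ++ al) (s ++ be).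
Proof.
move=> h ab; elim: s => [|a s IH] //=; apply/below_cons; split=> //=.
by rewrite !count_cat !leq_add2l.
Qed.

Lemma below_suffix_sum al be : size al = size be -> below al be ->
  (suffix_sum al <= suffix_sum be)%N.
Proof. by move=> sz ab; rewrite /suffix_sum sz; apply: leq_sum => k _; apply: ab. Qed.

Lemma below_eq al be : size al = size be -> below al be ->
  suffix_sum al = suffix_sum be -> al = be.
Proof.
elim: al be => [|a al IH] [|b be] // [sz] /below_cons[h ab].
rewrite !suffix_sum_cons => e.
have := below_suffix_sum sz ab => le.
have [e1 e2] : count2 (a :: al) = count2 (b :: be) /\ suffix_sum al = suffix_sum be.
  by move: e le h; lia.
have E := IH _ sz ab e2; move: e1; rewrite E /=; case: a {h e}; case: b => //=; lia.
Qed.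

Section KLSupport.
Context {L : comNzRingType} (t tV tNV : L) (sw : nat -> nat -> L).

Lemma klvec_support p al be : size al = size be -> klvec t tV tNV sw p be al != 0 -> below al be.
Proof.
move=> sz nz k; rewrite leqNgt; apply: contra nz => lt.
rewrite -(cat_take_drop k al) -(cat_take_drop k be).
by rewrite klvec_suffix0 // !size_take sz.
Qed.

End KLSupport.

Section BruhatBelow.
Context {N : nat}.
Implicit Types a b : word N.

Lemma ones_drop a k : (k <= N)%N -> (ones a k + count2 (drop (N - k) (rseq a)) = k)%N.
Proof.
elim: k => [|k IH] kN.
  rewrite subn0 drop_oversize ?size_rseq // addn0; apply/eqP; rewrite cards_eq0.
  by apply/eqP/setP => i; rewrite !inE.
have := IH (ltnW kN); rewrite -(subnSK kN) => E; rewrite -[RHS]/(k.+1) -[in RHS]E {E}.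
have mN : (N - k.+1 < N)%N by lia.
rewrite [in LHS](drop_nth false) ?size_rseq // (nth_rseqE _ mN).
have -> : rev_ord (Ordinal mN) = Ordinal kN by apply: val_inj => /=; lia.
rewrite [count2 (_ :: _)]/= addnA [in RHS]addnC -addnS [in RHS]addnC; congr (_ + _)%N.
rewrite /ones; case ak: (a (Ordinal kN)).
  rewrite addn1; congr _.+1; apply: eq_card => i; rewrite !inE ltnS leq_eqVlt.
  case: eqP => //= e; have -> : i = Ordinal kN by apply: val_inj.
  by rewrite ak andbF.
rewrite addn0 -[RHS]add1n; have <- : #|Ordinal kN |: [set i : 'I_N | (i < k)%N && ~~ a i]| = (1 + #|[set i : 'I_N | (i < k)%N && ~~ a i]|)%N.
  by rewrite cardsU1 inE /= ltnn.
apply: eq_card => i; rewrite !inE ltnS leq_eqVlt -val_eqE /=.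
case: eqP => //= e; have -> : i = Ordinal kN by apply: val_inj.
by rewrite ak.
Qed.

Lemma bruhatP a b : bruhat a b <-> below (rseq a) (rseq b).
Proof.
split=> [/forallP h k|h].
  have [kN|Nk] := leqP k N; last by rewrite !drop_oversize ?size_rseq // ltnW.
  have kN' : (N - k < N.+1)%N by lia.
  have := h (Ordinal kN'); rewrite /=.
  have := @ones_drop a (N - k) (leq_subr _ _); have := @ones_drop b (N - k) (leq_subr _ _).
  by rewrite subKn //; lia.
apply/forallP => k; have kN : (k <= N)%N by have := ltn_ord k; lia.
have := h (N - k)%N; have := ones_drop a kN; have := ones_drop b kN; lia.
Qed.

End BruhatBelow.

Lemma mul_unit_sqr (R : comNzRingType) (x y z : R) : y * z = 1 -> - (x * y) = z * - (x * y ^+ 2).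
Proof. by move=> yz; ring: yz. Qed.

Lemma mono_natmul (K : comNzRingType) (G : zmodType) (g : G) n :
  mono (g *+ n) = mono g ^+ n :> laurent K G.
Proof. by elim: n => [|n IH]; rewrite ?mulr0n ?mono0 ?expr0 // mulrS monoD IH exprS. Qed.

Section LaurentVariables.
Context (K : comNzRingType) (X : kl_case).
Local Notation L := (laurent K (expo X)).

Definition var_t : L := mono (e_t X).
Definition var_tV : L := mono (- e_t X).
Definition var_tN : L := mono (e_tN X).
Definition var_tNV : L := mono (- e_tN X).
Local Notation t := var_t.
Local Notation tV := var_tV.
Local Notation tN := var_tN.
Local Notation tNV := var_tNV.

(* The part of the weight of [n] strips of length (l, p) that the power of t  *)
(* counting their steps does not account for.                                 *)
Definition sw p n : L :=
  match X return L with
  | CaseA => if odd p then (- (tV * tN ^+ 2)) ^+ n else 1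
  | CaseB m => swB t m p n
  end.

Definition crit : pred nat :=
  match X with CaseA => pred0 | CaseB m => pred1 m end.

Definition lev : pred nat :=
  match X with CaseA => predT | CaseB m => fun p => (p <= m)%N end.

Definition thetaV p : L :=
  match X return L with CaseA => thetaVA tV tN tNV p | CaseB m => thetaVB tV m p end.

End LaurentVariables.

Lemma var_tN_caseB (K : comNzRingType) m :
  var_tN K (CaseB m) = var_t K (CaseB m) ^+ m /\
  var_tNV K (CaseB m) = var_tV K (CaseB m) ^+ m.
Proof.
rewrite /var_tN /var_tNV /var_t /var_tV.
have E : e_tN (CaseB m) = e_t (CaseB m) *+ m by rewrite /= natz.
by rewrite E -mulNrn !mono_natmul.
Qed.

Section LaurentVariableTheory.
Context {K : comNzRingType} (X : kl_case).
Local Notation L := (laurent K (expo X)).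
Local Notation t := (var_t K X).
Local Notation tV := (var_tV K X).
Local Notation tN := (var_tN K X).
Local Notation tNV := (var_tNV K X).

Lemma var_tK : t * tV = 1. Proof. exact: monoV. Qed.
Lemma var_tNK : tN * tNV = 1. Proof. exact: monoV. Qed.
Lemma bar_t : lbar t = tV. Proof. exact: lbar_mono. Qed.
Lemma bar_tV : lbar tV = t. Proof. by rewrite lbar_mono opprK. Qed.
Lemma bar_tN : lbar tN = tNV. Proof. exact: lbar_mono. Qed.
Lemma bar_tNV : lbar tNV = tN. Proof. by rewrite lbar_mono opprK. Qed.

Lemma sw0 p : sw K X p 0 = 1.
Proof. by case: X => [|m]; rewrite /sw ?expr0 ?if_same // swB0. Qed.

Lemma sw_exp p n : lev X p -> ~~ crit X p -> sw K X p n = sw K X p 1 ^+ n.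
Proof.
case: X => [|m] /= lp cp; rewrite /sw.
  by case: odd; [rewrite expr1 | rewrite expr1n].
by rewrite !swB_lt ?expr1 // ltn_neqAle cp.
Qed.

Lemma thetaV_sw p : lev X p -> ~~ crit X p -> thetaV K X p = var_tNV K X * sw K X p 1.
Proof.
have := var_tNK; have := var_tK.
case: X => [|m] tK uK /= lp cp; rewrite /sw /thetaV.
  rewrite /thetaVA expr1; case: odd; last by rewrite mulr1.
  exact: (mul_unit_sqr _ uK).
have [_ ->] := var_tN_caseB K m.
have pm : (p < m)%N by rewrite ltn_neqAle cp.
rewrite swB_lt // expr1 /thetaVB.
have -> : var_tV K (CaseB m) ^+ m = var_tV K (CaseB m) ^+ (m - p) * var_tV K (CaseB m) ^+ p.
  by rewrite -exprD subnK // ltnW.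
rewrite -mulrA.
by rewrite -exprMn [X in X ^+ p]mulrC tK expr1n mulr1.
Qed.

Local Notation V p be := (klvec (var_t K X) (var_tV K X) (var_tNV K X) (sw K X) p be).
Local Notation space := (space (var_tV K X) (@lbar K (expo X)) (thetaV K X) (crit X)).

Lemma klvec_crit p a b be s : kl_case_ok X -> lev X p -> crit X p -> size s = size be ->
  V p (b :: be) (a :: s) =
  if odd (count2 (b :: be) + count2 (a :: s)) then 0 else V p.-1 be s.
Proof.
have := var_tK; case: X => [|m] uK //= okX lp /eqP->.
by have [_ ->] := var_tN_caseB K m => sz; rewrite /sw klvec_critical.
Qed.

Lemma lev0 : lev X 0. Proof. by case: X. Qed.
Lemma crit0 : kl_case_ok X -> ~~ crit X 0.
Proof. by case: X => //= m; rewrite lt0n eq_sym. Qed.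

Lemma sw_level0 n : kl_case_ok X -> sw K X 0 n = 1.
Proof. by case: X => [|m] //= okX; rewrite /sw /swB okX mul0n. Qed.

Lemma levS p : lev X p -> ~~ crit X p -> lev X p.+1.
Proof. by case: X => //= m; rewrite ltn_neqAle => -> ->. Qed.

Lemma lev_pred p : lev X p -> crit X p -> lev X p.-1.
Proof. by case: X => //= m lp _; apply: leq_trans (leq_pred _) lp. Qed.

Let V_nseq p be : lev X p -> V p be (nseq (size be) true) = (be == nseq (size be) true)%:R.
Proof. by move=> _; apply: klvec_nseq => //; apply: sw0. Qed.

Let V_peak p b1 b2 s : lev X p -> size s = (size b1 + size b2)%N ->
  cup (var_tV K X) (size b1) (V p (b1 ++ true :: false :: b2)) s = V p (b1 ++ b2) s.
Proof. by move=> _; apply: cup_klvec_peak; [apply: var_tK | apply: sw0]. Qed.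

Let V_nopeak p b1 x y b2 s : lev X p -> size s = (size b1 + size b2)%N -> ~~ (x && ~~ y) ->
  cup (var_tV K X) (size b1) (V p (b1 ++ x :: y :: b2)) s = 0.
Proof. by move=> _; apply: cup_klvec0. Qed.

Let V_hcup_false p be s : lev X p -> ~~ crit X p -> size s = size be ->
  hcup (thetaV K X p) (V p (false :: be)) s = V p.+1 be s.
Proof.
move=> lp cp sz; rewrite thetaV_sw //; apply: hcup_klvec_false => //.
- exact: var_tK.
- by move=> n; apply: sw_exp.
Qed.

Let V_hcup_true p be s : lev X p -> ~~ crit X p -> size s = size be ->
  hcup (thetaV K X p) (V p (true :: be)) s = 0.
Proof.
by move=> lp cp sz; rewrite thetaV_sw //; apply: hcup_klvec_true => // n; apply: sw_exp.
Qed.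

Lemma klvec_space p be : kl_case_ok X -> lev X p -> space p (size be) (V p be).
Proof.
move=> okX.
exact: (V_space _ levS lev_pred V_nseq V_peak V_nopeak V_hcup_false V_hcup_true
  (fun p a b be s => @klvec_crit p a b be s okX)).
Qed.

Lemma klvec_dual p ga : kl_case_ok X -> lev X p ->
  exists D : (seq bool -> laurent K (expo X)) -> laurent K (expo X),
  [/\ forall v w, (forall s, size s = size ga -> v s = w s) -> D v = D w,
      forall c d v w, D (fun s => c * v s + d * w s) = c * D v + d * D w,
      forall be, size be = size ga -> D (V p be) = (be == ga)%:R
    & forall v, space p (size ga) v -> lbar (D v) = D v].
Proof.
move=> okX.
exact: (dual_functional _ levS lev_pred V_nseq V_peak V_nopeak V_hcup_false V_hcup_true
  (fun p a b be s => @klvec_crit p a b be s okX)).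
Qed.

Lemma space_capX n u k : kl_case_ok X -> space 0 n u -> space 0 n.+2 (cap (var_t K X) k u).
Proof.
have := bar_tNV; have := bar_tN; have := var_tNK.
have := bar_tV; have := bar_t; have := var_tK.
case: X u => [|m] u tK bt btV tNK btN btNV /= okX su.
  exact: (spaceA_cap tK bt btV btN btNV k su).
exact: (spaceB_cap tK bt btV okX k (leq0n m) su).
Qed.

Lemma space_hcapX n u : kl_case_ok X -> space 1 n u -> space 0 n.+1 (hcap (- var_tN K X) u).
Proof.
have := bar_tNV; have := bar_tN; have := var_tNK.
have := bar_tV; have := bar_t; have := var_tK.
case: X u => [|m] u tK bt btV tNK btN btNV /= okX su.
  exact: (spaceA_hcap tK bt btV btN btNV (p := 0) su).
have [-> _] := var_tN_caseB K m.
by have := spaceB_hcap tK bt btV okX (p := 0) okX su; rewrite subn0.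
Qed.

End LaurentVariableTheory.

Section KLBasis.
Context (K : comNzRingType) (X : kl_case) (N : nat).
Hypothesis okX : kl_case_ok X.
Local Notation L := (laurent K (expo X)).
Local Notation W := (word N).
Local Notation M := {ffun W -> L^o}.
Local Notation space := (space (var_tV K X) (@lbar K (expo X)) (thetaV K X) (crit X)).
Implicit Types (a b c : W) (v w : M) (i : 'I_N).

Definition klseq (be al : seq bool) : L :=
  klvec (var_t K X) (var_tV K X) (var_tNV K X) (sw K X) 0 be al.

Definition of_seqfun (f : seq bool -> L) : M := [ffun a => f (rseq a)].

Definition klbasis b : M := of_seqfun (klseq (rseq b)).

Lemma Top_of_seqfun i f : exists2 g,
  Top i (of_seqfun f) = tpar K X i *: of_seqfun f + of_seqfun g &
  space 0 N f -> space 0 N g.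
Proof.
case li: (is_last i).
  exists (hcap (- var_tN K X) (hcup (var_tNV K X) f)).
    apply/ffunP => a; rewrite TopE !ffunE /flat li /= /tpar /tparV /e_gen li.
    have [s [_ -> ->]] := rseq_last a li; rewrite /GRing.scale /= /hcup.
    have := var_tNK (K := K) X; rewrite /var_tN /var_tNV => tNK.
    by case: (a i) => /=; ring: tNK.
  move=> sf; have N1 : N = N.-1.+1 by rewrite prednK //; apply: leq_trans (ltn_ord i).
  rewrite N1; apply: space_hcapX => //.
  have h := space_hcup (crit0 okX) (p := 0) (n := N.-1).
  have <- : thetaV K X 0 = var_tNV K X.
    by rewrite thetaV_sw ?lev0 ?crit0 // sw_level0 ?mulr1.
  by apply: h; rewrite -N1.
have li' := negbT li.
exists (cap (var_t K X) (N - i.+2) (cup (var_tV K X) (N - i.+2) f)).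
  apply/ffunP => a; rewrite TopE !ffunE /flat li /= /tpar /tparV /e_gen li.
  have [s1 [s2 [sN -> ->]]] := rseq_nxt a li'.
  have -> : (N - i.+2 = size s1)%N by lia.
  have capE k x y u : k = size s1 -> cap (var_t K X) k u (s1 ++ x :: y :: s2) =
    if x then (if y then 0 else - var_t K X * u (s1 ++ s2)) else if y then u (s1 ++ s2) else 0.
    move=> ->; elim: s1 u {sN} => [|z s1 IH] u //=.
  rewrite capE // cup_cat /GRing.scale /=.
  have := var_tK (K := K) X; rewrite /var_t /var_tV => tK.
  by case: (a i); case: (a (nxt i)) => /=; ring: tK.
move=> sf; have N2 : N = (N - 2).+2.
  have := val_nxt li'; have := ltn_ord (nxt i); lia.
by rewrite {1}N2; apply: space_capX => //; apply: space_cup; rewrite -N2.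
Qed.

End KLBasis.

Lemma dual_sum (R : comNzRingType) (V : lmodType R) (I : finType) (C : I -> V)
    (D : V -> R) (i0 : I) :
    {morph D : v w / v + w} -> D 0 = 0 -> (forall c v, D (c *: v) = c * D v) ->
    (forall i, D (C i) = (i == i0)%:R) ->
  forall f : I -> R, D (\sum_i f i *: C i) = f i0.
Proof.
move=> DD D0 DZ DC f; rewrite (big_morph D DD D0) (bigD1 i0) //= DZ DC eqxx mulr1.
by rewrite big1 ?addr0 // => i ne; rewrite DZ DC (negbTE ne) mulr0.
Qed.

Lemma scaler_exchange (R : comNzRingType) (V : lmodType R) (l s s' : R) (v w : V) :
  l *: (s' *: v + w) = l *: (s *: v + w) - (s - s') *: (l *: v).
Proof.
rewrite scalerA [_ * l]mulrC -scalerA -scalerBr; congr (_ *: _).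
by rewrite scalerBl opprB [RHS]addrC addrA subrK.
Qed.

Section BarMap.
Context (K : comNzRingType) (X : kl_case) (N : nat).
Hypothesis okX : kl_case_ok X.
Local Notation L := (laurent K (expo X)).
Local Notation W := (word N).
Local Notation M := {ffun W -> L^o}.
Local Notation m_ := (mbasis K X).
Local Notation space := (space (var_tV K X) (@lbar K (expo X)) (thetaV K X) (crit X)).
Local Notation klbasis := (@klbasis K X N).
Local Notation of_seqfun := (@of_seqfun K X N).
Implicit Types (a b c : W) (v w : M) (i : 'I_N).

Lemma coord_exists b : exists D : M -> L,
  [/\ forall (c d : L) v w, D (c *: v + d *: w) = c * D v + d * D w,
      forall b', D (klbasis b') = (b' == b)%:R
    & forall f, space 0 N f -> lbar (D (of_seqfun f)) = D (of_seqfun f)].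
Proof.
have [D [Dext Dlin Ddual Dbar]] := klvec_dual (K := K) (rseq b) okX (lev0 X).
rewrite size_rseq in Dext Ddual Dbar.
have Dof f : D (fun s => of_seqfun f (wordof s)) = D f.
  by apply: Dext => s sN; rewrite ffunE wordofK.
exists (fun v => D (fun s => v (wordof s))); split.
- move=> c d v w; rewrite -Dlin; apply: Dext => s _; rewrite !ffunE.
  by rewrite /GRing.scale /=.
- by move=> b'; rewrite Dof Ddual ?size_rseq // (inj_eq rseq_inj).
- by move=> f sf; rewrite Dof Dbar.
Qed.

Definition coord b : M -> L := projT1 (cid (coord_exists b)).

Lemma coord_lin b (c d : L) v w : coord b (c *: v + d *: w) = c * coord b v + d * coord b w.
Proof. by rewrite /coord; case: cid => D [] /=. Qed.

Lemma coord_klbasis b b' : coord b (klbasis b') = (b' == b)%:R.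
Proof. by rewrite /coord; case: cid => D [] /=. Qed.

Lemma coord_space b f : space 0 N f ->
  lbar (coord b (of_seqfun f)) = coord b (of_seqfun f).
Proof. by rewrite /coord; case: cid => D [] /= _ _; apply. Qed.

Lemma coordD b v w : coord b (v + w) = coord b v + coord b w.
Proof. by have := coord_lin b 1 1 v w; rewrite !scale1r !mul1r. Qed.

Lemma coord0 b : coord b 0 = 0.
Proof. by have := coord_lin b 0 0 0 0; rewrite !scale0r !mul0r !addr0. Qed.

Lemma coordZ b (c : L) v : coord b (c *: v) = c * coord b v.
Proof. by have := coord_lin b c 0 v v; rewrite !scale0r !mul0r !addr0. Qed.

Lemma klbasis_diag b : klbasis b b = 1.
Proof. by rewrite ffunE /klseq klvec_diag //; apply: sw0. Qed.

Lemma klbasis_bruhat a b : klbasis b a != 0 -> bruhat a b.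
Proof.
rewrite ffunE => nz; apply/bruhatP; apply: klvec_support nz.
by rewrite !size_rseq.
Qed.

Definition rank a := suffix_sum (rseq a).

Lemma bruhat_rank a b : bruhat a b -> a != b -> (rank a < rank b)%N.
Proof.
move=> /bruhatP ab ne; have sz : size (rseq a) = size (rseq b) by rewrite !size_rseq.
rewrite ltn_neqAle below_suffix_sum // andbT; apply: contra ne => /eqP e.
exact/eqP/rseq_inj/below_eq.
Qed.

Lemma klbasis_expand b : m_ b = klbasis b - \sum_(a | (a != b) && bruhat a b) klbasis b a *: m_ a.
Proof.
apply/eqP; rewrite eq_sym subr_eq; apply/eqP.
rewrite {1}[klbasis b]sum_mbasis (bigD1 b) //= klbasis_diag scale1r; congr (_ + _).
rewrite big_mkcondr; apply: eq_bigr => a ab; case: ifP => // /negbT nab.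
case: (eqVneq (klbasis b a) 0) => [->|/klbasis_bruhat]; first by rewrite scale0r.
by rewrite (negbTE nab).
Qed.

Lemma coord_span v : v = \sum_b coord b v *: klbasis b.
Proof.
pose P w := w = \sum_b coord b w *: klbasis b.
rewrite -/(P v).
have PD w1 w2 : P w1 -> P w2 -> P (w1 + w2).
  rewrite /P => h1 h2; rewrite {1}h1 {1}h2 -big_split; apply: eq_bigr => b _.
  by rewrite coordD scalerDl.
have PZ (c : L) w : P w -> P (c *: w).
  rewrite /P => h; rewrite {1}h scaler_sumr; apply: eq_bigr => b _.
  by rewrite coordZ scalerA.
have P0 : P 0 by rewrite /P big1 // => b _; rewrite coord0 scale0r.
have Psum (I : finType) (Q : pred I) (F : I -> M) : (forall x, Q x -> P (F x)) -> P (\sum_(x | Q x) F x).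
  by move=> h; apply: (big_ind P).
have PC b : P (klbasis b).
  rewrite /P (bigD1 b) //= coord_klbasis eqxx scale1r big1 ?addr0 // => b' ne.
  by rewrite coord_klbasis eq_sym (negbTE ne) scale0r.
clearbody P; have Pm n b : (rank b < n)%N -> P (m_ b).
  elim: n b => // n IH b bn; rewrite klbasis_expand; apply: PD (PC b) _.
  rewrite -scaleN1r; apply: (PZ _ _ _); apply: (Psum) => a /andP[ne ab]; apply: (PZ _ _ _).
  by apply: IH; apply: leq_trans (bruhat_rank ab ne) _.
by rewrite [v]sum_mbasis; apply: (Psum) => b _; apply: (PZ _ _ _); apply: Pm (ltnSn _).
Qed.

Definition bar_map v : M := \sum_b lbar (coord b v) *: klbasis b.

Lemma coord_bar_map b v : coord b (bar_map v) = lbar (coord b v).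
Proof.
exact: (dual_sum (coordD b) (coord0 b) (coordZ b) (coord_klbasis b) (fun c => lbar (coord c v))).
Qed.

Lemma bar_mapD v w : bar_map (v + w) = bar_map v + bar_map w.
Proof.
by rewrite -big_split; apply: eq_bigr => b _; rewrite coordD rmorphD scalerDl.
Qed.

Lemma bar_mapZ (c : L) v : bar_map (c *: v) = lbar c *: bar_map v.
Proof.
by rewrite scaler_sumr; apply: eq_bigr => b _; rewrite coordZ rmorphM scalerA.
Qed.

Lemma bar_map_space f : space 0 N f -> bar_map (of_seqfun f) = of_seqfun f.
Proof.
by move=> sf; rewrite [RHS]coord_span; apply: eq_bigr => b _; rewrite coord_space.
Qed.

Lemma klseq_space b : space 0 N (klseq K X (rseq b)).
Proof. by rewrite -{1}(size_rseq b); apply: klvec_space; rewrite ?lev0. Qed.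

Lemma bar_map_klbasis b : bar_map (klbasis b) = klbasis b.
Proof. exact/bar_map_space/klseq_space. Qed.

Lemma bar_mapN v : bar_map (- v) = - bar_map v.
Proof. by rewrite -scaleN1r bar_mapZ rmorphN1 scaleN1r. Qed.

Lemma bar_map_sum (I : finType) (F : I -> M) : bar_map (\sum_j F j) = \sum_j bar_map (F j).
Proof.
by apply: (big_morph bar_map bar_mapD); rewrite -[X in bar_map X](scale0r 0) bar_mapZ rmorph0 scale0r.
Qed.

Lemma Top_sum i (I : finType) (F : I -> M) : Top i (\sum_j F j) = \sum_j Top i (F j).
Proof.
by apply: (big_morph (Top i) (TopD i)); rewrite -[X in Top _ X](scale0r 0) TopZ scale0r.
Qed.

Lemma bar_map_Top i v :
  bar_map (Top i v) = Top i (bar_map v) - (tpar K X i - tparV K X i) *: bar_map v.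
Proof.
have E1 : bar_map (Top i v) = \sum_b lbar (coord b v) *: bar_map (Top i (klbasis b)).
  rewrite {1}[v]coord_span (Top_sum i) bar_map_sum; apply: eq_bigr => b _.
  by rewrite TopZ bar_mapZ.
have E2 : Top i (bar_map v) = \sum_b lbar (coord b v) *: Top i (klbasis b).
  by rewrite /bar_map (Top_sum i); apply: eq_bigr => b _; rewrite TopZ.
rewrite E1 E2 [bar_map v]/bar_map scaler_sumr -sumrB; apply: eq_bigr => b _.
have [g Eg sg] := Top_of_seqfun okX i (klseq K X (rseq b)).
have bg := bar_map_space (sg (klseq_space b)).
have Et : lbar (tpar K X i) = tparV K X i by apply: lbar_mono.
rewrite -[klbasis b]/(of_seqfun _) Eg bar_mapD bar_mapZ bg -/(klbasis b) bar_map_klbasis Et.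
exact: scaler_exchange.
Qed.

Lemma bar_map_word1 : bar_map (m_ (word1 : W)) = m_ word1.
Proof.
suff -> : m_ (word1 : W) = klbasis word1 by apply: bar_map_klbasis.
rewrite klbasis_expand big1 ?subr0 // => a /andP[ne ab].
case/negP: ne; apply/eqP/ffunP => i; rewrite ffunE.
have /forallP/(_ ord_max)/= := ab.
rewrite /ones; have -> : [set i : 'I_N | (i < N)%N && ~~ (word1 : W) i] = [set: 'I_N].
  by apply/setP => j; rewrite !inE ltn_ord ffunE.
rewrite cardsT leqNgt; apply: contraNF => ai.
rewrite -cardsT; apply/proper_card/properP; split; first exact: subsetT.
by exists i; rewrite !inE ?ai ?andbF.
Qed.

Lemma bar_map_is_bar : is_bar_module bar_map.
Proof.
split; [exact: bar_mapD|exact: bar_mapZ|exact: bar_map_word1|].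
apply: (@hpi_ind K X N) => x v; rewrite hact_pi hbar_pi.
elim: x v => [c|i|x IHx y IHy|x IHx y IHy] v /=.
- by rewrite bar_mapZ hact_scale hact1.
- rewrite bar_map_Top /hgenV hactDl hact_pi /=.
  by congr (_ + _); rewrite -[X in hact X _]scaleNr hact_scale hact1 scaleNr.
- by rewrite bar_mapD IHx IHy hactDl.
- by rewrite IHx IHy hactM.
Qed.

Lemma is_bar_unique (f g : M -> M) : is_bar_module f -> is_bar_module g -> f =1 g.
Proof.
move=> [fD fZ f1 fh] [gD gZ g1 gh].
have f0 : f 0 = 0 by rewrite -[X in f X](scale0r 0) fZ rmorph0 scale0r.
have g0 : g 0 = 0 by rewrite -[X in g X](scale0r 0) gZ rmorph0 scale0r.
suff H a : f (m_ a) = g (m_ a).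
  move=> v; rewrite [v]sum_mbasis (big_morph f fD f0) (big_morph g gD g0).
  by apply: eq_bigr => a _; rewrite fZ gZ H.
have step i c : ~~ flat i c -> ~~ c i -> f (m_ c) = g (m_ c) -> f (m_ (sact i c)) = g (m_ (sact i c)).
  move=> nf ci e; have E : m_ (sact i c) = hact (hgen i : hecke) (m_ c).
    rewrite hact_gen /Tbasis; move: nf; rewrite /flat.
    case: (is_last i) => /= [_|/negbTE->]; by rewrite (negbTE ci) addr0.
  by rewrite E fh gh e.
have [n le] := ubnP (rank a); elim: n a le => // n IH a le.
case: (pickP (fun i => a i && (is_last i || ~~ a (nxt i)))) => [i /andP[ai ni]|none].
  rewrite -[a](sactK i); apply: step; last apply: IH.
  - rewrite flat_sact /flat ai; case/orP: ni => [->|/negbTE->]; first by [].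
    by rewrite andbF.
  - case li: (is_last i); first by rewrite /sact li ffunE eqxx ai.
    by rewrite sact_at ?li //; move: ni; rewrite li.
  - apply: (@leq_trans (rank a)); last by rewrite -ltnS.
    apply: bruhat_rank; last first.
      apply: contraTneq ai => /ffunP/(_ i); rewrite {1}/sact; case li: (is_last i) ni => /= ni.
        by rewrite !ffunE eqxx; case: (a i).
      by rewrite ffunE tpermL => <-.
    apply/bruhatP; case li: (is_last i) ni => /= ni.
      have [s [_ -> ->]] := rseq_last a li; rewrite ai.
      by apply/below_cons; split; [rewrite /= leqW | apply: below_refl].
    have [s1 [s2 [_ -> ->]]] := rseq_nxt a (negbT li); rewrite ai (negbTE ni).
    apply: below_cat => //; apply/below_cons; split; first by [].
    by apply/below_cons; split; [rewrite /= leqW | apply: below_refl].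
suff -> : a = word1 by rewrite f1 g1.
apply/ffunP => i; rewrite ffunE; apply/negbTE/negP => ai.
have H k : forall j : 'I_N, (j + k = N)%N -> a j -> False.
  elim: k => [|k IHk] j jk aj; first by have := ltn_ord j; lia.
  have := none j; rewrite aj /=; case lj: (is_last j) => //= /negbFE aj'.
  by apply: (IHk (nxt j)); rewrite ?val_nxt ?lj //; lia.
by apply: (H (N - i)%N i) => //; rewrite subnKC // ltnW.
Qed.

End BarMap.

(** * Exponent bounds *)

Section ZspanTheory.
Context {K : comNzRingType} {G : zmodType}.
Local Notation L := (laurent K G).
Implicit Types (S : G -> Prop) (f : L).

Lemma Zspan0 S : Zspan S (0 : L).
Proof. by exists [::]; rewrite big_nil. Qed.

Lemma ZspanD S f1 f2 : Zspan S f1 -> Zspan S f2 -> Zspan S (f1 + f2).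
Proof.
move=> [r1 [S1 ->]] [r2 [S2 ->]]; exists (r1 ++ r2); rewrite big_cat; split=> // p.
by rewrite mem_cat => /orP[/S1|/S2].
Qed.

Lemma Zspan_sum S (I : Type) (r : seq I) (P : pred I) (F : I -> L) :
  (forall i, P i -> Zspan S (F i)) -> Zspan S (\sum_(i <- r | P i) F i).
Proof. by move=> h; apply: big_ind => //; [exact: Zspan0|exact: ZspanD]. Qed.

Lemma Zspan_shift S S' (n : int) h f : (forall g, S g -> S' (h + g)) ->
  Zspan S f -> Zspan S' (mono h *~ n * f).
Proof.
move=> hS [r [Sr ->]]; exists [seq (n * p.1, h + p.2) | p <- r]; split.
  by move=> _ /mapP[p pr ->] /=; apply/hS/Sr.
rewrite big_map mulr_sumr; apply: eq_bigr => p _ /=.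
by rewrite monoD mulrzAl mulrzAr -mulrzA [n * _]mulrC.
Qed.

Lemma Zspan_mono S S' h f : (forall g, S g -> S' (h + g)) ->
  Zspan S f -> Zspan S' (mono h * f).
Proof. by move=> hS sf; rewrite -[mono h]mulr1z; apply: Zspan_shift sf. Qed.

Lemma Zspan_sub S S' f : (forall g, S g -> S' g) -> Zspan S f -> Zspan S' f.
Proof. by move=> sub [r [Sr ->]]; exists r; split=> // p /Sr/sub. Qed.

Lemma Zspan1 S : S 0 -> Zspan S (1 : L).
Proof.
move=> S0; exists [:: (1, 0)]; rewrite big_seq1 mulr1z; split=> // p.
by rewrite inE => /eqP->.
Qed.

Lemma Zspan_bar_eq0 S f : (forall g, S g -> ~ S (- g)) ->
  Zspan S f -> lbar f = f -> f = 0.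
Proof.
move=> asym [r [Sr fE]] bf.
have coef_mono (p : int * G) g : (mono p.2 *~ p.1 : L)@_g = (p.2 == g)%:R *~ p.1.
  by rewrite raddfMz /= mcoeffU.
have coefS g : f@_g != 0 -> S g.
  rewrite fE; elim: r Sr {fE} => [|p r IH] Sr; first by rewrite big_nil mcoeff0 eqxx.
  rewrite big_cons mcoeffD coef_mono; case: (eqVneq p.2 g) => [<- _|ne].
    by apply: Sr; rewrite mem_head.
  by rewrite mul0rz add0r; apply: IH => x xr; apply: Sr; rewrite inE xr orbT.
have coefV g : f@_g = f@_(- g).
  rewrite -{1}bf fE; elim: r {Sr fE} => [|p r IH]; first by rewrite big_nil raddf0 !mcoeff0.
  rewrite big_cons raddfD !mcoeffD IH coef_mono; congr (_ + _).
  rewrite raddfMz /= lbar_mono (coef_mono (p.1, - p.2)) /=.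
  by rewrite eqr_oppLR.
apply/malgP => g; rewrite mcoeff0; apply/eqP; apply: contraT => nz.
by case: (asym g); apply: coefS; rewrite -?coefV.
Qed.

End ZspanTheory.

(* Exponents of at most t^n (resp. t^(n + m c)), strictly if [s].             *)
Definition exp_bound X n c (s : bool) : expo X -> Prop :=
  match X return expo X -> Prop with
  | CaseA => fun g => (g.1 < n%:Z)%R \/ (~~ s /\ g = (n%:Z, 0))
  | CaseB m => fun g => (g < (n + m * c)%N%:Z)%R \/ (~~ s /\ g = (n + m * c)%N%:Z)
  end.

Definition strict_case X c := if X is CaseB _ then (0 < c)%N else false.

Definition sw_strict X p k := if X is CaseB m then (p < m)%N && (0 < k)%N else false.

Lemma e_t_mul (g : nat) : e_t CaseA *+ g = (g%:Z, 0).
Proof. by apply: injective_projections; rewrite raddfMn /= ?natz ?mul0rn. Qed.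

Lemma e_tN_mul (g : nat) : e_tN CaseA *+ g = (0, g%:Z).
Proof. by apply: injective_projections; rewrite raddfMn /= ?natz ?mul0rn. Qed.

Section ScanBound.
Context {K : comNzRingType} (X : kl_case).
Hypothesis okX : kl_case_ok X.
Local Notation L := (laurent K (expo X)).
Implicit Types (al be : seq bool) (stk : seq nat) (p c n : nat).

Lemma exp_bound_t n c s g F (s' : bool) (f : L) : (g <= F)%N ->
    (s' ==> s || (g < F)%N) ->
  Zspan (@exp_bound X n c s) f -> Zspan (@exp_bound X (F + n) c s') (var_t K X ^+ g * f).
Proof.
move=> gF /implyP ss'; rewrite /var_t -mono_natmul; apply: Zspan_mono => h {f}.
case: X h => [|m] h; rewrite /exp_bound.
  rewrite e_t_mul; case: h => x y /= -[hn|[ns [-> ->]]]; first by left; lia.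
  case: s' ss' => [/(_ isT)|_]; first by rewrite (negbTE ns) /= => gF'; left; lia.
  have [->|ne] := eqVneq g F; last by left; lia.
  by right; split=> //; congr pair; rewrite ?addr0 // PoszD.
rewrite [e_t _]/(1 : int) natz => -[hn|[ns ->]]; first by left; lia.
case: s' ss' => [/(_ isT)|_]; first by rewrite (negbTE ns) /= => gF'; left; lia.
by have [->|ne] := eqVneq g F; [right; split=> //; lia | left; lia].
Qed.

Lemma exp_bound_sw p k n c s (s' : bool) (f : L) :
    (s' ==> s || sw_strict X p k) ->
  Zspan (@exp_bound X n c s) f -> Zspan (@exp_bound X n (c + k) s') (sw K X p k * f).
Proof.
move=> /implyP ss'; move: f okX ss'; rewrite /sw_strict /sw; case: X => [|m] f okX' ss'.
  have E : (- (var_tV K CaseA * var_tN K CaseA ^+ 2)) ^+ k =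
      mono ((- e_t CaseA + e_tN CaseA *+ 2) *+ k) *~ (-1) ^+ k.
    rewrite /var_tV /var_tN -mono_natmul -monoD [LHS]exprNn -mono_natmul.
    by rewrite -[RHS]mulrzl rmorphXn /= rmorphN1.
  have E2 : (- e_t CaseA + e_tN CaseA *+ 2) *+ k = (- k%:Z, 2 * k%:Z).
    rewrite mulrnDl mulNrn -mulrnA e_t_mul e_tN_mul.
    by congr pair; rewrite /= ?addr0 ?add0r //; lia.
  case: (odd p); last first.
    rewrite mul1r; apply: Zspan_sub => -[x y] /= [h|[ns [-> ->]]]; first by left.
    by right; split=> //; apply: contra ns => /ss'; rewrite orbF.
  rewrite E E2; apply: Zspan_shift => -[x y] /= [h|[ns [-> ->]]]; first by left; lia.
  case: k {E E2} ss' => [|k] ss'; last by left; lia.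
  by right; split; [apply: contra ns => /ss'; rewrite orbF | congr pair; lia].
have shiftm j s0 : (j <= m * k)%N -> (s' ==> s || s0) -> (s0 -> (j < m * k)%N) ->
   Zspan (@exp_bound (CaseB m) n c s) f ->
   Zspan (@exp_bound (CaseB m) n (c + k) s') (var_t K (CaseB m) ^+ j * f).
  move=> jk /implyP ss0 s0j; rewrite /var_t -mono_natmul; apply: Zspan_mono => h.
  rewrite /exp_bound [e_t _]/(1 : int) natz mulnDr => -[hn|[ns ->]]; first by left; lia.
  case: s' ss0 {ss'} => [/(_ isT)|_]; first by rewrite (negbTE ns) /= => /s0j sj; left; lia.
  by have [->|ne] := eqVneq j (m * k)%N; [right; split=> //; lia | left; lia].
rewrite /swB; case: ifP ss' => pm /= ss'.
  apply: (shiftm _ (0 < k)%N); first by rewrite leq_mul2r ltnW ?orbT.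
    exact/implyP/ss'.
  by move=> k0; rewrite ltn_mul2r k0.
case: ifP => _.
  case: (eqVneq k 0%N) => [k0|k0] sf; last by rewrite mul0r; apply: Zspan0.
  by have := shiftm 0%N false (leq0n _) (introT implyP ss') (fun e => False_ind _ (notF e)) sf; rewrite expr0.
case: odd; first by rewrite !mul0r => _; apply: Zspan0.
by rewrite mul1r; apply: (shiftm _ false) => //; apply/implyP.
Qed.

Lemma scan_bound p c stk al be : size al = size be ->
  Zspan (@exp_bound X (area al be) c
           (strict_case X c || ((count2 al == count2 be) && (al != be))))
        (scan (var_t K X) (sw K X) p c stk al be).
Proof.
elim: al be p c stk => [|a al IH] [|b be] // p c stk sz.
  rewrite /=; case: ifP; last by move=> _; apply: Zspan0.
  rewrite /fits /= add0n leqn0 => /andP[/eqP-> _]; apply: Zspan1.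
  by case: (X) => [|m] /=; right; rewrite ?muln0.
case: sz => sz; case ok: (all (fits (a :: al) (b :: be)) (c :: stk)); last first.
  by rewrite scan_out ?ok //; apply: Zspan0.
have fc : fits (a :: al) (b :: be) c by case/andP: ok.
rewrite [area _ _]/=; set F := (count2 be - count2 al)%N.
set s := strict_case X c || _.
have step q d stk' g k : (d + k = c)%N -> (fits al be g -> g <= F)%N ->
    (fits al be g ->
     s ==> (strict_case X d || ((count2 al == count2 be) && (al != be)) || sw_strict X p k) || (g < F)%N) ->
    g \in d :: stk' \/ fits al be g ->
  Zspan (@exp_bound X (F + area al be) c s)
    (var_t K X ^+ g * (sw K X p k * scan (var_t K X) (sw K X) q d stk' al be)).
  move=> dk gF hs gin; case fg: (fits al be g); last first.
    rewrite (@scan_out1 _ _ _ _ _ _ _ _ g) ?fg ?mulr0 //; first exact: Zspan0.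
    by case: gin => //; rewrite fg.
  apply: (exp_bound_t (gF fg) (hs fg)); rewrite -{1}dk.
  by apply: (exp_bound_sw _ (IH be q d stk' sz)); apply/implyP.
have fF g : fits al be g -> (g <= F)%N by rewrite /fits /F; lia.
have ne_tail : a = b -> a :: al != b :: be -> al != be.
  by move=> ->; rewrite eqseq_cons eqxx.
case: b fc ok @s ne_tail step => fc ok s ne_tail step; case: stk ok => [|h stk] ok.
- rewrite (@scan_true_nil _ _ _ _ _ (count2 be).+1) //; apply: Zspan_sum => -[g gM] _ /=.
  have [/and4P[/eqP g0 /eqP c1 BX mp]|ncase] := boolP [&& g == 0%N, c == 1%N,
      strict_case X 1 & ~~ sw_strict X p 1].
    have -> : sw K X p (c - g) = 0; last by rewrite mul0r mulr0; apply: Zspan0.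
    rewrite g0 c1 /sw; move: BX mp; rewrite /sw_strict; case: (X) => //= m' _.
    by rewrite andbT /swB => /negbTE->; rewrite mul0r if_same.
  apply: step; [lia | exact: fF | | by left; rewrite !inE eqxx orbT].
  move=> fg; apply/implyP => /orP[sc|/andP[/eqP e ne]].
    have [cg0|cg0] := posnP (minn c g); last first.
      by move: sc; rewrite /strict_case; case: (X) => //= ? _; rewrite cg0.
    move: sc cg0 ncase fc; rewrite /strict_case /sw_strict /fits /F /=; case: (X) => //= m' c0 cg0.
    have -> : g = 0%N by lia.
    by case: (p < m')%N => /=; lia.
  have [ea ec] : a = true /\ count2 al = count2 be.
    by move: e fg; rewrite /fits /=; case: (a); lia.
  by rewrite ec eqxx ne_tail ?orbT.
- rewrite (@scan_true_cons _ _ _ _ _ _ _ (count2 be).+1) //; apply: Zspan_sum => -[g gM] /= hg.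
  rewrite -[scan _ _ _ _ _ _ _]mul1r -(sw0 (K := K) X p).
  apply: step; [lia | exact: fF | | by left; rewrite !inE eqxx orbT].
  move=> fg; apply/implyP => /orP[->//|/andP[/eqP e ne]].
  have [ea ec] : a = true /\ count2 al = count2 be.
    by move: e fg; rewrite /fits /=; case: (a); lia.
  by rewrite ec eqxx ne_tail ?orbT.
- rewrite scan_false_nil //; apply: Zspan_sum => -[g gc] _; rewrite [nat_of_ord _]/=.
  rewrite ltnS in gc.
  have fg : fits al be g by move: fc gc; rewrite /fits /=; case: (a); lia.
  apply: step; [lia | exact: fF | | by right].
  move=> _; apply/implyP => /orP[sc|/andP[/eqP e ne]].
    have [g0|g0] := posnP g; last first.
      by move: sc; rewrite /strict_case; case: (X) => //= ? _; rewrite g0.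
    have -> : (g < F)%N; last by rewrite orbT.
    move: sc fc; rewrite /strict_case /fits /F /=; case: (X) => //= m' c0.
    by case: (a); lia.
  have c0 : c = 0%N by move: fc; rewrite /fits e; lia.
  case: a e ne ne_tail {IH ok fc s} => /= e ne ne_tail.
    by have -> : (g < F)%N; [rewrite /F; lia | rewrite orbT].
  by rewrite !add0n in e; rewrite e eqxx ne_tail ?orbT.
- rewrite scan_false_cons // -[scan _ _ _ _ _ _ _]mul1r -(sw0 (K := K) X p).
  have fh : fits (a :: al) (false :: be) h by case/and3P: ok.
  have fh' : fits al be h by move: fh; rewrite /fits /=; case: (a); lia.
  apply: step; [lia | exact: fF | | by right].
  move=> _; apply/implyP => /orP[->//|/andP[/eqP e ne]].
  have h0 : h = 0%N by move: fh; rewrite /fits e; lia.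
  case: a e ne ne_tail {IH ok fc s fh} => /= e ne ne_tail.
    by have -> : (h < F)%N; [rewrite /F; lia | rewrite orbT].
  by rewrite !add0n in e; rewrite e eqxx ne_tail ?orbT.
Qed.

End ScanBound.

Fixpoint suffix_count (s : seq bool) : nat :=
  if s is _ :: s' then count2 s' + suffix_count s' else 0.

Lemma area_below al be : size al = size be -> below al be ->
  (area al be + suffix_count al = suffix_count be)%N.
Proof.
elim: al be => [|a al IH] [|b be] // [sz] /below_cons[_ ab] /=.
by have := IH _ sz ab; have := ab 0%N; rewrite !drop0; lia.
Qed.

Lemma count2_nth s : count2 s = (\sum_(0 <= k < size s | nth false s k) 1)%N.
Proof.
elim: s => [|a s IH]; first by rewrite big_geq.
by rewrite [size _]/= big_ltn_cond // big_add1 /= IH; case: a.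
Qed.

Lemma suffix_count_nth s : suffix_count s = (\sum_(0 <= k < size s | nth false s k) k)%N.
Proof.
elim: s => [|a s IH]; first by rewrite big_geq.
rewrite [size _]/= big_ltn_cond // big_add1 /= add0n if_same IH count2_nth -big_split.
by apply: eq_bigr => k _; rewrite /= add1n.
Qed.

Lemma wexp_rseq X N (a : word N) :
  wexp X a = e_t X *+ suffix_count (rseq a) + e_tN X *+ count2 (rseq a).
Proof.
have E (F : nat -> nat) : (\sum_(i | a i) F (N - i.+1) = \sum_(0 <= k < size (rseq a) | nth false (rseq a) k) F k)%N.
  rewrite (reindex_inj rev_ord_inj) size_rseq big_mkord.
  rewrite (eq_bigl (fun k : 'I_N => nth false (rseq a) k)) => [|k]; last first.
    by rewrite -(nth_rseq a (rev_ord k)) rev_ordK.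
  by apply: eq_bigr => k _; congr F; have := ltn_ord k; rewrite /=; lia.
rewrite /wexp big_split /= sumrMnr (E id) -suffix_count_nth; congr (_ + _).
by rewrite sumr_const -sum1_card (E (fun=> 1%N)) -count2_nth.
Qed.

Lemma var_prod_mono (K : comNzRingType) X n d :
  var_tV K X ^+ n * var_tNV K X ^+ d = mono (- (e_t X *+ n + e_tN X *+ d)).
Proof. by rewrite /var_tV /var_tNV -!mono_natmul -monoD !mulNrn opprD. Qed.

Lemma below_count al be : below al be -> (count2 al <= count2 be)%N.
Proof. by move=> /(_ 0%N); rewrite !drop0. Qed.

Lemma e_t_mulz (z : int) : e_t CaseA *~ z = (z, 0).
Proof. by apply: injective_projections; rewrite raddfMz /= ?intz ?mul0rz. Qed.

Lemma e_tN_mulz (z : int) : e_tN CaseA *~ z = (0, z).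
Proof. by apply: injective_projections; rewrite raddfMz /= ?intz ?mul0rz. Qed.

Lemma Gamma_neg_asym X (g : expo X) : Gamma_neg g -> ~ Gamma_neg (- g).
Proof.
rewrite /Gamma_neg opprK; case: X g => [|m] g /=.
  case: g => x y; rewrite /GRing.opp /=.
  case=> [[i [j [i0]]]|[i [i0]]]; rewrite ?e_t_mulz e_tN_mulz => -[ex ey];
  case=> [[i' [j' [i0']]]|[i' [i0']]]; rewrite ?e_t_mulz e_tN_mulz => -[ex' ey']; lia.
by case=> i [i0]; rewrite intz => e [j [j0]]; rewrite intz; lia.
Qed.

Section KLFamily.
Context (K : comNzRingType) (X : kl_case) (N : nat).
Hypothesis okX : kl_case_ok X.
Local Notation L := (laurent K (expo X)).
Local Notation W := (word N).
Local Notation M := {ffun W -> L^o}.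
Local Notation klbasis := (@klbasis K X N).
Implicit Types (a b c : W) (v w : M).

Lemma klbasis_wratio a b : bruhat a b -> klbasis b a =
  wratio K X a b * scan (var_t K X) (sw K X) 0 (count2 (rseq b) - count2 (rseq a)) [::] (rseq a) (rseq b).
Proof.
move=> /bruhatP ab; rewrite ffunE /klseq /klvec mulrA var_prod_mono; congr (mono _ * _).
have sz : size (rseq a) = size (rseq b) by rewrite !size_rseq.
rewrite !wexp_rseq -(area_below sz ab) -(subnK (below_count ab)) addnK.
rewrite !mulrnDr; set u := _ *+ area _ _; set x := _ *+ suffix_count _.
set y := _ *+ (_ - _); set z := _ *+ count2 _.
by rewrite [X in _ = _ - X]addrACA [in RHS]opprD [RHS]addrCA subrr addr0.
Qed.

Lemma klbasis_Gamma a b : bruhat a b -> a != b ->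
  Zspan (@Gamma_neg X) (klbasis b a : L).
Proof.
move=> /bruhatP ab ne; rewrite ffunE /klseq /klvec mulrA var_prod_mono.
have sz : size (rseq a) = size (rseq b) by rewrite !size_rseq.
have ne' : rseq a != rseq b by rewrite (inj_eq rseq_inj).
apply: Zspan_mono (scan_bound okX 0 _ _ sz) => h; rewrite ne' andbT.
have := below_count ab; set D := (count2 (rseq b) - _)%N; move: (area _ _) => n le.
have {}D0 : (count2 (rseq a) == count2 (rseq b)) = (D == 0%N) by rewrite /D; lia.
rewrite D0 /Gamma_neg; case: X h => [|m] h /=.
  rewrite e_t_mul e_tN_mul; case: h => x y /= [lt|[nD [-> ->]]].
    left; exists (n%:Z - x), (D%:Z - y); split; first by lia.
    by rewrite e_t_mulz e_tN_mulz; congr pair; rewrite /=; lia.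
  right; exists D%:Z; split; first by lia.
  by rewrite e_tN_mulz; congr pair; rewrite /=; lia.
have -> : m%:Z *+ D = (m * D)%N%:Z by rewrite -[m%:Z]natz -mulrnA natz.
rewrite natz => hD; exists (n%:Z + (m * D)%N%:Z - h); rewrite intz; split; last by lia.
by case: hD => [|[]]; lia.
Qed.

Let bar_module_is_bar : is_bar_module (@bar_module K X N).
Proof.
apply: (@classical_sets.xgetPex _ (id : M -> M) (@is_bar_module K X N)).
by exists (bar_map okX); exact: (bar_map_is_bar K N okX).
Qed.

Lemma bar_moduleE : @bar_module K X N =1 bar_map okX.
Proof. exact: is_bar_unique bar_module_is_bar (bar_map_is_bar K N okX). Qed.

Lemma KL_element_at (P : W -> W -> L) b c :
  KL_element P b c = if bruhat c b then wratio K X c b * P c b else 0.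
Proof.
rewrite /KL_element sum_ffunE big_mkcond (bigD1 c) //= big1 => [|a ne].
  by rewrite addr0; case: ifP => // _; rewrite !ffunE eqxx /GRing.scale /= mulr1.
by case: ifP => // _; rewrite !ffunE (negbTE ne) scaler0.
Qed.

Lemma wratio_refl a : wratio K X a a = 1.
Proof. by rewrite /wratio subrr mono0. Qed.

Lemma bruhat_refl a : bruhat a a.
Proof. exact/bruhatP/below_refl. Qed.

Lemma klbasis0 a b : ~~ bruhat a b -> klbasis b a = 0.
Proof. by apply: contraNeq => /klbasis_bruhat. Qed.

Lemma ffunB_at v w c : (v - w) c = (v c : L) - (w c : L) :> L.
Proof. by rewrite !ffunE. Qed.

Lemma KL_element_diff (P : W -> W -> L) b c : is_KL_family P ->
  Zspan (@Gamma_neg X) ((KL_element P b - klbasis b) c : L).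
Proof.
move=> famP; have [_ Pbb PG _] := famP b.
have x1 := klbasis_diag K X b; have x0 := @klbasis0 c b; have xG := @klbasis_Gamma c b.
move: (klbasis b) x1 x0 xG => f x1 x0 xG; rewrite ffunB_at KL_element_at.
have [cb|ne] := eqVneq c b.
  have -> : (f c : L) = 1 by rewrite cb.
  rewrite cb bruhat_refl wratio_refl mul1r Pbb subrr; exact: Zspan0.
case: ifP => cb; last by rewrite x0 ?cb // subrr; apply: Zspan0.
apply: ZspanD; first exact: PG.
have := Zspan_shift (S := @Gamma_neg X) (S' := @Gamma_neg X) (h := 0) (-1) _ (xG cb ne).
by rewrite mono0 mulrNz mulr1z mulN1r; apply=> g; rewrite add0r.
Qed.

Lemma KL_family_klbasis (P : W -> W -> L) : is_KL_family P -> forall b, KL_element P b = klbasis b.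
Proof.
move=> famP b; have [barP Pbb PG P0] := famP b; rewrite bar_moduleE in barP.
have diffE c := KL_element_diff b c famP.
move: (KL_element P b) barP diffE => E barP diffE.
have [d dE] : {d : W -> L | forall c, d c = coord okX c (E - klbasis b)}.
  by exists (fun c => coord okX c (E - klbasis b)).
suff d0 c : d c = 0.
  apply/eqP; rewrite -subr_eq0; apply/eqP.
  rewrite [LHS](coord_span okX); apply: big1 => c _.
  by rewrite -dE d0; exact: scale0r.
have bar_d c' : lbar (d c') = d c'.
  have e : bar_map okX (E - klbasis b) = E - klbasis b.
    by rewrite bar_mapD bar_mapN bar_map_klbasis barP.
  by rewrite !dE; exact: etrans (esym (coord_bar_map okX c' _)) (congr1 (coord okX c') e).
pose m := (\max_(a : W) rank a)%N.
have le_m a : (rank a <= m)%N := leq_bigmax a.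
have [n le] := ubnP (m - rank c)%N; elim: n c le => [//|n IH] c le.
have IHc a : (rank c < rank a)%N -> d a = 0.
  by move=> ca; apply: IH; have := le_m a; clearbody m; lia.
have Ec : (E - klbasis b) c = d c.
  rewrite {1}[E - _](coord_span okX) sum_ffunE (bigD1 c isT) /= big1 => [|a ne].
    by rewrite ffunE klbasis_diag addr0 -dE /GRing.scale /= mulr1.
  rewrite ffunE -dE; case: (eqVneq (klbasis a c) 0) => [->|/klbasis_bruhat ca].
    exact: mulr0.
  by rewrite IHc ?scale0r // bruhat_rank // eq_sym.
refine (@Zspan_bar_eq0 _ _ (@Gamma_neg X) _ _ _ (bar_d c)); first exact: Gamma_neg_asym.
by rewrite -Ec; apply: diffE.
Qed.

Lemma KL_family_exists : exists P, is_KL_family (P : W -> W -> L).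
Proof.
exists (fun a b => if bruhat a b then mono (wexp X b - wexp X a) * klbasis b a else 0) => b.
have wr a : bruhat a b -> wratio K X a b * (if bruhat a b then mono (wexp X b - wexp X a) * klbasis b a else 0) = klbasis b a.
  by move=> ->; rewrite mulrA -monoD -(opprB (wexp X a) (wexp X b)) subrr mono0 mul1r.
have KE : KL_element (fun a b => if bruhat a b then mono (wexp X b - wexp X a) * klbasis b a else 0) b = klbasis b.
  apply/ffunP => c; rewrite KL_element_at; case: ifP => cb; first by have := wr c cb; rewrite cb.
  case: (eqVneq (klbasis b c) 0) => [->//|/klbasis_bruhat].
  by rewrite cb.
split.
- by rewrite KE bar_moduleE bar_map_klbasis.
- have -> : bruhat b b by apply/bruhatP/below_refl.
  by rewrite subrr mono0 klbasis_diag mulr1.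
- by move=> a ab ne; rewrite wr //; apply: klbasis_Gamma.
- by move=> a /negbTE->.
Qed.

Lemma KLpoly_scan a b : bruhat a b -> KLpoly K X a b =
  scan (var_t K X) (sw K X) 0 (count2 (rseq b) - count2 (rseq a)) [::] (rseq a) (rseq b).
Proof.
move=> ab; have fam : is_KL_family (@KLpoly K X N).
  exact: (@classical_sets.xgetPex _ (fun _ _ => 0) (@is_KL_family K X N) KL_family_exists).
have := congr1 (fun f : M => f a) (KL_family_klbasis fam b).
rewrite KL_element_at ab klbasis_wratio // /wratio.
move/(congr1 (fun x : L => mono (- (wexp X a - wexp X b)) * x)).
by rewrite !mulrA [mono (- _) * _]mulrC monoV !mul1r.
Qed.

End KLFamily.

(** * Configurations as labellings *)

Fixpoint label_seqs n B : seq (seq nat) :=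
  if n is n'.+1 then [seq g :: gs | g <- iota 0 B, gs <- label_seqs n' B] else [:: [::]].

Lemma mem_label_seqs n B gs : (gs \in label_seqs n B) = (size gs == n) && all (gtn B) gs.
Proof.
elim: n gs => [|n IH] gs; first by rewrite inE; case: gs.
apply/allpairsP/andP => [[[g gs'] /= [gB gsn ->]]|].
  by move: gB gsn; rewrite mem_iota IH /= => -> /andP[/eqP-> ->].
case: gs => [|g gs] [] //= sz /andP[gB al]; exists (g, gs); split=> //=.
  by rewrite mem_iota.
by rewrite IH al andbT -eqSS.
Qed.

Lemma uniq_label_seqs n B : uniq (label_seqs n B).
Proof.
elim: n => //= n IH; apply: allpairs_uniq; rewrite ?iota_uniq //.
by move=> [g gs] [g' gs'] /= _ _ [-> ->].
Qed.

Section ScanTerm.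
Context {L : comNzRingType} (t : L) (sw : nat -> nat -> L).
Hypothesis sw0 : forall p, sw p 0 = 1.
Implicit Types (al be : seq bool) (gs stk : seq nat) (p c g B : nat).

Fixpoint scan_term p c stk al be gs : L :=
  if all (fits al be) (c :: stk) then
    match al, be, gs with
    | _ :: al', b :: be', g :: gs' =>
      if b then
        if stk is [::] then
          t ^+ g * (sw p (c - g) * scan_term p (minn c g) [:: g] al' be' gs')
        else if (head 0%N stk <= g)%N then t ^+ g * scan_term p c (g :: stk) al' be' gs' else 0
      else
        if stk is h :: stk' then
          if g == h then t ^+ h * scan_term p c stk' al' be' gs' else 0
        else if (g <= c)%N then t ^+ g * (sw p (c - g) * scan_term p.+1 g [::] al' be' gs') else 0
    | _, _, _ => 1
    end
  else 0.

Lemma scan_term_out p c stk al be gs :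
  ~~ all (fits al be) (c :: stk) -> scan_term p c stk al be gs = 0.
Proof. by case: al be gs => [|a al] [|b be] [|g gs] /negbTE /= ->. Qed.

Lemma sum_iota (F : nat -> L) n : \sum_(g <- iota 0 n) F g = \sum_(g < n) F g.
Proof. by rewrite -(big_mkord xpredT F) /index_iota subn0. Qed.

Lemma scan_sum p c stk al be B : size al = size be -> (size be < B)%N ->
  scan t sw p c stk al be = \sum_(gs <- label_seqs (size al) B) scan_term p c stk al be gs.
Proof.
elim: al be p c stk => [|a al IH] [|b be] // p c stk.
  by move=> _ _; rewrite big_seq1 /=.
case=> sz beB; have beB' : (size be < B)%N by apply: ltnW.
case ok: (all (fits (a :: al) (b :: be)) (c :: stk)); last first.
  rewrite scan_out ?ok // big1_seq // => gs _.
  by rewrite scan_term_out ?ok.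
have cB g : (g \in c :: stk) -> (g < B)%N.
  move=> /(allP ok); rewrite /fits => h.
  by have := count_size id (b :: be); move: beB h => /=; lia.
rewrite [label_seqs _ _]/= big_allpairs_dep sum_iota.
have zero g gs p' c' stk' : ~~ fits al be g -> g \in stk' -> scan_term p' c' stk' al be gs = 0.
  move=> ng gin; apply: scan_term_out; apply/allPn; exists g => //.
  by rewrite inE gin orbT.
have cBe : (count2 be < B)%N by apply: leq_ltn_trans (count_size _ _) beB'.
clear beB; case: b ok cB => ok cB; case: stk ok cB => [|h stk] ok cB.
- rewrite (@scan_true_nil _ _ _ _ _ B) //; last by case/andP: ok.
  apply: eq_bigr => g _; rewrite (IH be) // !mulr_sumr; apply: eq_bigr => gs _.
  by move: ok; rewrite /= => ->.
- rewrite (@scan_true_cons _ _ _ _ _ _ _ B) // big_mkcond; apply: eq_bigr => g _.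
  case: ifP => hg; last by rewrite big1 // => gs _; move: ok; rewrite /= => ->; rewrite hg.
  rewrite (IH be) // mulr_sumr; apply: eq_bigr => gs _.
  by move: ok; rewrite /= => ->; rewrite hg.
- have cB' : (c < B)%N by apply: cB; rewrite mem_head.
  rewrite scan_false_nil; last by case/andP: ok.
  rewrite (big_ord_widen B (fun g => t ^+ g * (sw p (c - g) * scan t sw p.+1 g [::] al be))) //.
  rewrite big_mkcond; apply: eq_bigr => g _; rewrite ltnS; case: ifP => gc; last first.
    by rewrite big1 // => gs _; move: ok; rewrite /= => ->; rewrite gc.
  rewrite (IH be) // !mulr_sumr; apply: eq_bigr => gs _.
  by move: ok; rewrite /= => ->; rewrite gc.
- have hB : (h < B)%N by apply: cB; rewrite !inE eqxx orbT.
  rewrite scan_false_cons // (bigD1 (Ordinal hB)) //= [X in _ + X]big1 => [|g gh].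
    rewrite addr0 (IH be) // mulr_sumr; apply: eq_bigr => gs _.
    by move: ok; rewrite /= => ->; rewrite eqxx.
  rewrite big1 // => gs _; move: ok; rewrite /= => ->.
  by rewrite -val_eqE /= in gh; rewrite (negbTE gh).
Qed.

End ScanTerm.

Section StepConditions.
(* [h] is the height of the lower path, [f] the number of boxes in a column   *)
(* and [g x] the number of strips crossing the step from column x-1 to x.     *)
Context (N : nat) (h : nat -> int) (f g : nat -> nat).
Implicit Types (x y z w j : nat).

Definition first_below y z : Prop :=
  [/\ (y < z <= N)%N, h z < h y & forall w, (y <= w < z)%N -> h y <= h w].

Definition step_ok y : Prop :=
  [/\ (g y <= f y)%N /\ (g y <= f y.-1)%N,
      h y < h y.-1 -> forall z, first_below y z -> (g z <= g y)%N,
      h y.-1 < h y -> forall z, first_below y z -> g y = g z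
    & h y.-1 < h y -> (forall z, ~ first_below y z) ->
      (g y <= f N)%N /\ forall w, (y < w <= N)%N -> (g y <= g w)%N].

(* The number of strips reaching the last column from column x or before.     *)
Definition through x : nat := foldr minn (f N) [seq g y | y <- iota x.+1 (N - x)].

Lemma throughN : through N = f N. Proof. by rewrite /through subnn. Qed.

Lemma throughS x : (x < N)%N -> through x = minn (g x.+1) (through x.+1).
Proof. by move=> xN; rewrite /through -(subnSK xN). Qed.

Lemma leq_through x j : (x <= N)%N ->
  (j <= through x)%N <-> (j <= f N)%N /\ forall w, (x < w <= N)%N -> (j <= g w)%N.
Proof.
move=> xN; rewrite -(subKn xN); move: (N - x)%N (leq_subr x N) => k; elim: k => [|k IH] kN.
  by rewrite subn0 throughN; split=> [->|[]] //; split=> // w; lia.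
rewrite throughS ?subnSK ?leq_min; [|lia..].
split=> [/andP[jg /(IH (ltnW kN))[jf jw]]|[jf jw]].
  split=> // w /andP[w1 w2]; case: (eqVneq w (N - k)%N) => [->//|ne]; apply: jw; lia.
by rewrite jw; [apply/(IH (ltnW kN)); split=> // w ww; apply: jw; lia|lia].
Qed.

End StepConditions.

Lemma le_head s stk c : sorted geq (rcons (s :: stk) c) -> forall k, k \in c :: stk -> (k <= s)%N.
Proof.
move=> srt k ks; have /allP := order_path_min geq_trans srt.
by apply; rewrite mem_rcons.
Qed.

Definition path_height N be x : int := x%:Z - (2 * count2 (drop (N - x) be))%N%:Z.

Definition depth N al be x : nat := (count2 (drop (N - x) be) - count2 (drop (N - x) al))%N.

Definition label N gs x : nat := nth 0%N gs (N - x).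

Lemma path_heightS N be x : size be = N -> (x < N)%N ->
  path_height N be x.+1 = (path_height N be x + (if nth false be (N - x.+1) then -1 else 1))%R :> int.
Proof.
move=> sN xN; rewrite /path_height (drop_nth false) ?sN ?subnSK //; last by lia.
by rewrite [count2 (_ :: _)]/=; case: nth; lia.
Qed.

Section ScanSteps.
Context {L : comNzRingType} (t : L) (sw : nat -> nat -> L).
Hypothesis sw0 : forall p, sw p 0 = 1.
Context (N : nat) (al be : seq bool) (gs : seq nat).
Hypotheses (size_al : size al = N) (size_be : size be = N) (size_gs : size gs = N).
Hypothesis al_be : below al be.
Implicit Types (x y z w p c k : nat) (stk : seq nat).

Local Notation h := (path_height N be).
Local Notation f := (depth N al be).
Local Notation g := (label N gs).
Local Notation step_ok := (step_ok N h f g).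
Local Notation through := (through N f g).

Definition step_weight y : L := t ^+ g y * sw `|h N - h y|%N (through y - g y).

Let drop_al x : (x < N)%N -> drop (N - x.+1) al = nth false al (N - x.+1) :: drop (N - x) al.
Proof. by move=> xN; rewrite (drop_nth false) ?size_al ?subnSK //; lia. Qed.
Let drop_be x : (x < N)%N -> drop (N - x.+1) be = nth false be (N - x.+1) :: drop (N - x) be.
Proof. by move=> xN; rewrite (drop_nth false) ?size_be ?subnSK //; lia. Qed.
Let drop_gs x : (x < N)%N -> drop (N - x.+1) gs = g x.+1 :: drop (N - x) gs.
Proof. by move=> xN; rewrite (drop_nth 0%N) ?size_gs ?subnSK //; lia. Qed.

Lemma depthS x : (x < N)%N -> (f x.+1 + nth false al (N - x.+1) = f x + nth false be (N - x.+1))%N.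
Proof.
move=> xN; rewrite /f drop_be // drop_al // ![count2 (_ :: _)]/=.
have := al_be (N - x)%N; have := al_be (N - x.+1)%N; rewrite drop_be // drop_al // ![count2 (_ :: _)]/=.
lia.
Qed.

Let fitsE x k : fits (drop (N - x) al) (drop (N - x) be) k = (k <= f x)%N.
Proof. by rewrite /fits /f; have := al_be (N - x)%N; lia. Qed.

Definition scan_inv x p c stk : Prop :=
  [/\ sorted geq (rcons stk c), c = through x,
      forall k, (k < size stk)%N -> exists z,
        [/\ (x < z <= N)%N, h z = h x - 1 - k%:Z, nth 0%N stk k = g z
          & forall w, (x <= w < z)%N -> h x - k%:Z <= h w],
      forall w, (x <= w <= N)%N -> h x - (size stk)%:Z <= h w
    & p%:Z = h N - h x + (size stk)%:Z].

Lemma scan_term_steps x p c stk : (x <= N)%N -> scan_inv x p c stk ->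
    all (fits (drop (N - x) al) (drop (N - x) be)) (c :: stk) ->
  scan_term t sw p c stk (drop (N - x) al) (drop (N - x) be) (drop (N - x) gs) =
  if `[< forall y, (0 < y <= x)%N -> step_ok y >] then \prod_(1 <= y < x.+1) step_weight y else 0.
Proof.
elim: x p c stk => [|x IH] p c stk xN inv ok.
  rewrite big_geq // asboolT; last by move=> y; lia.
  by move: ok; rewrite subn0 !drop_oversize ?size_al ?size_be ?size_gs //= => ->.
have [srt cE stkP low pE] := inv.
have hS := path_heightS size_be xN; have fS := depthS xN.
have splitE : `[< forall y, (0 < y <= x.+1)%N -> step_ok y >] =
    `[< step_ok x.+1 >] && `[< forall y, (0 < y <= x)%N -> step_ok y >].
  apply/asboolP/andP => [H|[/asboolP H1 /asboolP H2] y yx].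
    by split; apply/asboolP; [|move=> y yx]; apply: H; lia.
  by case: (eqVneq y x.+1) => [->//|ne]; apply: H2; lia.
have prodE : \prod_(1 <= y < x.+2) step_weight y =
    t ^+ g x.+1 * (sw `|h N - h x.+1|%N (through x.+1 - g x.+1) * \prod_(1 <= y < x.+1) step_weight y).
  by rewrite big_nat_recr //= mulrC -mulrA.
have ok' : all (fun k => (k <= f x.+1)%N) (c :: stk).
  by move: ok; apply: sub_all => k; rewrite fitsE.
have c_f : (c <= f x.+1)%N by case/andP: ok'.
rewrite splitE prodE {splitE prodE}.
have thr : through x = minn (g x.+1) c by rewrite throughS // cE.
move: ok; rewrite drop_al // drop_be // drop_gs //.
set b := nth false be _ in hS fS *; set a := nth false al _ in fS *; set G := g x.+1 in thr *.
move=> ok.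
have no_first : stk = [::] -> forall z, ~ first_below N h x.+1 z.
  by move=> s0 z [zz lt _]; have := low z; rewrite s0 /= => /(_ ltac:(lia)); lia.
have first_uniq z z' : first_below N h x.+1 z -> first_below N h x.+1 z' -> z = z'.
  move=> [zz zl zw] [zz' zl' zw'].
  have [lt|lt|//] := ltngtP z z'.
    by have := zw' z; lia.
  by have := zw z'; lia.
have IH' p' c' stk' : scan_inv x p' c' stk' ->
    all (fun k => k <= f x)%N (c' :: stk') = (G <= f x)%N -> 
    scan_term t sw p' c' stk' (drop (N - x) al) (drop (N - x) be) (drop (N - x) gs) =
    if (G <= f x)%N && `[< forall y, (0 < y <= x)%N -> step_ok y >] then \prod_(1 <= y < x.+1) step_weight y else 0.
  move=> inv' okE; have okE' : all (fits (drop (N - x) al) (drop (N - x) be)) (c' :: stk') = (G <= f x)%N.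
    by rewrite -okE; apply: eq_all => k; rewrite fitsE.
  case Gf: (G <= f x)%N => /=; first by apply: IH => //; [exact: ltnW | rewrite okE' Gf].
  by rewrite scan_term_out // okE' Gf.
move: (ok) => ok2; rewrite [all _ _]/= in ok2.
rewrite [scan_term _ _ _ _ _ _ _ _]/= ok2 {ok2}.
case: b hS fS ok => hS fS ok; case: stk inv srt stkP low pE ok' ok no_first => [|s stk] inv srt stkP low pE ok' ok no_first.
- have inv' : scan_inv x p (minn c G) [:: G].
    split=> //=.
    + by rewrite andbT geq_minr.
    + by rewrite minnC thr.
    + move=> [|//] _; exists x.+1; split; [lia | rewrite hS; lia | by [] |].
      by move=> w xw; have -> : w = x; lia.
    + move=> w xw; case: (eqVneq w x) => [->|ne]; first by lia.
      have := low w; rewrite /= hS; lia.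
    + by rewrite pE /= hS; lia.
  rewrite (IH' _ _ _ inv'); last by rewrite /= andbT geq_min; case: (G <= f x)%N; rewrite ?orbT ?andbF.
  have pE' : p = `|h N - h x.+1|%N by move: pE; rewrite /=; lia.
  have -> : `[< step_ok x.+1 >] = (G <= f x)%N.
    apply/asboolP/idP => [[[]//]|Gf]; have nf := no_first erefl; split.
    + by split=> //; move: fS Gf; case: (a); rewrite /=; lia.
    + by move=> _ z /nf.
    + by rewrite /= hS; lia.
    + by rewrite /= hS; lia.
  by case: ifP => _; rewrite ?mulr0 // cE pE'.
- have le_s := le_head srt.
  have cs : (c <= s)%N by apply: le_s; rewrite mem_head.
  have [z0 [z0x z0h z0g z0w]] := stkP 0%N isT; rewrite [nth _ _ _]/= in z0g.
  have fb0 : first_below N h x.+1 z0.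
    by split=> //; [lia | move=> w xw; have := z0w w xw; lia].
  have okE : `[< step_ok x.+1 >] = (s <= G)%N && (G <= f x)%N.
    apply/asboolP/andP => [[[_ Gf] dn _ _]|[sG Gf]].
      by split=> //; rewrite z0g; apply: dn => //; rewrite /= hS; lia.
    split.
    + by split=> //; move: fS Gf; case: (a); rewrite /=; lia.
    + by move=> _ z /(first_uniq _ _ fb0) <-; rewrite -z0g.
    + by rewrite /= hS; lia.
    + by rewrite /= hS; lia.
  rewrite okE; case sG: (s <= G)%N => //=.
  have inv' : scan_inv x p c [:: G, s & stk].
    split.
    + by rewrite /= sG; exact: srt.
    + by rewrite thr; lia.
    + move=> [|k] kk.
        exists x.+1; split; [lia | rewrite hS; lia | by [] |].
        by move=> w xw; have -> : w = x; lia.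
      have [z [zx zh zg zw]] := stkP k kk; exists z; split; [lia | rewrite zh hS; lia | by [] |].
      move=> w xw; case: (eqVneq w x) => [->|ne]; first by lia.
      by have := zw w; rewrite hS; lia.
    + move=> w xw; case: (eqVneq w x) => [->|ne]; first by lia.
      by have := low w; rewrite /= hS; lia.
    + by rewrite pE /= hS; lia.
  rewrite (IH' _ _ _ inv').
    have -> : (through x.+1 - G = 0)%N by rewrite -cE; lia.
    by case: ifP => _; rewrite ?mulr0 // sw0 mul1r.
  rewrite /=; case Gf: (G <= f x)%N; last by rewrite andbF.
  rewrite (leq_trans cs) ?(leq_trans sG) //=; apply/allP => k ks.
  by apply: leq_trans (le_s k _) (leq_trans sG Gf); rewrite inE ks orbT.
- have nf := no_first erefl.
  have okE : `[< step_ok x.+1 >] = (G <= c)%N && (G <= f x)%N.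
    apply/asboolP/andP => [[[_ Gf] _ _ up]|[Gc Gf]].
      split=> //; rewrite cE leq_through //; apply: up => //.
      by rewrite /= hS; lia.
    split.
    + by split=> //; apply: leq_trans Gc c_f.
    + by rewrite /= hS; lia.
    + by move=> _ z /nf.
    + by move=> _ _; apply/leq_through => //; rewrite -cE.
  rewrite okE; case Gc: (G <= c)%N => //=.
  have inv' : scan_inv x p.+1 G [::].
    split=> //.
    + by rewrite thr; lia.
    + move=> w xw; case: (eqVneq w x) => [->|ne]; first by lia.
      by have := low w; rewrite /= hS; lia.
    + by move: pE; rewrite /= hS; lia.
  rewrite (IH' _ _ _ inv'); last by rewrite /= andbT.
  have pE' : p = `|h N - h x.+1|%N by move: pE; rewrite /=; lia.
  by case: ifP => _; rewrite ?mulr0 // -cE -pE'.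
- have le_s := le_head srt.
  have cs : (c <= s)%N by apply: le_s; rewrite mem_head.
  have sf : (s <= f x.+1)%N by case/and3P: ok'.
  have ff : (f x.+1 <= f x)%N by move: fS; case: (a); rewrite /=; lia.
  have [z0 [z0x z0h z0g z0w]] := stkP 0%N isT; rewrite [nth _ _ _]/= in z0g.
  have fb0 : first_below N h x.+1 z0.
    by split=> //; [lia | move=> w xw; have := z0w w xw; lia].
  have okE : `[< step_ok x.+1 >] = (G == s) && (G <= f x)%N.
    apply/asboolP/andP => [[[_ Gf] _ up _]|[/eqP Gs Gf]].
      by split=> //; apply/eqP; rewrite z0g; apply: up => //; rewrite /= hS; lia.
    split.
    + by split=> //; rewrite -/G Gs.
    + by rewrite /= hS; lia.
    + by move=> _ z /(first_uniq _ _ fb0) <-; rewrite -z0g.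
    + by move=> _ /(_ z0).
  rewrite okE; case: eqP => Gs //=.
  have inv' : scan_inv x p c stk.
    split.
    + exact: path_sorted srt.
    + by rewrite thr; lia.
    + move=> k kk; have [z [zx zh zg zw]] := stkP k.+1 kk.
      exists z; split; [lia | rewrite zh hS; lia | by [] |].
      move=> w xw; case: (eqVneq w x) => [->|ne]; first by lia.
      by have := zw w; rewrite hS; lia.
    + move=> w xw; case: (eqVneq w x) => [->|ne]; first by lia.
      by have := low w; rewrite /= hS; lia.
    + by move: pE; rewrite /= hS; lia.
  rewrite (IH' _ _ _ inv').
    have -> : (through x.+1 - G = 0)%N by rewrite -cE; lia.
    by rewrite Gs; case: ifP => _; rewrite ?mulr0 // sw0 mul1r.
  rewrite Gs (leq_trans sf ff); apply/allP => k ks.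
  by apply: leq_trans (le_s k ks) (leq_trans sf ff).
Qed.

End ScanSteps.

Lemma scan_steps (L : comNzRingType) (t : L) (sw : nat -> nat -> L) N B (al be : seq bool) :
    (forall p, sw p 0 = 1) -> size al = N -> size be = N -> below al be -> (N < B)%N ->
  scan t sw 0 (count2 be - count2 al) [::] al be =
  \sum_(gs <- label_seqs N B |
      `[< forall y, (0 < y <= N)%N -> step_ok N (path_height N be) (depth N al be) (label N gs) y >])
    \prod_(1 <= y < N.+1) step_weight t sw N al be gs y.
Proof.
move=> sw0 sal sbe ab NB; rewrite (scan_sum _ _ _ _ _ (B := B)) ?sal ?sbe // [RHS]big_mkcond.
apply: eq_big_seq => gs; rewrite mem_label_seqs => /andP[/eqP sgs _].
have E s : drop (N - N) s = s :> seq bool by rewrite subnn drop0.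
have Eg s : drop (N - N) s = s :> seq nat by rewrite subnn drop0.
have := @scan_term_steps _ t sw sw0 N al be gs sal sbe sgs ab N 0 (count2 be - count2 al) [::] (leqnn N).
rewrite !E Eg; apply; last first.
  by rewrite /= andbT /fits; have := below_count ab; lia.
split=> //=; [by rewrite throughN /depth !E | | by rewrite subrr].
by move=> w wN; have -> : w = N; lia.
Qed.

Section RegionCoordinates.
Context {N : nat} (a b : word N).
Hypothesis ab : bruhat a b.
Implicit Types (c d : box (N := N)) (x y j : nat).

Local Notation h := (path_height N (rseq b)).
Local Notation f := (depth N (rseq a) (rseq b)).

Lemma heightE (e : word N) x : (x <= N)%N -> height e x = path_height N (rseq e) x.
Proof.
move=> xN; have := ones_drop e xN; rewrite /path_height.
suff : height e x + x%:Z = (2 * ones e x)%N%:Z by lia.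
have -> : x%:Z = \sum_(i < N | (i < x)%N) (1 : int).
  by rewrite -(big_ord_widen N (fun=> 1) xN) sumr_const card_ord natz.
rewrite -big_split /= /ones -sum1_card big_distrr /= -[RHS]natz natr_sum.
rewrite [RHS](eq_bigl (fun i : 'I_N => (i < x)%N && ~~ e i)); last by move=> i; rewrite inE.
by rewrite [RHS]big_mkcondr; apply: eq_bigr => i _; case: (e i).
Qed.

Lemma depthE x : (x <= N)%N -> height a x = h x + (2 * f x)%N%:Z.
Proof.
move=> xN; rewrite heightE // /path_height /depth.
by have /bruhatP/(_ (N - x)%N) := ab; lia.
Qed.

Lemma depth_le x : (x <= N)%N -> (f x <= x)%N.
Proof.
move=> xN; rewrite /depth; apply: leq_trans (leq_subr _ _) _.
by apply: leq_trans (count_size _ _) _; rewrite size_drop size_rseq; lia.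
Qed.

Lemma depth_gt0 x : (0 < f x)%N -> (0 < x)%N.
Proof. by case: x => //; rewrite /depth subn0 !drop_oversize ?size_rseq. Qed.

Lemma height_bound x : (x <= N)%N -> - x%:Z <= h x /\ h x + (2 * f x)%N%:Z <= x%:Z.
Proof.
move=> xN; split.
  rewrite /path_height; have := count_size id (drop (N - x) (rseq b)).
  by rewrite size_drop size_rseq; lia.
by rewrite -depthE // heightE // /path_height; lia.
Qed.

(* Boxes of the column x are numbered 1, 2, ... upwards from the lower path.  *)
Definition layer c : nat := (absz (box_y c - h (box_x c) + 1)%R %/ 2)%N.

Definition cell x j : box (N := N) := (inord x, inord (absz (h x - 1 + (2 * j)%N%:Z + N%:Z)%R)).

Lemma box_x_le c : (box_x c <= N)%N. Proof. by rewrite -ltnS ltn_ord. Qed.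

Lemma box_inj c d : box_x c = box_x d -> box_y c = box_y d -> c = d.
Proof.
case: c => x y; case: d => x' y'; rewrite /box_x /box_y /= => ex ey.
by congr pair; apply: val_inj => //=; lia.
Qed.

Lemma regionE c : (c \in region a b) =
  [&& (0 < box_x c)%N, (0 < layer c <= f (box_x c))%N & box_y c == h (box_x c) - 1 + (2 * layer c)%N%:Z].
Proof.
have xN := box_x_le c.
rewrite !inE (depthE xN) heightE // /layer /is_box.
have := height_bound xN; have : exists n : int, h (box_x c) = (box_x c)%:Z - n * 2.
  by exists (count2 (drop (N - box_x c) (rseq b)))%:Z; rewrite /path_height; lia.
move: (box_x c) (box_y c) xN => x y xN; move: (h x) (f x) => H F [n ->] [h1 h2].
have [x0|x0] := posnP x; first by rewrite x0.
rewrite /=; apply/idP/idP; lia.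
Qed.

Lemma cell_x x j : (x <= N)%N -> box_x (cell x j) = x.
Proof. by move=> xN; rewrite /cell /box_x /= inordK. Qed.

Lemma cell_y x j : (x <= N)%N -> (0 < j <= f x)%N -> box_y (cell x j) = h x - 1 + (2 * j)%N%:Z.
Proof.
move=> xN jf; rewrite /cell /box_y /=; have := height_bound xN; have := depth_le xN => df hb.
by rewrite inordK; lia.
Qed.

Lemma cell_layer x j : (x <= N)%N -> (0 < j <= f x)%N -> layer (cell x j) = j.
Proof. by move=> xN jf; rewrite /layer cell_y // cell_x //; lia. Qed.

Lemma cell_region x j : (x <= N)%N -> (0 < j <= f x)%N -> cell x j \in region a b.
Proof.
move=> xN jf; rewrite regionE cell_layer // cell_x // cell_y // jf eqxx !andbT.
by apply: depth_gt0; lia.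
Qed.

Lemma region_cell c : c \in region a b -> c = cell (box_x c) (layer c).
Proof.
rewrite regionE => /and3P[_ jf /eqP e]; apply: box_inj.
  by rewrite cell_x // box_x_le.
by rewrite cell_y // box_x_le.
Qed.

Lemma just_belowE c d : c \in region a b -> d \in region a b ->
  just_below c d = (box_x c == box_x d) && (layer d == (layer c).+1).
Proof.
rewrite !regionE => /and3P[_ jc /eqP ec] /and3P[_ jd /eqP ed].
rewrite /just_below ec ed; case: eqP => //= ->; apply/idP/idP; lia.
Qed.

Definition segment j x0 x1 : {set box (N := N)} :=
  [set c in region a b | (layer c == j) && (x0 <= box_x c <= x1)%N].

Lemma in_segment j x0 x1 c : (c \in segment j x0 x1) =
  [&& c \in region a b, layer c == j & (x0 <= box_x c <= x1)%N].
Proof. by rewrite inE. Qed.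

Lemma segment_cell j x0 x1 x : (0 < j)%N -> (x0 <= x <= x1)%N -> (x <= N)%N -> (j <= f x)%N ->
  cell x j \in segment j x0 x1.
Proof.
move=> j0 xx xN jf; have jf' : (0 < j <= f x)%N by rewrite j0.
by rewrite inE cell_region // cell_layer // cell_x // eqxx.
Qed.

Lemma path_ballot_x c s : path ballot_step c s ->
  forall i, (i <= size s)%N -> box_x (nth c (c :: s) i) = (box_x c + i)%N.
Proof.
elim: s c => [|d s IH] c /=; first by move=> _ [|//]; rewrite addn0.
move=> /andP[/andP[/eqP cd _] p] [|i] i_s; first by rewrite addn0.
rewrite [nth _ _ _]/= (set_nth_default d) //= IH // cd; lia.
Qed.

Lemma is_strip_segment l l' j x0 x1 : (0 < j)%N -> (0 < x0 <= x1)%N -> (x1 <= N)%N ->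
    (forall x, (x0 <= x <= x1)%N -> (j <= f x)%N) ->
  is_strip l l' (segment j x0 x1) <->
  [/\ forall x, (x0 <= x <= x1)%N -> h x0 <= h x, h x1 = h x0 + l'%:Z
    & (x1 - x0 = 2 * l + l')%N].
Proof.
move=> j0 /andP[x00 x01] x1N jf.
have cellP x : (x0 <= x <= x1)%N -> cell x j \in segment j x0 x1.
  by move=> xx; apply: segment_cell => //; [lia | apply: jf].
have cy x : (x0 <= x <= x1)%N -> box_y (cell x j) = h x - 1 + (2 * j)%N%:Z.
  by move=> xx; rewrite cell_y ?j0 ?jf //; lia.
have cx x : (x0 <= x <= x1)%N -> box_x (cell x j) = x by move=> xx; rewrite cell_x //; lia.
have segE c : c \in segment j x0 x1 -> c = cell (box_x c) j /\ (x0 <= box_x c <= x1)%N.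
  by rewrite inE => /and3P[/region_cell e /eqP <- ->].
split=> [/existsP[c /existsP[s /and4P[pcs alls lasty /eqP segs]]]|[hle h1 xl]].
  have colx := path_ballot_x pcs; rewrite size_tuple in colx.
  have inseg i : (i <= l.*2 + l')%N -> nth c (c :: s) i \in segment j x0 x1.
    by move=> il; rewrite segs inE mem_nth //= size_tuple ltnS.
  have ex x : (x0 <= x <= x1)%N -> exists2 i, (i <= l.*2 + l')%N & cell x j = nth c (c :: s) i.
    move=> xx; have := cellP x xx; rewrite segs inE => hin.
    case: (elimT (nthP c) hin) => i; rewrite /= size_tuple ltnS => il <-.
    by exists i.
  have cE : c = cell x0 j /\ box_x c = x0.
    have [i il ei] := ex x0 ltac:(lia); have := colx i il; rewrite -ei cx ?leqnn // => e.
    have [cc1 cc2] := segE _ (inseg 0%N (leq0n _)); move: cc1 cc2; rewrite /= => cc1 cc2.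
    have bx : box_x c = x0 by lia.
    by rewrite bx in cc1.
  case: cE => cE bx.
  have sz : (x1 = x0 + (l.*2 + l'))%N.
    have [i il ei] := ex x1 ltac:(lia); have := colx i il; rewrite -ei cx ?x01 ?leqnn // => e.
    have [_] := segE _ (inseg (l.*2 + l')%N (leqnn _)); rewrite colx //; lia.
  split.
  - move=> x xx; have := cellP x xx; rewrite segs !inE => /predU1P[e|xs].
      by have := cx x xx; rewrite e bx => <-.
    by have /allP/(_ _ xs) := alls; rewrite {1}cE !cy ?leqnn //; lia.
  - have lc : last c s = cell x1 j.
      have [l1 _] := segE _ (inseg (l.*2 + l')%N (leqnn _)).
      rewrite (last_nth c) size_tuple; move: (colx _ (leqnn (l.*2 + l')%N)) => e.
      by rewrite l1 e bx -sz.
    by move: lasty; rewrite lc {1}cE !cy ?leqnn ?x01 //; lia.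
  - lia.
have stepP x : (x0 <= x < x1)%N -> ballot_step (cell x j) (cell x.+1 j).
  move=> xx; rewrite /ballot_step !cx ?cy; try lia.
  have xN : (x < N)%N by lia.
  rewrite eqxx (path_heightS (size_rseq b) xN) /=.
  by case: (nth _ _ _); apply/orP; [right|left]; apply/eqP; lia.
have pathP n x : (x0 <= x)%N -> (x + n <= x1)%N ->
    path ballot_step (cell x j) [seq cell y j | y <- iota x.+1 n].
  elim: n x => //= n IH x xx xn; rewrite stepP ?IH //=; lia.
pose s := [seq cell y j | y <- iota x0.+1 (x1 - x0)].
have ss : size s == (l.*2 + l')%N by rewrite size_map size_iota xl -mul2n.
have sin c : (c \in s) = (c \in segment j x0.+1 x1).
  apply/mapP/idP => [[x]|].
    rewrite mem_iota => xx ->; apply: segment_cell => //; [lia|lia|apply: jf; lia].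
  move=> cs; have [e cc] : c = cell (box_x c) j /\ (x0.+1 <= box_x c <= x1)%N.
    by move: cs; rewrite inE => /and3P[/region_cell e /eqP <- ->].
  by exists (box_x c) => //; rewrite mem_iota; lia.
apply/existsP; exists (cell x0 j); apply/existsP; exists (Tuple ss); apply/and4P; split.
- by apply: pathP; lia.
- apply/allP => c /=; rewrite sin inE => /and3P[cr /eqP lc cc].
  have ec := region_cell cr; rewrite lc in ec; rewrite ec.
  have := hle (box_x c) ltac:(lia); rewrite !cy; lia.
- have -> : last (cell x0 j) (Tuple ss) = cell x1 j.
    rewrite /= /s; have [e|ne] := eqVneq x0 x1; first by rewrite e subnn.
    have -> : (x1 - x0 = (x1 - x0.+1) + 1)%N by lia.
    rewrite iotaD map_cat last_cat /=; congr (cell _ j); lia.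
  by apply/eqP; rewrite !cy ?leqnn ?x01 //; lia.
- apply/eqP/setP => c; rewrite [RHS]inE in_cons -[c \in tval _]/(c \in s) sin !in_segment; apply/idP/idP.
    move=> /and3P[cr /eqP lc cc]; rewrite cr lc eqxx /=.
    have [e|ne] := eqVneq (box_x c) x0; last by apply/orP; right; lia.
    by rewrite {1}(region_cell cr) lc e eqxx.
  case/orP => [/eqP->|/and3P[-> -> cc]]; last by rewrite /=; lia.
  by have := cellP x0; rewrite leqnn x01 => /(_ isT); rewrite inE.
Qed.

End RegionCoordinates.

Lemma first_below_exists N (h : nat -> int) y z : (y < z <= N)%N -> h z < h y ->
  exists z', first_below N h y z' /\ (z' <= z)%N.
Proof.
move=> yz lt; have ex : exists z, (y < z)%N && (h z < h y) by exists z; rewrite lt andbT; lia.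
case: (ex_minnP ex) => z' /andP[yz' lt'] min.
have z'z : (z' <= z)%N by apply: min; rewrite lt andbT; lia.
exists z'; split=> //; split=> //; first by lia.
move=> w yw; have [->//|ne] := eqVneq w y.
rewrite leNgt; apply/negP => wlt; have := min w; rewrite wlt andbT; lia.
Qed.

Section Runs.
Context (N : nat) (h : nat -> int) (f g : nat -> nat).
Hypothesis h_step : forall x, (x < N)%N -> h x.+1 = h x + 1 \/ h x.+1 = h x - 1.
Hypothesis f0 : f 0 = 0%N.
Implicit Types (x y z w j : nat).

Definition labels_le : Prop :=
  forall y, (0 < y <= N)%N -> (g y <= f y)%N /\ (g y <= f y.-1)%N.

(* A maximal row of connected boxes of layer j.                               *)
Definition is_run j x0 x1 : Prop :=
  [/\ (0 < j)%N, (0 < x0 <= x1)%N /\ (x1 <= N)%N, (j <= f x0)%N /\ (g x0 < j)%N,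
      forall y, (x0 < y <= x1)%N -> (j <= g y)%N
    & (x1 < N)%N -> (g x1.+1 < j)%N].

Definition valid_run x0 x1 : Prop :=
  (forall x, (x0 <= x <= x1)%N -> h x0 <= h x) /\ ((x1 < N)%N -> h x1 = h x0).

Lemma run_depth j x0 x1 : labels_le -> is_run j x0 x1 ->
  forall x, (x0 <= x <= x1)%N -> (j <= f x)%N.
Proof.
move=> gle [j0 [xx x1N] [jf _] jg _] x xb; have [->//|ne] := eqVneq x x0.
by have [gf _] := gle x ltac:(lia); apply: leq_trans gf; apply: jg; lia.
Qed.

Lemma run_exists j x : labels_le -> (0 < j)%N -> (x <= N)%N -> (j <= f x)%N ->
  exists x0 x1, is_run j x0 x1 /\ (x0 <= x <= x1)%N.
Proof.
move=> gle j0 xN jf.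
have [x0 [x00 jf0 gx0 jg0]] : exists x0, [/\ (0 < x0 <= x)%N, (j <= f x0)%N, (g x0 < j)%N
    & forall y, (x0 < y <= x)%N -> (j <= g y)%N].
  elim: x xN jf => [|x IH] xN jf; first by move: jf; rewrite f0; lia.
  have [gj|jg] := ltnP (g x.+1) j.
    by exists x.+1; split=> // [|y]; lia.
  have [_ gf] := gle x.+1 ltac:(lia).
  have [x0 [x00 jf0 gx0 jg0]] := IH (ltnW xN) (leq_trans jg gf).
  exists x0; split=> // [|y yx]; first by lia.
  by have [->//|ne] := eqVneq y x.+1; apply: jg0; lia.
have [x1 [x1x x1N jg1 gx1]] : exists x1, [/\ (x <= x1)%N, (x1 <= N)%N,
    forall y, (x < y <= x1)%N -> (j <= g y)%N & (x1 < N)%N -> (g x1.+1 < j)%N].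
  move: (subnK xN); move: (N - x)%N => k; clear -xN; elim: k x xN => [|k IH] x xN kx.
    by exists x; split=> // [y|]; lia.
  have [gj|jg] := ltnP (g x.+1) j; first by exists x; split=> // y; lia.
  have [x1 [x1x x1N jg1 gx1]] := IH x.+1 ltac:(lia) ltac:(lia).
  exists x1; split=> // [|y yx]; first by lia.
  by have [->//|ne] := eqVneq y x.+1; apply: jg1; lia.
exists x0, x1; split; last by lia.
split=> //; first by lia.
move=> y yx; have [yx'|xy] := leqP y x; [apply: jg0; lia | apply: jg1; lia].
Qed.

Hypothesis steps : forall y, (0 < y <= N)%N -> step_ok N h f g y.

Lemma label_first_below y z w : first_below N h y z -> (y < w <= z)%N -> (g z <= g w)%N.
Proof.
move=> fb; have [yz lt min] := fb.
move En: (z - w)%N => n; elim/ltn_ind: n w En => n IH w En yw.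
have [->//|ne] := eqVneq w z.
have hw : h y <= h w by apply: min; lia.
have [z' [fb' z'z]] := @first_below_exists N h w z ltac:(lia) ltac:(lia).
have [z'w z'lt _] := fb'.
have gz' : (g z <= g z')%N by apply: (IH (z - z')%N) => //; lia.
have [_ dn up _] := steps (y := w) ltac:(lia).
have := @h_step w.-1 ltac:(lia); rewrite prednK; last by lia.
case=> e; first by rewrite (up _ _ fb') //; lia.
by apply: leq_trans gz' (dn _ _ fb'); lia.
Qed.

Lemma label_up y w : (0 < y)%N -> h y.-1 < h y -> (y < w <= N)%N ->
  (forall z, first_below N h y z -> (w <= z)%N) -> (g y <= g w)%N.
Proof.
move=> y0 hy yw wz; have [_ _ up up'] := steps (y := y) ltac:(lia).
have [[z fb]|nz] := pselect (exists z, first_below N h y z).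
  by rewrite (up hy z fb); apply: (label_first_below fb); have := wz z fb; lia.
have [|_] := up' hy; first by move=> z fb; apply: nz; exists z.
by apply.
Qed.

Lemma steps_valid_run j x0 x1 : is_run j x0 x1 -> valid_run x0 x1.
Proof.
move=> [j0 [xx x1N] [jf gx0] jg gx1].
have ballot x : (x0 <= x <= x1)%N -> h x0 <= h x.
  move=> xb; rewrite leNgt; apply/negP => lt.
  have xne : x0 != x by apply: contraTneq lt => ->; rewrite ltxx.
  have [z [fb zx]] := @first_below_exists N h x0 x ltac:(lia) lt.
  have [zz zlt _] := fb; have gz : (j <= g z)%N by apply: jg; lia.
  have [_ dn up _] := steps (y := x0) ltac:(lia).
  have := @h_step x0.-1 ltac:(lia); rewrite prednK; last by lia.
  case=> e; first by have := up _ _ fb; lia.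
  by have := dn _ _ fb; lia.
split=> // x1N'; apply/eqP; rewrite eq_le ballot ?andbT; last by lia.
rewrite leNgt; apply/negP => lt.
have ex : exists u, (x0 <= u <= x1)%N && (h u < h x1) by exists x0; rewrite lt leqnn; lia.
have bd u : (x0 <= u <= x1)%N && (h u < h x1) -> (u <= x1)%N by lia.
case: (ex_maxnP ex bd) => u /andP[ux ult] max {ex bd}.
have une : u != x1 by apply: contraTneq ult => ->; rewrite ltxx.
have after w : (u < w <= x1)%N -> h x1 <= h w.
  by move=> uw; rewrite leNgt; apply/negP => wl; have := max w; rewrite wl andbT; lia.
have hu1 : h u.+1 = h x1 /\ h u < h u.+1.
  by have := after u.+1 ltac:(lia); have := @h_step u ltac:(lia); lia.
have := @label_up u.+1 x1.+1 isT; rewrite /= => /(_ ltac:(lia) ltac:(lia)) H.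
have := gx1 x1N'; have := jg u.+1 ltac:(lia).
suff : (g u.+1 <= g x1.+1)%N by lia.
apply: H => z [zz zlt zmin]; rewrite leqNgt; apply/negP => zx.
by have := after z ltac:(lia); lia.
Qed.

End Runs.

Section RunsSteps.
Context (N : nat) (h : nat -> int) (f g : nat -> nat).
Hypothesis h_step : forall x, (x < N)%N -> h x.+1 = h x + 1 \/ h x.+1 = h x - 1.
Hypotheses (f0 : f 0 = 0%N) (gle : labels_le N f g).
Hypothesis valid : forall j x0 x1, is_run N f g j x0 x1 -> valid_run N h x0 x1.

Lemma valid_label_first y z : (0 < y)%N -> first_below N h y z -> (g z <= g y)%N.
Proof.
move=> y0 [yz lt min]; rewrite leqNgt; apply/negP => gyz.
have [gf _] := gle (y := z) ltac:(lia).
have [x0 [x1 [run xz]]] := run_exists f0 gle (j := g z) (x := z) ltac:(lia) ltac:(lia) gf.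
have [ballot _] := valid run; have [_ [xx x1N] [_ gx0] jg _] := run.
have x0z : x0 != z by apply: contraTneq gx0 => ->; rewrite ltnn.
have yx0 : (y <= x0)%N by rewrite leqNgt; apply/negP => lt0; have := jg y ltac:(lia); lia.
by have := min x0 ltac:(lia); have := ballot z xz; lia.
Qed.

Lemma valid_label_up y w : (0 < y)%N -> h y.-1 < h y -> (y < w <= N)%N ->
  (forall u, (y <= u < w)%N -> h y <= h u) -> (g y <= g w)%N.
Proof.
move=> y0 hy yw min; rewrite leqNgt; apply/negP => gwy.
have [gf _] := gle (y := y) ltac:(lia).
have [x0 [x1 [run xy]]] := run_exists f0 gle (j := g y) (x := y) ltac:(lia) ltac:(lia) gf.
have [ballot closed] := valid run; have [_ [xx x1N] [_ gx0] jg _] := run.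
have x0y : x0 != y by apply: contraTneq gx0 => ->; rewrite ltnn.
have x1w : (x1 < w)%N by rewrite ltnNge; apply/negP => wx; have := jg w ltac:(lia); lia.
have := closed ltac:(lia); have := ballot y.-1 ltac:(lia); have := min x1 ltac:(lia).
lia.
Qed.

Lemma valid_steps y : (0 < y <= N)%N -> step_ok N h f g y.
Proof.
move=> yN; have y0 : (0 < y)%N by lia.
split; first exact: gle.
- by move=> _ z; apply: valid_label_first.
- move=> hy z fb; apply/eqP; rewrite eqn_leq; apply/andP; split; last exact: valid_label_first.
  by have [yz _ min] := fb; apply: valid_label_up.
- move=> hy nz; have all_ge u : (y <= u <= N)%N -> h y <= h u.
    move=> yu; rewrite leNgt; apply/negP => lt.
    have ne : y != u by apply: contraTneq lt => ->; rewrite ltxx.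
    by have [z [/nz]] := @first_below_exists N h y u ltac:(lia) lt.
  have gw w : (y < w <= N)%N -> (g y <= g w)%N.
    by move=> yw; apply: valid_label_up => // u yu; apply: all_ge; lia.
  split=> //; have [->|ne] := eqVneq y N; first by have [] := gle (y := N) ltac:(lia).
  by apply: leq_trans (gw N _) _; [lia | have [] := gle (y := N) ltac:(lia)].
Qed.

End RunsSteps.

Section Breaks.
Context (g : nat -> nat).
Implicit Types (x y j : nat).

Definition breaks j x : nat := (\sum_(1 <= y < x.+1) (g y < j))%N.

Lemma breaksS j x : breaks j x.+1 = (breaks j x + (g x.+1 < j))%N.
Proof. by rewrite /breaks big_nat_recr. Qed.

Lemma breaks_eq j x x' : (x <= x')%N ->
  breaks j x = breaks j x' <-> forall y, (x < y <= x')%N -> (j <= g y)%N.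
Proof.
move=> xx; rewrite -(subnKC xx); move: (x' - x)%N => k {xx}.
elim: k => [|k IH]; first by rewrite addn0; split=> // _ y; lia.
have mono : (breaks j x <= breaks j (x + k))%N.
  by clear IH; elim: k => [|k IH]; rewrite ?addn0 // addnS breaksS; lia.
rewrite addnS breaksS; split=> [e|jg].
  have gj : (j <= g (x + k).+1)%N by rewrite leqNgt; apply/negP => lt; rewrite lt in e; lia.
  move=> y yx; have [->//|ne] := eqVneq y (x + k).+1.
  by apply: (proj1 IH) => //; lia.
have -> : (g (x + k).+1 < j)%N = false by have := jg (x + k).+1 ltac:(lia); lia.
by rewrite addn0; apply/IH => y yx; apply: jg; lia.
Qed.

End Breaks.

Section Blocks.
Context {N : nat} (a b : word N).
Hypothesis ab : bruhat a b.
Context (g : nat -> nat).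
Local Notation h := (path_height N (rseq b)).
Local Notation f := (depth N (rseq a) (rseq b)).
Local Notation layer := (layer b).
Local Notation cell := (cell b).
Local Notation segment := (segment a b).
Local Notation region := (region a b).
Local Notation is_run := (is_run N f g).
Local Notation valid_run := (valid_run N h).
Hypothesis gle : labels_le N f g.
Implicit Types (c d : box (N := N)) (D : {set box (N := N)}) (x y j l : nat).

Lemma depth0 : f 0 = 0%N.
Proof. by have := @depth_gt0 N a b 0; lia. Qed.

Lemma path_height_step x : (x < N)%N -> h x.+1 = h x + 1 \/ h x.+1 = h x - 1.
Proof.
by move=> xN; rewrite (path_heightS (size_rseq b) xN); case: nth; [right|left].
Qed.

Definition block_key c : nat * nat := (layer c, breaks g (layer c) (box_x c)).

Definition blocks : {set {set box (N := N)}} := preim_partition block_key region.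

Lemma run_block j x0 x1 x : is_run j x0 x1 -> (x0 <= x <= x1)%N ->
  segment j x0 x1 = [set d in region | block_key (cell x j) == block_key d].
Proof.
move=> run xx; have [j0 [x00 x1N] [jf gx0] jg gx1] := run.
have xf := run_depth depth0 gle run xx.
have xN : (x <= N)%N by lia.
have jx : (0 < j <= f x)%N by rewrite j0.
apply/setP => d; rewrite in_segment [in RHS]inE; case dr: (d \in region) => //=.
rewrite /block_key (cell_layer ab) // cell_x // xpair_eqE eq_sym.
case: eqP => //= ld; rewrite -ld; apply/idP/eqP => [dx|e].
  have [xd|dx'] := leqP x (box_x d); [|symmetry]; apply/breaks_eq => //; try lia;
  by move=> y yx; apply: jg; lia.
rewrite leqNgt; apply/andP; split.
  apply/negP => lt; have := (proj1 (breaks_eq g j (ltac:(lia) : (box_x d <= x)%N))) (esym e) x0 ltac:(lia).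
  by lia.
rewrite leqNgt; apply/negP => lt; have dN := box_x_le d.
have := (proj1 (breaks_eq g j (ltac:(lia) : (x <= box_x d)%N))) e x1.+1 ltac:(lia).
by have := gx1 ltac:(lia); lia.
Qed.

Lemma mem_blocks D : D \in blocks <-> exists j x0 x1, is_run j x0 x1 /\ D = segment j x0 x1.
Proof.
split=> [/imsetP[c cr ->]|[j [x0 [x1 [run ->]]]]].
  have cE := region_cell ab cr; move: (cr); rewrite (regionE ab) => /and3P[_ /andP[l0 lf] _].
  have [x0 [x1 [run xx]]] := run_exists depth0 gle l0 (box_x_le c) lf.
  exists (layer c), x0, x1; split=> //; rewrite (run_block run xx) -cE.
  by apply/setP => d; rewrite !inE.
have [j0 [xx x1N] [jf _] _ _] := run.
have cr : cell x0 j \in region by apply: (cell_region ab); rewrite ?j0 //; lia.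
apply/imsetP; exists (cell x0 j) => //.
by rewrite (run_block (x := x0) run) //; lia.
Qed.

Lemma run_strip l l' j x0 x1 : is_run j x0 x1 ->
  is_strip l l' (segment j x0 x1) <->
  [/\ forall x, (x0 <= x <= x1)%N -> h x0 <= h x, h x1 = h x0 + l'%:Z
    & (x1 - x0 = 2 * l + l')%N].
Proof.
move=> run; have [j0 [xx x1N] _ _ _] := run.
by apply: (is_strip_segment ab) => //; exact: (run_depth depth0 gle run).
Qed.

Lemma run_strip_length l l' j x0 x1 : is_run j x0 x1 ->
  is_strip l l' (segment j x0 x1) -> strip_length (segment j x0 x1) = (l, l').
Proof.
move=> run st; have [_ h1 xl] := proj1 (run_strip _ _ run) st.
have [_ [xx x1N] _ _ _] := run.
rewrite /strip_length; case: pickP => [[[p1 q1] [p2 q2]] /(proj1 (run_strip _ _ run))[_ h1' xl']|none].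
  by move: h1' xl' => /= h1' xl'; congr pair; lia.
have lN : (l < N.+1)%N by lia.
have lN' : (l' < N.+1)%N by lia.
by have := none (Ordinal lN, Ordinal lN'); rewrite /= st.
Qed.

Lemma valid_run_strip j x0 x1 : is_run j x0 x1 -> valid_run x0 x1 ->
  exists l l', [/\ is_strip l l' (segment j x0 x1), h x1 = h x0 + l'%:Z,
    (x1 - x0 = 2 * l + l')%N & (x1 < N)%N -> l' = 0%N].
Proof.
move=> run [ballot closed]; have [_ [xx x1N] _ _ _] := run.
have hx := ballot x1 ltac:(lia).
have : exists n : nat, h x1 = h x0 + (x1 - x0)%N%:Z - (2 * n)%N%:Z.
  have sub : exists r, drop (N - x1) (rseq b) = r ++ drop (N - x0) (rseq b).
    exists (take (x1 - x0) (drop (N - x1) (rseq b))).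
    rewrite -[LHS](cat_take_drop (x1 - x0)); congr (_ ++ _).
    by rewrite drop_drop; congr (drop _ _); lia.
  have [r e] := sub; exists (count2 r).
  by rewrite /path_height e count_cat; lia.
move=> [n en]; exists n, (x1 - x0 - 2 * n)%N.
have e1 : h x1 = h x0 + (x1 - x0 - 2 * n)%N%:Z by lia.
have e2 : (x1 - x0 = 2 * n + (x1 - x0 - 2 * n))%N by lia.
split=> //; first by apply/run_strip.
by move=> /closed; lia.
Qed.

Lemma blocks_ruleIa : ruleIa blocks.
Proof.
apply/forall_inP => D /mem_blocks[j [x0 [x1 [run ->]]]].
apply/forall_inP => D' /mem_blocks[j' [x0' [x1' [run' ->]]]].
apply/implyP => /exists_inP[c cD /exists_inP[c' cD' cc]].
have [j0 [xx x1N] [jf gx0] jg gx1] := run; have [j0' [xx' x1N'] [jf' gx0'] jg' gx1'] := run'.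
move: cD cD'; rewrite !in_segment => /and3P[cr /eqP lc xc] /and3P[cr' /eqP lc' xc'].
move: cc; rewrite (just_belowE ab cr cr') lc lc' => /andP[/eqP exc /eqP ej].
apply/forall_inP => d; rewrite in_segment => /and3P[dr /eqP ld xd].
have dN := box_x_le d.
have xd' : (x0 <= box_x d <= x1)%N.
  apply/andP; split; rewrite leqNgt; apply/negP => lt.
    by have := jg' x0 ltac:(lia); lia.
  by have := jg' x1.+1 ltac:(lia); have := gx1 ltac:(lia); lia.
have jd : (0 < j <= f (box_x d))%N by rewrite j0 (run_depth depth0 gle run).
apply/exists_inP; exists (cell (box_x d) j); first by apply: (segment_cell ab) => //; lia.
by rewrite (just_belowE ab (cell_region ab dN jd) dr) cell_x // (cell_layer ab) // eqxx ld ej /=.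
Qed.

Lemma blocks_strips_rule0 :
  ([forall D in blocks, ballot_strip D] && rule0 blocks) <->
  forall j x0 x1, is_run j x0 x1 -> valid_run x0 x1.
Proof.
split=> [/andP[/forall_inP strips /forall_inP r0] j x0 x1 run|valid].
  have DP : segment j x0 x1 \in blocks by apply/mem_blocks; exists j, x0, x1.
  have /existsP[[l l'] /= st] := strips _ DP.
  have [ballot h1 xl] := proj1 (run_strip _ _ run) st.
  have sl := run_strip_length run st.
  have [j0 [xx x1N] [jf gx0] jg gx1] := run.
  split=> // x1N'; have [e|l'0] := posnP l'; first by rewrite h1 e addr0.
  have := r0 _ DP; rewrite sl l'0 => /forall_inP/(_ (cell x1 j)).
  have x1D : cell x1 j \in segment j x0 x1.
    by apply: (segment_cell ab) => //; [lia | apply: (run_depth depth0 gle run); lia].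
  move=> /(_ x1D)/implyP H; have : anchor (cell x1 j).
    by apply: H; apply/forall_inP => d; rewrite in_segment cell_x // => /and3P[_ _ /andP[]].
  by rewrite /anchor cell_x //; lia.
apply/andP; split; apply/forall_inP => D /mem_blocks[j [x0 [x1 [run ->]]]];
  have [l [l' [st h1 xl cl]]] := valid_run_strip run (valid _ _ _ run);
  have [j0 [xx x1N] [jf gx0] jg gx1] := run.
  have lN : (l < N.+1)%N by lia.
  have lN' : (l' < N.+1)%N by lia.
  by apply/existsP; exists (Ordinal lN, Ordinal lN').
rewrite (run_strip_length run st) /=; apply/implyP => l'0.
have x1E : x1 = N by apply/eqP; rewrite eqn_leq x1N leqNgt; apply/negP => /cl; lia.
apply/forall_inP => c cD; apply/implyP => /forall_inP/(_ (cell x1 j)).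
rewrite (segment_cell ab) //; [|lia|by apply: (run_depth depth0 gle run); lia].
by move=> /(_ isT); rewrite cell_x // x1E /anchor eqn_leq box_x_le => ->.
Qed.

End Blocks.

Section PartitionLabels.
Context {N : nat} (a b : word N).
Hypothesis ab : bruhat a b.
Local Notation h := (path_height N (rseq b)).
Local Notation f := (depth N (rseq a) (rseq b)).
Local Notation layer := (layer b).
Local Notation cell := (cell b).
Local Notation region := (region a b).
Implicit Types (c d : box (N := N)) (D : {set box (N := N)}) (x y j l : nat).

Lemma strip_contiguous l l' D c d x : is_strip l l' D -> c \in D -> d \in D ->
  (box_x c <= x <= box_x d)%N -> exists2 e, e \in D & box_x e = x.
Proof.
move=> /existsP[c0 /existsP[s /and4P[pcs _ _ /eqP ->]]].
have colx := path_ballot_x ab pcs; rewrite size_tuple in colx.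
rewrite 2!in_set => hc hd.
case: (elimT (nthP c0) hc) => i; rewrite /= size_tuple ltnS => il <-.
case: (elimT (nthP c0) hd) => k; rewrite /= size_tuple ltnS => kl <-; rewrite !colx // => xx.
exists (nth c0 (c0 :: s) (x - box_x c0)); last by rewrite colx; lia.
by rewrite in_set mem_nth //= size_tuple; lia.
Qed.

Context (P : {set {set box (N := N)}}).
Hypothesis partP : partition P region.
Hypothesis stripP : forall D, D \in P -> ballot_strip D.
Hypothesis ruleP : ruleIa P.

Lemma part_block c : c \in region -> pblock P c \in P /\ c \in pblock P c.
Proof.
by move=> cr; rewrite pblock_mem ?mem_pblock (cover_partition partP).
Qed.

Lemma part_pblock D c : D \in P -> c \in D -> pblock P c = D.
Proof. by move=> DP cD; apply: def_pblock DP cD; have /and3P[] := partP. Qed.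

Lemma part_region D c : D \in P -> c \in D -> c \in region.
Proof. by move=> DP cD; rewrite -(cover_partition partP); apply/bigcupP; exists D. Qed.

Lemma part_below D c d j : D \in P -> c \in D -> d \in D -> layer c = j.+1 -> (0 < j)%N ->
  (layer d = (layer (cell (box_x d) (layer d).-1)).+1) /\
  (cell (box_x d) (layer d).-1 \in pblock P (cell (box_x c) j)) /\ (1 < layer d)%N.
Proof.
move=> DP cD dD lc j0; have cr := part_region DP cD; have dr := part_region DP dD.
have cN := box_x_le c; have := cr; rewrite (regionE ab) lc => /and3P[_ jf _].
have jf' : (0 < j <= f (box_x c))%N by lia.
have br := cell_region ab cN jf'; have [BP bB] := part_block br.
have /forall_inP/(_ _ BP)/forall_inP/(_ _ DP)/implyP := ruleP.
have ex : [exists c0 in pblock P (cell (box_x c) j), exists c' in D, just_below c0 c'].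
  apply/exists_inP; exists (cell (box_x c) j) => //; apply/exists_inP; exists c => //.
  by rewrite (just_belowE ab br cr) cell_x // (cell_layer ab) // eqxx lc eqxx.
move=> /(_ ex)/forall_inP/(_ d dD)/exists_inP[e eB].
have er := part_region BP eB; rewrite (just_belowE ab er dr) => /andP[/eqP exd /eqP ld].
have eE := region_cell ab er; have := er; rewrite (regionE ab) => /and3P[_ l0 _].
have -> : cell (box_x d) (layer d).-1 = e by rewrite -exd ld /= -eE.
by split; [|split; [|rewrite ld ltnS; case/andP: l0]].
Qed.

Lemma part_layer D c d : D \in P -> c \in D -> d \in D -> layer c = layer d.
Proof.
move En: (layer c) => n; elim: n D c d En => [|n IH] D c d lc DP cD dD.
  by have := part_region DP cD; rewrite (regionE ab) lc => /and3P[].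
have [n0|n0] := posnP n.
  have dr := part_region DP dD; have := dr; rewrite (regionE ab) => /and3P[_ l0 _].
  have [ld|ld] := leqP (layer d) 1; first by lia.
  have [] := @part_below D d c (layer d).-1 DP dD cD ltac:(lia) ltac:(lia).
  by rewrite lc n0; lia.
have [e1 [e2 e3]] := part_below DP cD dD lc n0.
have cr := part_region DP cD; have cN := box_x_le c.
have := cr; rewrite (regionE ab) lc => /and3P[_ jf _].
have jf' : (0 < n <= f (box_x c))%N by lia.
have br := cell_region ab cN jf'; have [BP bB] := part_block br.
by rewrite e1 -(IH _ _ _ _ BP bB e2) // (cell_layer ab).
Qed.

Definition connected y j : bool :=
  [&& (0 < j)%N, (j <= f y)%N, (j <= f y.-1)%N & pblock P (cell y.-1 j) == pblock P (cell y j)].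

Lemma connected_below y j : (0 < y <= N)%N -> (0 < j)%N -> connected y j.+1 -> connected y j.
Proof.
move=> yN j0 /and4P[_ jf jf' /eqP e].
have y1N : (y.-1 <= N)%N by lia.
have yN' : (y <= N)%N by lia.
have r1 : cell y.-1 j.+1 \in region by apply: (cell_region ab).
have r2 : cell y j.+1 \in region by apply: (cell_region ab).
have [DP D2] := part_block r2; have [_ D1] := part_block r1; rewrite e in D1.
have l2 : layer (cell y j.+1) = j.+1 by rewrite (cell_layer ab).
have [_ [inB _]] := part_below DP D2 D1 l2 j0.
rewrite (cell_layer ab) // !cell_x //= in inB.
have r3 : cell y j \in region by apply: (cell_region ab) => //; lia.
have [BP _] := part_block r3.
by apply/and4P; split; [|apply: ltnW|apply: ltnW|rewrite (part_pblock BP inB)].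
Qed.

Definition part_label y : nat := (\max_(j < N.+1 | connected y j) j)%N.

Lemma part_labelP y j : (0 < y <= N)%N -> (0 < j)%N -> (j <= part_label y)%N <-> connected y j.
Proof.
move=> yN j0; split=> [jg|cj]; last first.
  have jN : (j < N.+1)%N.
    by have /and4P[_ jf _ _] := cj; have := @depth_le N a b ab y; lia.
  exact: (leq_bigmax_cond (Ordinal jN)).
have [/existsP[i /andP[ci ji]]|/existsPn no] := boolP [exists i : 'I_N.+1, connected y i && (j <= i)%N]; last first.
  suff : (part_label y <= j.-1)%N by lia.
  by apply/bigmax_leqP => i ci; have := no i; rewrite ci /=; lia.
move: (nat_of_ord i) ci ji => {i} i ci; move/subnK; move: (i - j)%N => k e.
move: ci; rewrite -e addnC; elim: k {e} => [|k IH]; first by rewrite addn0.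
by rewrite addnS => /connected_below-/(_ yN ltac:(lia)).
Qed.

Lemma part_labels_le : labels_le N f part_label.
Proof.
by move=> y yN; split; apply/bigmax_leqP => j /and4P[].
Qed.

Lemma connected_chain x k j : (x + k <= N)%N ->
    (forall y, (x < y <= x + k)%N -> connected y j) ->
  pblock P (cell x j) = pblock P (cell (x + k) j).
Proof.
elim: k => [|k IH] xN cy; first by rewrite addn0.
rewrite IH; [|lia|by move=> y yx; apply: cy; lia].
by have /and4P[_ _ _ /eqP] := cy (x + k).+1 ltac:(lia); rewrite addnS.
Qed.

Lemma part_key c d : c \in region -> d \in region ->
  (pblock P c == pblock P d) = (block_key b part_label c == block_key b part_label d).
Proof.
wlog le : c d / (box_x c <= box_x d)%N.
  move=> W cr dr; have [le|/ltnW le] := leqP (box_x c) (box_x d); first exact: W.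
  by rewrite eq_sym [RHS]eq_sym; apply: W.
move=> cr dr; have cN := box_x_le c; have dN := box_x_le d.
have := cr; rewrite (regionE ab) => /and3P[c0 lc _]; have := dr; rewrite (regionE ab) => /and3P[d0 ld _].
rewrite /block_key xpair_eqE; apply/eqP/andP => [e|[/eqP el /eqP eb]].
  have [DP cD] := part_block cr; have [_ dD] := part_block dr; rewrite -e in dD.
  have el := part_layer DP cD dD; rewrite -el eqxx; split=> //; apply/eqP/breaks_eq => // y yx.
  have y1 : (0 < y <= N)%N by lia.
  have /existsP[p st] := stripP DP.
  have inD x : (box_x c <= x <= box_x d)%N -> cell x (layer c) \in pblock P c /\ (layer c <= f x)%N.
    move=> xx; have [e' eD ex] := strip_contiguous st cD dD xx.
    have er := part_region DP eD; have := er; rewrite (regionE ab) => /and3P[_ le' _].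
    rewrite (part_layer DP cD eD) -ex -(region_cell ab er); split=> //; lia.
  have [i1 f1] := inD y ltac:(lia); have [i2 f2] := inD y.-1 ltac:(lia).
  apply/part_labelP; [by [] | by case/andP: lc |].
  by rewrite /connected f1 f2 (part_pblock DP i1) (part_pblock DP i2) eqxx; lia.
rewrite (region_cell ab cr) (region_cell ab dr) -el -(subnKC le).
apply: connected_chain; first by rewrite subnKC.
rewrite subnKC // => y yx; apply/part_labelP; [lia | by case/andP: lc |].
by move: y yx; apply/breaks_eq => //; rewrite el in eb *.
Qed.

Lemma part_blocks : P = blocks a b part_label.
Proof.
rewrite -[LHS](preim_partition_pblock partP) /blocks /preim_partition /equivalence_partition.
apply: eq_in_imset => c cr; apply/setP => d; rewrite in_set [RHS]in_set.
by case dr: (d \in region) => //=; rewrite part_key.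
Qed.

End PartitionLabels.

Section LabelsOfBlocks.
Context {N : nat} (a b : word N).
Hypothesis ab : bruhat a b.
Local Notation f := (depth N (rseq a) (rseq b)).
Local Notation cell := (cell b).
Local Notation region := (region a b).

Lemma blocks_eq_key g g' : blocks a b g = blocks a b g' ->
  forall c d, c \in region -> d \in region ->
  block_key b g c = block_key b g d -> block_key b g' c = block_key b g' d.
Proof.
move=> e c d cr dr ecd.
have : [set d in region | block_key b g c == block_key b g d] \in blocks a b g'.
  rewrite -e; apply/imsetP; exists c => //; by apply/setP => z; rewrite !in_set.
move=> /imsetP[c0 _ E].
have : c \in [set d in region | block_key b g c == block_key b g d] by rewrite in_set cr eqxx.
have : d \in [set d in region | block_key b g c == block_key b g d] by rewrite in_set dr ecd eqxx.
by rewrite E !in_set => /andP[_ /eqP <-] /andP[_ /eqP <-].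
Qed.

Lemma blocks_label_le g g' : labels_le N f g -> blocks a b g = blocks a b g' ->
  forall y, (0 < y <= N)%N -> (g y <= g' y)%N.
Proof.
move=> gle e y yN; rewrite leqNgt; apply/negP => lt.
have [g1 g2] := gle y yN; set j := g y in lt g1 g2.
have y1N : (y.-1 <= N)%N by lia.
have yN' : (y <= N)%N by lia.
have j1 : (0 < j <= f y)%N by lia.
have j2 : (0 < j <= f y.-1)%N by lia.
have := blocks_eq_key e (cell_region ab y1N j2) (cell_region ab yN' j1).
rewrite /block_key !(cell_layer ab) // !cell_x //.
have -> : breaks g j y.-1 = breaks g j y.
  by apply/breaks_eq => [|z zy]; [lia | have -> : z = y by lia].
move=> /(_ erefl)[e']; have := proj1 (breaks_eq g' j (leq_pred y)) e' y ltac:(lia); lia.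
Qed.

Lemma blocks_label_inj g g' : labels_le N f g -> labels_le N f g' ->
  blocks a b g = blocks a b g' -> forall y, (0 < y <= N)%N -> g y = g' y.
Proof.
move=> gle gle' e y yN; apply/eqP; rewrite eqn_leq.
by apply/andP; split; [apply: blocks_label_le gle e _ yN | apply: blocks_label_le gle' (esym e) _ yN].
Qed.

Lemma eq_blocks g g' : (forall y, (0 < y <= N)%N -> g y = g' y) -> blocks a b g = blocks a b g'.
Proof.
move=> gg; apply: eq_in_imset => c _; apply/setP => d; rewrite in_set [RHS]in_set.
have E e : block_key b g e = block_key b g' e.
  congr pair; rewrite /breaks; apply: eq_big_nat => y yx; rewrite gg //.
  by have := box_x_le e; lia.
by rewrite /= !E.
Qed.

End LabelsOfBlocks.

Lemma mul_unit_cancel (R : comNzRingType) (x y z w : R) :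
  x * y = 1 -> - (z * w) = x * z * - (y * w).
Proof. by move=> xy; ring: xy. Qed.

Definition parity_ok X p n : bool :=
  if X is CaseB m then (m <= p)%N ==> (if odd (p - m) then n == 0%N else ~~ odd n) else true.

Section ExtraWeight.
Context (K : comNzRingType) (X : kl_case).
Local Notation L := (laurent K (expo X)).

Definition extra_weight p : L :=
  match X return L with
  | CaseA => if odd p then - (var_tV K X * var_tN K X ^+ 2) else 1
  | CaseB m => if (p < m)%N then var_t K X ^+ p
               else if odd (p - m) then var_t K X ^+ m.-1 else var_t K X ^+ m
  end.

End ExtraWeight.

Section ExtraWeightTheory.
Context (K : comNzRingType) (X : kl_case).
Hypothesis okX : kl_case_ok X.

Lemma sw_extra p n : sw K X p n = if parity_ok X p n then extra_weight K X p ^+ n else 0.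
Proof.
case: X => [|m]; rewrite /sw /extra_weight /parity_ok.
  by case: odd; [|rewrite expr1n].
rewrite /swB ltnNge; case: leqP => /= mp; last by rewrite exprM.
case: odd; first by case: eqP => [->|_]; rewrite ?expr0.
by case: odd; rewrite /= ?mul0r ?mul1r ?exprM.
Qed.

Lemma extra_weight0 : extra_weight K X 0 = 1.
Proof. by move: okX; case: X => [|m] //= m0; rewrite /extra_weight m0 expr0. Qed.

Lemma strip_weight_extra l l' :
  strip_weight K X (l, l') = var_t K X ^+ (2 * l + l') * extra_weight K X l'.
Proof.
move: okX; have := var_tK (K := K) X; case: X => [|m] tK okX'; rewrite /strip_weight /extra_weight.
  case: ifP => ol; last by rewrite mulr1 mono_natmul.
  rewrite monoD !mono_natmul -/(var_t K CaseA) -/(var_tN K CaseA).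
  have -> : (2 * l + l' = (2 * l + l' - 1).+1)%N by lia.
  by rewrite [in RHS]exprS subSS subn0; apply: mul_unit_cancel.
rewrite !mono_natmul -/(var_t K (CaseB m)).
by case: ifP => lm; last case: ifP => om; rewrite -exprD; congr (_ ^+ _); move: okX' => /=; lia.
Qed.

End ExtraWeightTheory.

Lemma prod_levels (L : comNzRingType) (u v : L) n A B :
  \prod_(j < n) (if (j < A)%N then u else if (j < B)%N then v else 1) =
  u ^+ minn A n * v ^+ (minn B n - A).
Proof.
elim: n => [|n IH]; first by rewrite big_ord0 !minn0 sub0n !expr0 mulr1.
rewrite big_ord_recr /= IH; case nA: (n < A)%N.
  have -> : minn A n = n by lia.
  have -> : minn A n.+1 = n.+1 by lia.
  have -> : (minn B n - A = 0)%N by lia.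
  have -> : (minn B n.+1 - A = 0)%N by lia.
  by rewrite !expr0 !mulr1 exprSr.
have -> : minn A n = A by lia.
have -> : minn A n.+1 = A by lia.
case nB: (n < B)%N; last first.
  by rewrite mulr1; congr (_ * _ ^+ _); lia.
have -> : (minn B n.+1 - A = (minn B n - A).+1)%N by lia.
by rewrite exprSr mulrA.
Qed.

Section BlockWeights.
Context (K : comNzRingType) (X : kl_case) {N : nat} (a b : word N).
Hypotheses (okX : kl_case_ok X) (ab : bruhat a b).
Context (g : nat -> nat).
Local Notation h := (path_height N (rseq b)).
Local Notation f := (depth N (rseq a) (rseq b)).
Local Notation layer := (layer b).
Local Notation cell := (cell b).
Local Notation segment := (segment a b).
Local Notation region := (region a b).
Local Notation is_run := (is_run N f g).
Local Notation valid_run := (valid_run N h).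
Local Notation blocks := (blocks a b g).
Local Notation through := (through N f g).
Local Notation t := (var_t K X).
Hypothesis gle : labels_le N f g.
Hypothesis valid : forall j x0 x1, is_run j x0 x1 -> valid_run x0 x1.
Implicit Types (c d : box (N := N)) (D : {set box (N := N)}) (x y j l : nat).

Let run_f j x0 x1 x : is_run j x0 x1 -> (x0 <= x <= x1)%N -> (j <= f x)%N.
Proof. by move=> run; apply: (run_depth _ gle run); apply: depth0. Qed.

Definition box_weight c : laurent K (expo X) :=
  if (layer c <= g (box_x c))%N then t
  else if (layer c <= through (box_x c))%N then extra_weight K X `|h N - h (box_x c)|%N else 1.

Lemma prod_segment (F : box -> laurent K (expo X)) j x0 x1 : is_run j x0 x1 ->
  \prod_(c in segment j x0 x1) F c = \prod_(x0 <= x < x1.+1) F (cell x j).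
Proof.
move=> run; have [j0 [xx x1N] _ _ _] := run.
have -> : segment j x0 x1 = [set cell x j | x : 'I_N.+1 in [pred x : 'I_N.+1 | (x0 <= x <= x1)%N]].
  apply/setP => c; apply/idP/imsetP => [|[x]].
    rewrite in_segment => /and3P[cr /eqP <- cx]; exists c.1 => //; exact: (region_cell ab cr).
  rewrite inE => xb ->; apply: (segment_cell ab) => //; [by rewrite -ltnS | exact: (run_f run xb)].
rewrite big_imset => [|x y /= _ _ e]; last first.
  apply: val_inj => /=; have := congr1 (@box_x N) e.
  by rewrite !cell_x // -ltnS.
rewrite (big_nat_widen _ _ N.+1) // (big_nat_widenl _ 0) // big_mkord /=.
by apply: eq_bigl => x; rewrite inE ltnS andbC.
Qed.

Lemma run_through j x0 x1 : is_run j x0 x1 -> (j <= through x0)%N = (x1 == N).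
Proof.
move=> run; have [j0 [xx x1N] [jf gx0] jg gx1] := run.
apply/idP/eqP => [|e].
  move=> /leq_through[]; first by lia.
  move=> _ jw; apply/eqP; rewrite eqn_leq x1N leqNgt; apply/negP => lt.
  by have := jw x1.+1 ltac:(lia); have := gx1 lt; lia.
apply/leq_through; first by lia.
split=> [|w ww]; last by apply: jg; lia.
have : (j <= f x1)%N by apply: (run_f run); lia.
by rewrite e.
Qed.

Lemma run_weight j x0 x1 : is_run j x0 x1 ->
  strip_weight K X (strip_length (segment j x0 x1)) = \prod_(c in segment j x0 x1) box_weight c.
Proof.
move=> run; have [l [l' [st h1 xl cl]]] := valid_run_strip ab gle run (valid run).
have [j0 [xx x1N] [jf gx0] jg gx1] := run.
rewrite (run_strip_length ab gle run st) (strip_weight_extra K okX) prod_segment // big_ltn; last by lia.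
have jf' x : (x0 <= x <= x1)%N -> (0 < j <= f x)%N by move=> /(run_f run) ->; rewrite j0.
have -> : \prod_(x0.+1 <= x < x1.+1) box_weight (cell x j) = \prod_(x0.+1 <= x < x1.+1) t.
  apply: eq_big_nat => x xb; have jx := jf' x ltac:(lia); have xN : (x <= N)%N by lia.
  by rewrite /box_weight cell_x // (cell_layer ab) // jg //; lia.
rewrite prodr_const_nat subSS xl mulrC; congr (_ * _).
have jx0 := jf' x0 ltac:(lia); have x0N : (x0 <= N)%N by lia.
rewrite /box_weight cell_x // (cell_layer ab) //.
rewrite leqNgt gx0 /= (run_through run); case: eqP => [e|ne].
  by congr (extra_weight _ _ _); rewrite e in h1; lia.
by rewrite cl ?(extra_weight0 K okX) //; lia.
Qed.

Lemma through_le x : (x <= N)%N -> (through x <= f x)%N.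
Proof.
move=> xN; have [_ H] : (through x <= f N)%N /\ forall w, (x < w <= N)%N -> (through x <= g w)%N.
  exact/leq_through.
have [->|ne] := eqVneq x N; first by rewrite throughN.
have [_ gf] := gle (y := x.+1) ltac:(lia).
by apply: leq_trans gf; apply: H; lia.
Qed.

Lemma prod_column (x : 'I_N.+1) : (0 < x)%N ->
  \prod_(c in region | c.1 == x) box_weight c =
  t ^+ g x * extra_weight K X `|h N - h x|%N ^+ (through x - g x).
Proof.
move=> x0; have xN : (x <= N)%N by rewrite -ltnS.
transitivity (\prod_(c in [set cell x j.+1 | j : 'I_(f x)]) box_weight c).
  apply: eq_bigl => c; apply/andP/imsetP => [[cr /eqP cx]|[j _ ->]].
    have := cr; rewrite (regionE ab) => /and3P[_ /andP[l0 lf] _].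
    have ex : box_x c = x by rewrite -cx.
    have lf' : ((layer c).-1 < f x)%N by rewrite -ex prednK.
    by exists (Ordinal lf') => //=; rewrite prednK // -ex; apply: (region_cell ab cr).
  split; first by apply: (cell_region ab) => //; rewrite ltn_ord.
  by apply/eqP/val_inj; exact: cell_x.
rewrite big_imset => [|j j' /= _ _ e]; last first.
  apply: val_inj; have := congr1 layer e.
  by rewrite !(cell_layer ab) ?ltn_ord //= => -[].
rewrite (eq_bigr (fun j : 'I_(f x) => if (j < g x)%N then t else if (j < through x)%N then extra_weight K X `|h N - h x|%N else 1)); last first.
  by move=> j _; rewrite /box_weight (cell_layer ab) ?ltn_ord // cell_x.
rewrite prod_levels; have [gf _] := gle (y := x) ltac:(lia).
by have := through_le xN; rewrite (minn_idPl gf) => /minn_idPl ->.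
Qed.

Lemma prod_blocks :
  \prod_(D in blocks) strip_weight K X (strip_length D) =
  \prod_(1 <= x < N.+1) (t ^+ g x * extra_weight K X `|h N - h x|%N ^+ (through x - g x)).
Proof.
transitivity (\prod_(D in blocks) \prod_(c in D) box_weight c).
  apply: eq_bigr => D /(mem_blocks ab gle)[j [x0 [x1 [run ->]]]]; exact: run_weight run.
have partB : partition blocks region by apply: preim_partitionP.
have /and3P[_ triv _] := partB.
rewrite -(big_trivIset _ triv) (cover_partition partB).
rewrite (partition_big (fun c : box => c.1) xpredT) //= big_ord_recl.
rewrite [X in X * _]big_pred0 ?mul1r => [|c]; last first.
  apply/negP => /andP[cr /eqP c1]; have := cr.
  by rewrite (regionE ab) /box_x c1.
rewrite big_add1 /= big_mkord; apply: eq_bigr => x _.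
by rewrite prod_column.
Qed.

Lemma runs_to_end l l' x : (0 < x)%N -> (x + (2 * l + l') = N)%N -> (0 < l')%N ->
    h N = h x + l'%:Z ->
  #|[set D in blocks | strip_length D == (l, l')]| = (through x - g x)%N.
Proof.
move=> x0 xN l0 hN.
have run k : (k < through x - g x)%N -> is_run (g x + k.+1) x N.
  move=> kk; have H : (g x + k.+1 <= through x)%N by lia.
  have /leq_through[|_ Hw] := H; first by lia.
  have xf := @through_le x ltac:(lia).
  by split=> //; lia.
transitivity #|[set segment (g x + k.+1) x N | k : 'I_(through x - g x)]|.
  apply: eq_card => D; rewrite in_set; apply/andP/imsetP => [[/(mem_blocks ab gle)[j [x0' [x1 [rj ->]]]] /eqP sl]|[k _ ->]].
    have [m [m' [st h1 xl cl]]] := valid_run_strip ab gle rj (valid rj).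
    move: sl; rewrite (run_strip_length ab gle rj st) => -[em em'].
    have [j0 [xx x1N] [jf gx0] jg gx1] := rj.
    have x1E : x1 = N by apply/eqP; rewrite eqn_leq x1N leqNgt; apply/negP => /cl; lia.
    have x0E : x0' = x by lia.
    rewrite x1E x0E in rj gx0 *; have jt : (j <= through x)%N by rewrite (run_through rj).
    have jk : (j - (g x).+1 < through x - g x)%N by lia.
    by exists (Ordinal jk) => //=; congr (segment _ _ _); lia.
  have rk := run k (ltn_ord k); split; first by apply/(mem_blocks ab gle); exists (g x + k.+1)%N, x, N.
  have [m [m' [st h1 xl cl]]] := valid_run_strip ab gle rk (valid rk).
  by rewrite (run_strip_length ab gle rk st); apply/eqP; congr pair; lia.
rewrite card_imset ?card_ord // => k k' e; apply: val_inj.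
have rk := run k (ltn_ord k); have [j0 _ [jf _] _ _] := rk.
have : cell x (g x + k.+1) \in segment (g x + k'.+1) x N.
  by rewrite -e; apply: (segment_cell ab) => //; lia.
have xN' : (x <= N)%N by lia.
have jx : (0 < g x + k.+1 <= f x)%N by rewrite j0.
by rewrite in_segment (cell_layer ab xN' jx) => /and3P[_ /eqP/addnI[]].
Qed.

Lemma blocks_ruleIb m : X = CaseB m ->
  ruleIb m blocks <->
  forall y, (0 < y <= N)%N -> parity_ok X `|h N - h y|%N (through y - g y)%N.
Proof.
move=> EX; have m0 : (0 < m)%N by move: okX; rewrite EX.
rewrite EX; split=> [/forallP Ib y yN|par].
  have [->|n0] := posnP (through y - g y)%N; first by rewrite /= if_same implybT.
  have run : is_run (g y).+1 y N.
    have H : ((g y).+1 <= through y)%N by lia.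
    have /leq_through[|_ Hw] := H; first by lia.
    by have := @through_le y ltac:(lia); split=> //; lia.
  have [l [l' [_ h1 xl _]]] := valid_run_strip ab gle run (valid run).
  have lN : (l < N.+1)%N by lia.
  have lN' : (l' < N.+1)%N by lia.
  have := Ib (Ordinal lN) => /forallP/(_ (Ordinal lN')) /=.
  have -> : `|h N - h y|%N = l' by lia.
  case: (leqP m l') => //= ml; rewrite (@runs_to_end l l' y) //; lia.
apply/forallP => -[l lN]; apply/forallP => -[l' lN'] /=; apply/implyP => ml.
have [e|[D]] := set_0Vmem [set D in blocks | strip_length D == (l, l')].
  by rewrite e cards0 if_same.
rewrite in_set => /andP[/(mem_blocks ab gle)[j [x [x1 [run ->]]]] /eqP sl].
have [n [n' [st h1 xl cl]]] := valid_run_strip ab gle run (valid run).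
move: sl; rewrite (run_strip_length ab gle run st) => -[en en'].
have [j0 [xx x1N] _ _ _] := run.
have x1E : x1 = N by apply/eqP; rewrite eqn_leq x1N leqNgt; apply/negP => /cl; lia.
rewrite (@runs_to_end l l' x); [|lia..|by rewrite x1E en' in h1].
have := par x ltac:(lia); rewrite /=; have -> : `|h N - h x|%N = l' by rewrite x1E in h1; lia.
by rewrite ml.
Qed.

End BlockWeights.

Section ConfigurationSum.
Context (K : comNzRingType) (X : kl_case) {N : nat} (a b : word N).
Hypotheses (okX : kl_case_ok X) (ab : bruhat a b).
Local Notation h := (path_height N (rseq b)).
Local Notation f := (depth N (rseq a) (rseq b)).
Local Notation blocks gs := (blocks a b (label N gs)).

Definition good_labels gs : bool :=
  `[< forall y, (0 < y <= N)%N -> step_ok N h f (label N gs) y >].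

Definition paired_labels gs : bool :=
  `[< forall y, (0 < y <= N)%N ->
      parity_ok X `|h N - h y|%N (through N f (label N gs) y - label N gs y)%N >].

Lemma good_labels_le gs : good_labels gs -> labels_le N f (label N gs).
Proof. by move=> /asboolP steps y /steps[]. Qed.

Lemma good_labels_valid gs : good_labels gs ->
  forall j x0 x1, is_run N f (label N gs) j x0 x1 -> valid_run N h x0 x1.
Proof.
move=> /asboolP steps j x0 x1 run.
exact: (steps_valid_run (path_height_step b) (depth0 ab) steps run).
Qed.

Lemma ruleIb_paired gs : good_labels gs ->
  (if X is CaseB m then ruleIb m (blocks gs) else true) = paired_labels gs.
Proof.
move=> good; have gle := good_labels_le good; have valid := good_labels_valid good.
rewrite /paired_labels; case EX: X => [|m]; first by apply/esym/asboolP.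
have := blocks_ruleIb okX ab gle valid EX; rewrite EX => H.
by apply/idP/asboolP => /H.
Qed.

Lemma blocks_conf gs : good_labels gs -> (blocks gs \in conf X a b) = paired_labels gs.
Proof.
move=> good; have gle := good_labels_le good; have valid := good_labels_valid good.
rewrite inE ruleIb_paired // blocks_ruleIa // preim_partitionP /=.
by have /(blocks_strips_rule0 ab gle)/andP[-> ->] := valid.
Qed.

Lemma conf_labels P : P \in conf X a b ->
  exists gs, [/\ gs \in label_seqs N N.+1, good_labels gs & P = blocks gs].
Proof.
rewrite inE => /and5P[partP /forall_inP stripP r0 rIa _].
have PE := part_blocks ab partP stripP rIa.
have gle := part_labels_le a b P; set g := part_label a b P in PE gle.
pose gs := [seq g (N - k)%N | k <- iota 0 N].
have gsE y : (0 < y <= N)%N -> label N gs y = g y.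
  move=> yN; rewrite /label (nth_map 0%N) ?size_iota; last by lia.
  by rewrite nth_iota; [congr g; lia | lia].
have {}PE : P = blocks gs by rewrite PE; apply: (eq_blocks ab) => y yN; rewrite gsE.
have gle' : labels_le N f (label N gs) by move=> y yN; rewrite gsE //; apply: gle.
exists gs; split=> //.
  rewrite mem_label_seqs size_map size_iota eqxx; apply/allP => z /mapP[k].
  rewrite mem_iota => kN ->; rewrite /= ltnS.
  have [gf _] := gle (N - k)%N ltac:(lia); apply: leq_trans gf _.
  by apply: leq_trans (depth_le ab _) _; lia.
have valid : forall j x0 x1, is_run N f (label N gs) j x0 x1 -> valid_run N h x0 x1.
  by apply/(blocks_strips_rule0 ab gle'); rewrite -PE r0 andbT; apply/forall_inP.
apply/asboolP => y yN; exact: (valid_steps (depth0 ab) gle' valid yN).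
Qed.

Lemma blocks_inj : {in [pred gs | (gs \in label_seqs N N.+1) && good_labels gs] &,
  injective (fun gs => blocks gs)}.
Proof.
move=> gs gs' /andP[+ /good_labels_le gle] /andP[+ /good_labels_le gle'] e.
rewrite !mem_label_seqs => /andP[/eqP s _] /andP[/eqP s' _].
have E := blocks_label_inj ab gle gle' e.
apply: (@eq_from_nth _ 0%N) => [|k kN]; rewrite ?s ?s' //.
rewrite s in kN; have := E (N - k)%N ltac:(lia).
by rewrite /label subKn // ltnW.
Qed.

Lemma prod_step_weight gs : good_labels gs ->
  \prod_(1 <= y < N.+1) step_weight (var_t K X) (sw K X) N (rseq a) (rseq b) gs y =
  if paired_labels gs then \prod_(D in blocks gs) strip_weight K X (strip_length D) else 0.
Proof.
move=> good; have gle := good_labels_le good; have valid := good_labels_valid good.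
rewrite (prod_blocks K okX ab gle valid) /paired_labels /step_weight; case: asboolP => [par|npar].
  by apply: eq_big_nat => y yN; rewrite sw_extra par //; lia.
have [y [yN np]] : exists y, (0 < y <= N)%N /\
    ~~ parity_ok X `|h N - h y|%N (through N f (label N gs) y - label N gs y)%N.
  apply: contrapT => none; apply: npar => y yN; apply/negPn/negP => np; apply: none.
  by exists y.
rewrite (bigD1_seq y) ?iota_uniq ?mem_index_iota //=.
by rewrite sw_extra (negbTE np) mulr0 mul0r.
Qed.

Lemma Qpoly_scan : Qpoly K X a b =
  scan (var_t K X) (sw K X) 0 (count2 (rseq b) - count2 (rseq a)) [::] (rseq a) (rseq b).
Proof.
rewrite (@scan_steps _ _ _ N N.+1) ?size_rseq //; [|exact: sw0|exact/bruhatP].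
pose S := [seq gs <- label_seqs N N.+1 | good_labels gs && paired_labels gs].
rewrite /Qpoly -big_enum (perm_big [seq blocks gs | gs <- S]) /=; last first.
  apply: uniq_perm; first exact: enum_uniq.
    rewrite map_inj_in_uniq ?filter_uniq ?uniq_label_seqs // => gs gs'.
    rewrite !mem_filter => /andP[/andP[g1 _] s1] /andP[/andP[g2 _] s2].
    by apply: blocks_inj; rewrite inE ?s1 ?s2 ?g1 ?g2.
  move=> P; rewrite mem_enum; apply/idP/mapP => [PC|[gs]].
    have [gs [gsS good PE]] := conf_labels PC.
    by exists gs => //; rewrite mem_filter gsS good -blocks_conf // -PE PC.
  by rewrite mem_filter => /andP[/andP[good par] _] ->; rewrite blocks_conf.
rewrite big_map big_filter big_mkcondr /= [RHS]big_mkcond [LHS]big_mkcond.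
apply: eq_bigr => gs _; case: (boolP (good_labels gs)) => [good|ng].
  by move: (good); rewrite /good_labels => ->; rewrite prod_step_weight.
by move: ng; rewrite /good_labels => /negbTE ->.
Qed.

End ConfigurationSum.

Theorem theorem21 (R : realType) (X : kl_case) (N : nat)
    (alpha beta : word N) :
  kl_case_ok X -> (0 < N)%N -> bruhat alpha beta ->
  Qpoly (complex R) X alpha beta = KLpoly (complex R) X alpha beta.
Proof. by move=> okX _ ab; rewrite Qpoly_scan // KLpoly_scan. Qed.
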